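(* Let $a>b>0$ be integers. For $i=0,\dots,a$ put $C_i=\mathcal E_1^{(a-i)}\mathcal E_2^{(b)}\mathcal E_1^{(i)}\{i(a-b-1)\}$, and for $i=0,\dots,a-1$ let $d_i:C_i\to C_{i+1}$ be the morphism $$d_i=\bigl(1_{\mathcal E_1^{(a-i-1)}}\otimes 1_{\mathcal E_2^{(b)}}\otimes M^1_{1,i}\bigr)\circ\bigl(1_{\mathcal E_1^{(a-i-1)}}\otimes X^{12}_{1,b}\otimes 1_{\mathcal E_1^{(i)}}\bigr)\circ\bigl(S^1_{a-i-1,1}\otimes 1_{\mathcal E_2^{(b)}}\otimes 1_{\mathcal E_1^{(i)}}\bigr).$$ Then $$0\to C_0\xrightarrow{d_0}C_1\xrightarrow{d_1}\cdots\xrightarrow{d_{a-1}}C_a\to 0$$ is a complex in $\dot{\mathcal U}^+_3$ which is homotopic to zero (i.e. its identity map is null-homotopic through morphisms of $\dot{\mathcal U}^+_3$).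
   Context: The category $\mathcal U^+_3$. Put $i\cdot i=2$ for $i\in\{1,2\}$ and $1\cdot 2=2\cdot 1=-1$. Let $\mathcal H$ be the strict monoidal $\mathbb Z$-linear category with $\mathbb Z$-graded Hom groups, generated by objects $\mathcal E_1,\mathcal E_2$ (tensor product written as juxtaposition of objects) and morphisms $x_i:\mathcal E_i\to\mathcal E_i$ of degree $2$ (a dot) and $\tau_{ij}:\mathcal E_i\mathcal E_j\to\mathcal E_j\mathcal E_i$ of degree $-i\cdot j$ (a crossing), for $i,j\in\{1,2\}$, subject to the following relations ($1$ denotes identity morphisms, products are compositions with the rightmost factor applied first): (1) $\tau_{ii}(x_i\otimes 1)-(1\otimes x_i)\tau_{ii}=1=(x_i\otimes 1)\tau_{ii}-\tau_{ii}(1\otimes x_i)$; (2) $\tau_{ii}\tau_{ii}=0$; (3) for $i\ne j$: $\tau_{ji}\tau_{ij}=x_i\otimes 1+1\otimes x_j$; (4) for $i\neq j$: $(x_j\otimes 1)\tau_{ij}=\tau_{ij}(1\otimes x_j)$ and $(1\otimes x_i)\tau_{ij}=\tau_{ij}(x_i\otimes 1)$; (5) for all $i,j,k$: $(\tau_{jk}\otimes 1)(1\otimes\tau_{ik})(\tau_{ij}\otimes 1)-(1\otimes\tau_{ij})(\tau_{ik}\otimes 1)(1\otimes\tau_{jk})$ equals $1$ if $i=k\ne j$ and equals $0$ otherwise. Objects of $\mathcal U^+_3$ are formal finite direct sums of $\mathcal E_{i_1}\cdots\mathcal E_{i_k}\{t\}$ with $t\in\mathbb Z$, $i_s\in\{1,2\}$,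 $k\geq 0$; the group $\mathrm{Hom}(X\{t\},Y\{t'\})$ is the homogeneous part of degree $t-t'$ of $\mathrm{Hom}_{\mathcal H}(X,Y)$. It is monoidal, with shifts adding under tensor product. $\dot{\mathcal U}^+_3$ is the Karoubi envelope (idempotent completion) of $\mathcal U^+_3$; its objects are pairs $(X,e)$ with $e$ an idempotent endomorphism of $X$, and morphisms $(X,e)\to(Y,f)$ are the morphisms $\varphi:X\to Y$ with $f\varphi e=\varphi$. The shift $\{t\}$ extends to all objects. Divided powers. On $\mathcal E_i^a=\mathcal E_i\cdots\mathcal E_i$ let $x_1,\dots,x_a$ denote the dots on the strands numbered left to right, $\delta_a=x_1^{a-1}x_2^{a-2}\cdots x_{a-1}$, and $D_a$ the composite of crossings $\tau_{ii}$ along a reduced word of the longest element of the symmetric group $S_a$. Then $e_a=\delta_aD_a$ is an idempotent of degree $0$, and $\mathcal E_i^{(a)}:=(\mathcal E_i^a,e_a)\{-a(a-1)/2\}$, with $\mathcal E_i^{(0)}$ the monoidal unit. Thick diagrams. A homogeneous morphism of degree $s$ from $X$ to $Y$ means a morphism $X\{t\}\to Y\{t'\}$ with $t-t'=s$. The following are the generating thick diagrams (strand of thickness $a$ and colour $i$ = $\mathcal E_i^{(a)}$; strands of thickness $0$ are omitted): - splitter $S^i_{k,l}:\mathcal E_i^{(k+l)}\to\mathcal E_i^{(k)}\mathcal E_i^{(l)}$, of degree $-kl$, represented by $(\delta_k\otimes\delta_l)D_{k+l}$ on $\mathcal E_i^{k+l}$; - merger $M^i_{k,l}:\mathcal E_i^{(k)}\mathcal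 E_i^{(l)}\to\mathcal E_i^{(k+l)}$, of degree $-kl$, represented by $e_{k+l}=\delta_{k+l}D_{k+l}$; - for $i\ne j$, the crossing $X^{ij}_{k,l}:\mathcal E_i^{(k)}\mathcal E_j^{(l)}\to\mathcal E_j^{(l)}\mathcal E_i^{(k)}$, of degree $kl$, represented by $\chi\circ(e_k\otimes e_l)$, where $\chi:\mathcal E_i^k\mathcal E_j^l\to\mathcal E_j^l\mathcal E_i^k$ is the diagram in which each of the $k$ strands of colour $i$ crosses each of the $l$ strands of colour $j$ exactly once and strands of equal colour do not cross. With these degrees each $d_i$ is a morphism $C_i\to C_{i+1}$ of $\dot{\mathcal U}^+_3$. *)

(* Defs.v *)
From HB Require Import structures.
From Stdlib Require Import Setoid Morphisms.
From mathcomp Require Import all_boot all_order all_algebra.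

Set Implicit Arguments.
Unset Strict Implicit.
Unset Printing Implicit Defensive.

Import GRing.Theory.

Variant colour := One | Two.

Definition bool_of_colour (i : colour) : bool := if i is One then true else false.
Definition colour_of_bool (b : bool) : colour := if b then One else Two.
Lemma bool_of_colourK : cancel bool_of_colour colour_of_bool.
Proof. by case. Qed.
HB.instance Definition _ := Equality.copy colour (can_type bool_of_colourK).

Definition pairing (i j : colour) : int := if i == j then 2%R else (-1)%R.

(* Words in the colours are the objects of the category H; the tensor product
   of objects is concatenation and the unit is the empty word. *)
Definition word := seq colour.

(** * The graded category H, presented by generators and relations *)

(* Morphisms of H are represented by raw expressions.  Every expression has a
   computed domain and codomain; only the well-formed ones ([dwf]) denote
   morphisms.  [Comp g f] is g after f.  Untyped expressions make the strict
   associativity of the tensor product expressible without casts. *)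
Inductive diag : Type :=
| Id of word
| Dot of colour
| Cross of colour & colour
| Comp of diag & diag
| Tens of diag & diag
| Zero of word & word
| Add of diag & diag
| Opp of diag.

Fixpoint ddom (f : diag) : word :=
  match f with
  | Id A => A
  | Dot i => [:: i]
  | Cross i j => [:: i; j]
  | Comp _ f => ddom f
  | Tens f g => ddom f ++ ddom g
  | Zero A _ => A
  | Add f _ => ddom f
  | Opp f => ddom f
  end.

Fixpoint dcod (f : diag) : word :=
  match f with
  | Id A => A
  | Dot i => [:: i]
  | Cross i j => [:: j; i]
  | Comp g _ => dcod g
  | Tens f g => dcod f ++ dcod g
  | Zero _ B => B
  | Add f _ => dcod f
  | Opp f => dcod f
  end.

Fixpoint dwf (f : diag) : bool :=
  match f with
  | Comp g f => [&& dwf g, dwf f & dcod f == ddom g]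
  | Tens f g => dwf f && dwf g
  | Add f g => [&& dwf f, dwf g, ddom f == ddom g & dcod f == dcod g]
  | Opp f => dwf f
  | _ => true
  end.

Definition Sub f g := Add f (Opp g).

(* Equality of morphisms of H: the congruence generated by the axioms of a
   strict monoidal Z-linear category and by the defining relations.  On
   well-formed expressions it only relates parallel morphisms, see [deq_type]
   below; thus Hom_H(A, B) is the quotient by [deq] of the set of well-formed
   expressions with domain A and codomain B. *)
Inductive deq : diag -> diag -> Prop :=
| deq_refl f : deq f f
| deq_sym f g : deq f g -> deq g f
| deq_trans f g h : deq f g -> deq g h -> deq f h
| deq_Comp g g' f f' : deq g g' -> deq f f' -> deq (Comp g f) (Comp g' f')
| deq_Tens f f' g g' : deq f f' -> deq g g' -> deq (Tens f g) (Tens f' g')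
| deq_Add f f' g g' : deq f f' -> deq g g' -> deq (Add f g) (Add f' g')
| deq_Opp f f' : deq f f' -> deq (Opp f) (Opp f')
(* category *)
| deq_CompA h g f : deq (Comp h (Comp g f)) (Comp (Comp h g) f)
| deq_Comp1l f : deq (Comp (Id (dcod f)) f) f
| deq_Comp1r f : deq (Comp f (Id (ddom f))) f
(* abelian groups *)
| deq_AddA f g h : deq (Add f (Add g h)) (Add (Add f g) h)
| deq_AddC f g : deq (Add f g) (Add g f)
| deq_Add0 f : deq (Add f (Zero (ddom f) (dcod f))) f
| deq_AddN f : dwf f -> deq (Add f (Opp f)) (Zero (ddom f) (dcod f))
(* biadditivity of composition and tensor product *)
| deq_CompDl g g' f : deq (Comp (Add g g') f) (Add (Comp g f) (Comp g' f))
| deq_CompDr g f f' : deq (Comp g (Add f f')) (Add (Comp g f) (Comp g f'))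
| deq_TensDl f f' g : deq (Tens (Add f f') g) (Add (Tens f g) (Tens f' g))
| deq_TensDr f g g' : deq (Tens f (Add g g')) (Add (Tens f g) (Tens f g'))
(* strict monoidal structure *)
| deq_TensA f g h : deq (Tens f (Tens g h)) (Tens (Tens f g) h)
| deq_Tens1l f : deq (Tens (Id [::]) f) f
| deq_Tens1r f : deq (Tens f (Id [::])) f
| deq_TensId A B : deq (Tens (Id A) (Id B)) (Id (A ++ B))
| deq_interchange g g' f f' : dcod f = ddom g -> dcod f' = ddom g' ->
    deq (Comp (Tens g g') (Tens f f')) (Tens (Comp g f) (Comp g' f'))
(* defining relations *)
| rel_nil_l i :
    deq (Sub (Comp (Cross i i) (Tens (Dot i) (Id [:: i])))
             (Comp (Tens (Id [:: i]) (Dot i)) (Cross i i)))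
        (Id [:: i; i])
| rel_nil_r i :
    deq (Sub (Comp (Tens (Dot i) (Id [:: i])) (Cross i i))
             (Comp (Cross i i) (Tens (Id [:: i]) (Dot i))))
        (Id [:: i; i])
| rel_sq i : deq (Comp (Cross i i) (Cross i i)) (Zero [:: i; i] [:: i; i])
| rel_r2 i j : i != j ->
    deq (Comp (Cross j i) (Cross i j))
        (Add (Tens (Dot i) (Id [:: j])) (Tens (Id [:: i]) (Dot j)))
| rel_slide_l i j : i != j ->
    deq (Comp (Tens (Dot j) (Id [:: i])) (Cross i j))
        (Comp (Cross i j) (Tens (Id [:: i]) (Dot j)))
| rel_slide_r i j : i != j ->
    deq (Comp (Tens (Id [:: j]) (Dot i)) (Cross i j))
        (Comp (Cross i j) (Tens (Dot i) (Id [:: j])))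
| rel_r3 i j k :
    deq (Sub (Comp (Tens (Cross j k) (Id [:: i]))
                   (Comp (Tens (Id [:: j]) (Cross i k))
                         (Tens (Cross i j) (Id [:: k]))))
             (Comp (Tens (Id [:: k]) (Cross i j))
                   (Comp (Tens (Cross i k) (Id [:: j]))
                         (Tens (Id [:: i]) (Cross j k)))))
        (if (i == k) && (i != j) then Id [:: i; j; k]
         else Zero [:: i; j; k] [:: k; j; i]).

Lemma eqseq_catl (A B C : word) : (A ++ B == A ++ C) = (B == C).
Proof. by rewrite eqseq_cat // eqxx. Qed.

Lemma eqseq_catr (A B C : word) : (B ++ A == C ++ A) = (B == C).
Proof.
apply/eqP/eqP => [/(congr1 rev)|-> //]; rewrite !rev_cat => /eqP.
by rewrite eqseq_catl => /eqP/(can_inj revK).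
Qed.

#[global] Instance deq_Equivalence : Equivalence deq.
Proof.
split; [exact: deq_refl | exact: deq_sym | exact: deq_trans].
Qed.

#[global] Instance Comp_Proper : Proper (deq ==> deq ==> deq) Comp.
Proof. by move=> g g' gg' f f' ff'; apply: deq_Comp. Qed.

#[global] Instance Tens_Proper : Proper (deq ==> deq ==> deq) Tens.
Proof. by move=> f f' ff' g g' gg'; apply: deq_Tens. Qed.

#[global] Instance Add_Proper : Proper (deq ==> deq ==> deq) Add.
Proof. by move=> f f' ff' g g' gg'; apply: deq_Add. Qed.

#[global] Instance Opp_Proper : Proper (deq ==> deq) Opp.
Proof. by move=> f f' ff'; apply: deq_Opp. Qed.

Lemma deq_type f g : deq f g ->
  dwf f = dwf g /\ (dwf f -> ddom f = ddom g /\ dcod f = dcod g).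
Proof.
elim=> {f g} //=.
- by move=> f g _ [-> H]; split=> // /H [-> ->].
- move=> f g h _ [e1 H1] _ [e2 H2]; split; first by rewrite e1.
  by move=> wf; case: (H1 wf) => -> ->; apply: H2; rewrite -e1.
- move=> g g' f f' _ [<- Hg] _ [<- Hf].
  case wg: (dwf g) => //; case wf: (dwf f) => //=.
  by have [-> ->] := Hg wg; have [-> ->] := Hf wf.
- move=> f f' g g' _ [<- Hf] _ [<- Hg]; split=> // /andP[wf wg].
  by have [-> ->] := Hg wg; have [-> ->] := Hf wf.
- move=> f f' g g' _ [<- Hf] _ [<- Hg].
  case wf: (dwf f) => //; case wg: (dwf g) => //=.
  by have [-> ->] := Hg wg; have [-> ->] := Hf wf.
- move=> h g f; split=> //.
  by case: (dwf h) => //; case: (dwf g) => //; case: (dwf f);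
     rewrite ?andbF //= andbC.
- by move=> f; rewrite eqxx andbT.
- by move=> f; rewrite eqxx !andbT.
- move=> f g h; case: (dwf f) => //; case: (dwf g) => //=;
    case: (dwf h); rewrite ?andbF //=.
  split; last by [].
  apply/idP/idP => /andP[/andP[/eqP e1 /eqP e2] /andP[/eqP e3 /eqP e4]].
    by rewrite e3 e4 e1 e2 !eqxx.
  by rewrite -e3 -e4 -e1 -e2 !eqxx.
- move=> f g; rewrite (eq_sym (ddom g)) (eq_sym (dcod g)); split.
    by case: (dwf f); case: (dwf g).
  by case/and4P => _ _ /eqP -> /eqP ->.
- by move=> f; rewrite !eqxx !andbT.
- by move=> f wf; rewrite !eqxx wf.
- move=> g g' f; split=> //; rewrite eqxx /=.
  case: (dwf g) => //; case: (dwf g') => //=; case: (dwf f); rewrite ?andbF //=.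
  case: (ddom g =P ddom g') => [->|ne] /=.
    by case: (dcod f == ddom g'); rewrite ?andbF ?andbT.
  by case: eqP => //= ->; case: eqP.
- move=> g f f'; split=> //; rewrite eqxx andbT.
  case: (dwf g) => //; case: (dwf f) => //; case: (dwf f') => //=; rewrite ?andbF //.
  case: (dcod f =P dcod f') => [->|ne]; rewrite ?andbF ?andbT /=.
    by case: (ddom f == ddom f'); case: (dcod f' == ddom g).
  by case: eqP => //= e; case: eqP => //= e'; case: ne; rewrite e e'.
- move=> f f' g; split=> //; rewrite !eqseq_catr.
  by case: (dwf f); case: (dwf f'); case: (dwf g); rewrite ?andbF ?andbT.
- move=> f g g'; split=> //; rewrite !eqseq_catl.
  by case: (dwf f); case: (dwf g); case: (dwf g').
- by move=> f g h; rewrite !catA andbA.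
- by move=> f; rewrite !cats0 andbT.
- move=> g g' f f' -> ->; rewrite !eqxx !andbT; split=> //.
  by case: (dwf g); case: (dwf g'); case: (dwf f); case: (dwf f').
- by move=> i; rewrite !eqxx.
- by move=> i; rewrite !eqxx.
- by move=> i; rewrite !eqxx.
- by move=> i j _; rewrite !eqxx.
- by move=> i j _; rewrite !eqxx.
- by move=> i j _; rewrite !eqxx.
- move=> i j k; rewrite !eqxx /=.
  by case: ifP => //= /andP[/eqP -> _].
Qed.

Inductive hdeg : diag -> int -> Prop :=
| hdeg_Id A : hdeg (Id A) 0%R
| hdeg_Dot i : hdeg (Dot i) 2%R
| hdeg_Cross i j : hdeg (Cross i j) (- pairing i j)%R
| hdeg_Comp g f s t : hdeg g s -> hdeg f t -> hdeg (Comp g f) (s + t)%R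
| hdeg_Tens f g s t : hdeg f s -> hdeg g t -> hdeg (Tens f g) (s + t)%R
| hdeg_Zero A B s : hdeg (Zero A B) s
| hdeg_Add f g s : hdeg f s -> hdeg g s -> hdeg (Add f g) s
| hdeg_Opp f s : hdeg f s -> hdeg (Opp f) s.

(* [f] represents an element of the homogeneous part of degree [s] of
   Hom_H(A, B). *)
Definition hhom (s : int) (A B : word) (f : diag) : Prop :=
  [/\ dwf f, ddom f = A, dcod f = B & exists2 g, deq f g & hdeg g s].

(** * The category U *)

(* The list [:: (A_0, t_0); (A_1, t_1); ...] is the formal direct sum of the
   A_p{t_p}. *)
Definition uobj := seq (word * int).

Definition uword (X : uobj) (p : nat) : word := (nth ([::], 0%R) X p).1.
Definition udeg (X : uobj) (p : nat) : int := (nth ([::], 0%R) X p).2.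

Definition uunit : uobj := [:: ([::], 0%R)].
Definition ushobj (t : int) (X : uobj) : uobj := [seq (A.1, A.2 + t)%R | A <- X].
Definition utenobj (X Y : uobj) : uobj :=
  [seq (A.1 ++ B.1, (A.2 + B.2)%R) | A <- X, B <- Y].

(* A matrix of morphisms of H; the entry [umx p q] goes from the q-th summand
   of the domain to the p-th summand of the codomain, and entries out of range
   are irrelevant. *)
Record uarr := UArr { udom : uobj; ucod : uobj; umx : nat -> nat -> diag }.

(* Homogeneous morphisms of degree [s] from X to Y; the entries
   A{t} -> B{t'} have degree s + t - t' in H. *)
Definition uhom (s : int) (X Y : uobj) (f : uarr) : Prop :=
  [/\ udom f = X, ucod f = Y &
      forall p q, (p < size Y)%N -> (q < size X)%N ->
        hhom (s + udeg X q - udeg Y p)%R (uword X q) (uword Y p) (umx f p q)].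

(* The morphisms of U are those of degree 0. *)
Definition umor := uhom 0%R.

Definition ueq (f g : uarr) : Prop :=
  [/\ udom f = udom g, ucod f = ucod g &
      forall p q, (p < size (ucod f))%N -> (q < size (udom f))%N ->
        deq (umx f p q) (umx g p q)].

Definition uzero (X Y : uobj) : uarr :=
  UArr X Y (fun p q => Zero (uword X q) (uword Y p)).

Definition uadd (f g : uarr) : uarr :=
  UArr (udom f) (ucod f) (fun p q => Add (umx f p q) (umx g p q)).

Definition ucomp (g f : uarr) : uarr :=
  UArr (udom f) (ucod g)
    (fun r q => \big[Add/Zero (uword (udom f) q) (uword (ucod g) r)]_(p < size (ucod f))
                  Comp (umx g r p) (umx f p q)).

(* [allpairs] enumerates in row-major order, whence the indices. *)
Definition uten (f g : uarr) : uarr :=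
  UArr (utenobj (udom f) (udom g)) (utenobj (ucod f) (ucod g))
    (fun p q => Tens (umx f (p %/ size (ucod g)) (q %/ size (udom g)))
                     (umx g (p %% size (ucod g)) (q %% size (udom g)))).

(* A morphism X -> Y of degree s seen as a morphism X{t} -> Y{t'}, of degree
   s - (t - t'). *)
Definition ureshift (t t' : int) (f : uarr) : uarr :=
  UArr (ushobj t (udom f)) (ushobj t' (ucod f)) (umx f).

(** * The Karoubi envelope *)

Record kobj := KObj { kcar : uobj; kidem : uarr }.

(* [kobj] is the type of raw pairs; [kwf] selects the objects. *)
Definition kwf (P : kobj) : Prop :=
  umor (kcar P) (kcar P) (kidem P) /\ ueq (ucomp (kidem P) (kidem P)) (kidem P).

Definition kmor (P Q : kobj) (f : uarr) : Prop :=
  umor (kcar P) (kcar Q) f /\ ueq (ucomp (kidem Q) (ucomp f (kidem P))) f.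

(* The identity of (X, e) in the Karoubi envelope is e. *)
Definition kid (P : kobj) : uarr := kidem P.

Definition kzero : kobj := KObj [::] (uzero [::] [::]).

Definition kten (P Q : kobj) : kobj :=
  KObj (utenobj (kcar P) (kcar Q)) (uten (kidem P) (kidem Q)).

Definition kshift (t : int) (P : kobj) : kobj :=
  KObj (ushobj t (kcar P)) (ureshift t t (kidem P)).

(* The arrow represented by a morphism of H, between objects whose underlying
   formal sum has a single summand. *)
Definition krep (P Q : kobj) (f : diag) : uarr :=
  UArr (kcar P) (kcar Q) (fun _ _ => f).

(** * Complexes *)

Definition is_complex (C : int -> kobj) (d : int -> uarr) : Prop :=
  [/\ forall n, kwf (C n),
      forall n, kmor (C n) (C (n + 1)%R) (d n) &
      forall n, ueq (ucomp (d (n + 1)%R) (d n))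
                    (uzero (kcar (C n)) (kcar (C (n + 1 + 1)%R)))].

Definition null_homotopic (C : int -> kobj) (d : int -> uarr) : Prop :=
  exists2 h : int -> uarr,
    forall n, kmor (C n) (C (n - 1)%R) (h n) &
    forall n, ueq (kid (C n))
                  (uadd (ucomp (d (n - 1)%R) (h n)) (ucomp (h (n + 1)%R) (d n))).

(* The complex 0 -> C 0 -> C 1 -> ... -> C m -> 0, extended by zero objects. *)
Definition fin_obj (m : nat) (C : nat -> kobj) (n : int) : kobj :=
  if n is Posz k then if (k <= m)%N then C k else kzero else kzero.

Definition fin_diff (m : nat) (C : nat -> kobj) (d : nat -> uarr) (n : int) : uarr :=
  let zero := uzero (kcar (fin_obj m C n)) (kcar (fin_obj m C (n + 1)%R)) in
  if n is Posz k then if (k < m)%N then d k else zero else zero.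

(** * Divided powers and thick diagrams *)

Fixpoint dots (i : colour) (m : nat) : diag :=
  if m is m'.+1 then Comp (Dot i) (dots i m') else Id [:: i].

(* delta_(a+1) = x_1^a delta_a', with delta_a' on the strands 2, ..., a+1 *)
Fixpoint delta (i : colour) (a : nat) : diag :=
  if a is a'.+1 then Tens (dots i a') (delta i a') else Id [::].

(* On a+1 strands: the last strand crosses all others and becomes the first. *)
Fixpoint last_to_first (i : colour) (a : nat) : diag :=
  if a is a'.+1 then
    Comp (Tens (Cross i i) (Id (nseq a' i))) (Tens (Id [:: i]) (last_to_first i a'))
  else Id [:: i].

(* The chosen reduced word for the longest element w of the symmetric group on
   a+1 letters is (s_a)(s_(a-1) s_a) ... (s_1 ... s_a), rightmost first. *)
Fixpoint longest (i : colour) (a : nat) : diag :=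
  if a is a'.+1 then
    Comp (Tens (Id [:: i]) (longest i a')) (last_to_first i a')
  else Id [::].

Definition thick_idem (i : colour) (a : nat) : diag := Comp (delta i a) (longest i a).

(* Each strand of colour i crosses l strands of colour j, one strand at a
   time. *)
Fixpoint cross1 (i j : colour) (l : nat) : diag :=
  if l is l'.+1 then
    Comp (Tens (Id [:: j]) (cross1 i j l')) (Tens (Cross i j) (Id (nseq l' j)))
  else Id [:: i].

Fixpoint chi (i j : colour) (k l : nat) : diag :=
  if k is k'.+1 then
    Comp (Tens (cross1 i j l) (Id (nseq k' i))) (Tens (Id [:: i]) (chi i j k' l))
  else Id (nseq l j).

Lemma thick_idem0 i : deq (thick_idem i 0) (Id [::]).
Proof. exact: (deq_Comp1l (Id [::])). Qed.

(* By [thick_idem0], thickness 0 gives the monoidal unit. *)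
Definition thick (i : colour) (a : nat) : kobj :=
  let X : uobj := [:: (nseq a i, 0%R)] in
  kshift (- ((a * a.-1)./2)%:Z)%R (KObj X (UArr X X (fun _ _ => thick_idem i a))).

Definition splitter (i : colour) (k l : nat) : uarr :=
  krep (thick i (k + l)) (kten (thick i k) (thick i l))
       (Comp (Tens (delta i k) (delta i l)) (longest i (k + l))).

Definition merger (i : colour) (k l : nat) : uarr :=
  krep (kten (thick i k) (thick i l)) (thick i (k + l)) (thick_idem i (k + l)).

Definition crossing (i j : colour) (k l : nat) : uarr :=
  krep (kten (thick i k) (thick j l)) (kten (thick j l) (thick i k))
       (Comp (chi i j k l) (Tens (thick_idem i k) (thick_idem j l))).

(** * The complex *)

Definition serre_shift (a b i : nat) : int := (i%:Z * (a%:Z - b%:Z - 1))%R.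

Definition serre_obj (a b i : nat) : kobj :=
  kshift (serre_shift a b i)
    (kten (kten (thick One (a - i)) (thick Two b)) (thick One i)).

(* The composite of thick diagrams is homogeneous of nonzero degree between the
   unshifted objects; [ureshift] makes it a morphism of degree 0. *)
Definition serre_diff (a b i : nat) : uarr :=
  ureshift (serre_shift a b i) (serre_shift a b i.+1)
    (ucomp (uten (uten (kid (thick One (a - i - 1))) (kid (thick Two b)))
                 (merger One 1 i))
    (ucomp (uten (uten (kid (thick One (a - i - 1))) (crossing One Two 1 b))
                 (kid (thick One i)))
           (uten (uten (splitter One (a - i - 1) 1) (kid (thick Two b)))
                 (kid (thick One i))))).

(* Main.v *)
(* On E_1^(p) E_2^(b) E_1^(q) with p + q = a, the homotopy h detaches a strand
   from the right thick strand, puts m = a - b - 1 dots on it, moves it to the left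
   across the b strands of colour 2, merges it into the left thick strand, and
   carries the sign (-1)^p.  In both hd and dh one strand of colour 1 moves to the
   right and another one to the left.  Straightening them by relations (5) and (1)
   shows that hd + dh is a sum of terms in which the strands of colour 1 do not
   pass the strands of colour 2 and carry polynomials in the dots of total degree
   p + q - 2.  The longest elements on the left and on the right kill such a term
   unless exactly p - 1 and q - 1 dots sit on the two thick strands, and exactly one
   monomial of this kind occurs; it gives the identity.

   The calculations take place among the families of morphisms from a fixed word
   to all words, on which dots and crossings act by their position; a diagram is
   determined by its action on the identity of its domain. *)

(* What survives in hd + dh is a divided difference. Let Q(u) be the product of the x_i + u over the
   strands of colour 2, which relation (3) produces from double crossings. Relation (5) contributes
   the divided difference of Q and relation (1) that of u^m; by the Leibniz rule they add up to the
   divided difference of u^m Q(u) at the two strands that have moved. Its degree is m + b - 1 = a -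
   2, and in its top part in these two variables every monomial has coefficient 1. The value m = a -
   b - 1 is also the one that makes h homogeneous of degree 0, and b < a makes it a natural number.

   The sign of h has two tasks: it makes the fully crossed terms of hd and dh cancel, and it offsets
   the sign (-1)^p with which a leftward sweep over p strands evaluates p dots.

   The obstacle is bookkeeping: the relations depend on colours, crossings change the word, and
   every layer of thick diagrams carries idempotents. Colours are therefore hypotheses on vectors
   and not types, and the idempotents are absorbed into longest elements before any relation between
   the two colours is used. *)
From HB Require Import structures.
From Stdlib Require Import Setoid Morphisms.
From mathcomp Require Import all_boot all_order all_algebra.
From mathcomp Require Import generic_quotient boolp.
From mathcomp Require Import zify ring.
Require Import Defs.

Set Implicit Arguments.
Unset Strict Implicit.
Unset Printing Implicit Defensive.

Import GRing.Theory.

(** * Operators on strands *)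

(* In the intended model the elements are families of morphisms from a fixed
   word to all words, and [col k c u] says that u vanishes at the words whose
   k-th letter does not exist or is not c. *)
Record klrModule := KlrModule {
  klr_sort :> zmodType;
  dot : nat -> klr_sort -> klr_sort;
  crs : nat -> klr_sort -> klr_sort;
  col : nat -> colour -> klr_sort -> Prop;
  dotD : forall k u v, (dot k (u + v) = dot k u + dot k v)%R;
  crsD : forall k u v, (crs k (u + v) = crs k u + crs k v)%R;
  col0 : forall k c, col k c 0%R;
  colD : forall k c u v, col k c u -> col k c v -> col k c (u + v)%R;
  colN : forall k c u, col k c u -> col k c (- u)%R;
  col_dot : forall j k c u, col k c u -> col k c (dot j u);
  col_crs : forall j k c u, (k < j)%N || (j.+1 < k)%N -> col k c u -> col k c (crs j u);
  col_crs_l : forall j c u, col j.+1 c u -> col j c (crs j u);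
  col_crs_r : forall j c u, col j c u -> col j.+1 c (crs j u);
  dotC : forall j k u, dot j (dot k u) = dot k (dot j u);
  crs_dotC : forall j k u, (k < j)%N || (j.+1 < k)%N ->
    crs j (dot k u) = dot k (crs j u);
  crsC : forall j k u, (j.+1 < k)%N -> crs j (crs k u) = crs k (crs j u);
  crs_dot : forall k c u, col k c u -> col k.+1 c u ->
    crs k (dot k u) = (dot k.+1 (crs k u) + u)%R;
  dot_crs : forall k c u, col k c u -> col k.+1 c u ->
    dot k (crs k u) = (crs k (dot k.+1 u) + u)%R;
  crs_sq : forall k c u, col k c u -> col k.+1 c u -> crs k (crs k u) = 0%R;
  crs_r2 : forall k c d u, c != d -> col k c u -> col k.+1 d u ->
    crs k (crs k u) = (dot k u + dot k.+1 u)%R;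
  slide_l : forall k c d u, c != d -> col k c u -> col k.+1 d u ->
    dot k (crs k u) = crs k (dot k.+1 u);
  slide_r : forall k c d u, c != d -> col k c u -> col k.+1 d u ->
    dot k.+1 (crs k u) = crs k (dot k u);
  braid : forall k c d e u, col k c u -> col k.+1 d u -> col k.+2 e u ->
    ~~ ((c == e) && (c != d)) ->
    crs k (crs k.+1 (crs k u)) = crs k.+1 (crs k (crs k.+1 u));
  braid1 : forall k c d u, col k c u -> col k.+1 d u -> col k.+2 c u -> c != d ->
    (crs k (crs k.+1 (crs k u)) = crs k.+1 (crs k (crs k.+1 u)) + u)%R
}.

Section KlrModule.
Local Open Scope ring_scope.
Variable V : klrModule.
Implicit Types (u v w z : V) (k l j n m p q r s : nat) (c d : colour).
Local Notation x := (@dot V).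
Local Notation t := (@crs V).

Lemma dot0 k : x k 0 = 0.
Proof. by apply: (addrI (x k 0)); rewrite -dotD !addr0. Qed.

Lemma crs0 k : t k 0 = 0.
Proof. by apply: (addrI (t k 0)); rewrite -crsD !addr0. Qed.

Definition mono k n c z := forall j, (k <= j < k + n)%N -> col j c z.

Lemma monoW k n l m c z :
  mono k n c z -> (k <= l)%N -> (l + m <= k + n)%N -> mono l m c z.
Proof. by move=> h *; move=> j hj; apply: h; lia. Qed.

(* With [b = false] only dots are allowed, so that the operators are
   polynomials in the dots. *)
Inductive local_op (b : bool) l h : (V -> V) -> Prop :=
| loc_id : local_op b l h id
| loc_zero : local_op b l h (fun=> 0)
| loc_x j : (l <= j < h)%N -> local_op b l h (x j)
| loc_t j : b -> (l <= j)%N && (j.+1 < h)%N -> local_op b l h (t j)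
| loc_comp f g : local_op b l h f -> local_op b l h g -> local_op b l h (f \o g)
| loc_add f g : local_op b l h f -> local_op b l h g -> local_op b l h (fun z => f z +
  g z).

Lemma loc_x1 b j : local_op b j j.+1 (x j).
Proof. by apply: loc_x; lia. Qed.

Lemma loc_t1 j : local_op true j j.+2 (t j).
Proof. by apply: loc_t; lia. Qed.

Lemma locW b b' l h l' h' f : local_op b l h f ->
  b ==> b' -> (l' <= l)%N -> (h <= h')%N -> local_op b' l' h' f.
Proof.
move=> H hb hl hh; elim: H => [||j hj|j bt hj|f1 f2 _ H1 _ H2|f1 f2 _ H1 _ H2].
- exact: loc_id.
- exact: loc_zero.
- by apply: loc_x; lia.
- by apply: loc_t; [move: hb; rewrite bt | lia].
- exact: loc_comp.
- exact: loc_add.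
Qed.

Lemma locD b l h f u v : local_op b l h f -> f (u + v) = f u + f v.
Proof.
move=> H; elim: H u v => //= [|j _|j _ _|f1 f2 _ H1 _ H2|f1 f2 _ H1 _ H2] u v.
- by rewrite addr0.
- exact: dotD.
- exact: crsD.
- by rewrite H2 H1.
- by rewrite H1 H2 addrACA.
Qed.

Lemma loc0 b l h f : local_op b l h f -> f 0 = 0.
Proof. by move=> H; apply: (addrI (f 0)); rewrite -(locD _ _ H) !addr0. Qed.

Lemma locN b l h f u : local_op b l h f -> f (- u) = - f u.
Proof.
by move=> H; apply/eqP; rewrite -addr_eq0 -(locD _ _ H) addNr (loc0 H).
Qed.

(** Operators on disjoint intervals of strands obey the interchange law, so no colours enter. The
    intervals are half-open, and a crossing at j occupies j and j+1. Nearly every rearrangement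
    below is an instance, with [lia] comparing the intervals. *)
Lemma loc_comm b b' l h l' h' f g z : local_op b l h f -> local_op b' l' h' g ->
  (h <= l')%N || (h' <= l)%N -> f (g z) = g (f z).
Proof.
move=> Hf Hg hlh.
elim: Hf z => //= [|j hj|j _ hj|f1 f2 _ H1 _ H2|f1 f2 _ H1 _ H2] z.
- by rewrite (loc0 Hg).
- elim: Hg z => //= [|i hi|i _ hi|g1 g2 _ G1 _ G2|g1 g2 _ G1 _ G2] z.
  + exact: dot0.
  + exact: dotC.
  + by rewrite crs_dotC //; lia.
  + by rewrite G1 G2.
  + by rewrite dotD G1 G2.
- elim: Hg z => //= [|i hi|i _ hi|g1 g2 _ G1 _ G2|g1 g2 _ G1 _ G2] z.
  + exact: crs0.
  + by rewrite crs_dotC //; lia.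
  + case/orP: hlh => hlh; first by rewrite crsC //; lia.
    by rewrite -crsC //; lia.
  + by rewrite G1 G2.
  + by rewrite crsD G1 G2.
- by rewrite H2 H1.
- by rewrite H1 H2 (locD _ _ Hg).
Qed.

Lemma pol_comm l h l' h' f g z : local_op false l h f -> local_op false l' h' g ->
  f (g z) = g (f z).
Proof.
move=> Hf Hg.
elim: Hf z => //= [|j hj|f1 f2 _ H1 _ H2|f1 f2 _ H1 _ H2] z.
- by rewrite (loc0 Hg).
- elim: Hg z => //= [|i hi|g1 g2 _ G1 _ G2|g1 g2 _ G1 _ G2] z.
  + exact: dot0.
  + exact: dotC.
  + by rewrite G1 G2.
  + by rewrite dotD G1 G2.
- by rewrite H2 H1.
- by rewrite H1 H2 (locD _ _ Hg).
Qed.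

Lemma col_loc b l h f j c z : local_op b l h f -> (j < l)%N || (h <= j)%N ->
  col j c z -> col j c (f z).
Proof.
move=> H hj; elim: H z => //= [|i hi|i _ hi|f1 f2 _ H1 _ H2|f1 f2 _ H1 _ H2] z zc.
- exact: col0.
- exact: col_dot.
- by apply: col_crs => //; lia.
- exact/H1/H2.
- by apply: colD; [apply: H1 | apply: H2].
Qed.

Lemma mono_loc b l h f k n c z : local_op b l h f ->
  [|| (h <= k)%N, (k + n <= l)%N | (k <= l)%N && (h <= k + n)%N] ->
  mono k n c z -> mono k n c (f z).
Proof.
move=> H; elim: H z => //= [|i hi|i _ hi|f1 f2 _ H1 _ H2|f1 f2 _ H1 _ H2] z hk zc.
- by move=> j _; apply: col0.
- by move=> j hj; apply: col_dot; apply: zc.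
- move=> j hj; have [ji|ji] := eqVneq j i.
    by rewrite ji; apply: col_crs_l; apply: zc; lia.
  have [ji'|ji'] := eqVneq j i.+1.
    by rewrite ji'; apply: col_crs_r; apply: zc; lia.
  by apply: col_crs; [lia | apply: zc].
- by apply: H1 => //; apply: H2.
- by move=> j hj; apply: colD; [apply: H1 | apply: H2].
Qed.

Lemma col_pol l h f j c z : local_op false l h f -> col j c z -> col j c (f z).
Proof.
move=> H; elim: H z => //= [|i hi|f1 f2 _ H1 _ H2|f1 f2 _ H1 _ H2] z zc.
- exact: col0.
- exact: col_dot.
- exact/H1/H2.
- by apply: colD; [apply: H1 | apply: H2].
Qed.

Lemma mono_pol l h f k n c z : local_op false l h f -> mono k n c z -> mono k n c (f z).
Proof. by move=> H zc j hj; apply: (col_pol H); apply: zc. Qed.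

Lemma mono_crs k n j c z : mono k n c z -> (k <= j)%N -> (j.+1 < k + n)%N ->
  mono k n c (t j z).
Proof.
move=> zc kj jn; apply: (@mono_loc true k (k + n) (t j)) => //; last by lia.
by apply: loc_t => //; lia.
Qed.

(** [sweepR k n] carries the strand at position k to position k+n, and [sweepL k n] carries the
    strand at k+n to k; the strands in between shift by one. *)
Fixpoint sweepR k n : V -> V := if n is n'.+1 then sweepR k.+1 n' \o t k else id.
Fixpoint sweepL k n : V -> V := if n is n'.+1 then t k \o sweepL k.+1 n' else id.
Fixpoint longest_op k n : V -> V := if n is n'.+1 then longest_op k.+1 n' \o sweepL k
  n' else id.
Fixpoint dots_op k n : V -> V := if n is n'.+1 then x k \o dots_op k n' else id.
Fixpoint delta_op k n : V -> V := if n is n'.+1 then dots_op k n' \o delta_op k.+1 n'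
  else id.
Definition thick_op k n : V -> V := delta_op k n \o longest_op k n.

Local Notation R := sweepR.
Local Notation K := sweepL.
Local Notation D := longest_op.
Local Notation dl := delta_op.

Lemma loc_sweepR k n : local_op true k (k + n).+1 (R k n).
Proof.
elim: n k => [|n IH] k /=; first exact: loc_id.
apply: loc_comp; last by apply: loc_t => //; lia.
by apply: locW (IH k.+1) _ _ _; lia.
Qed.

Lemma loc_sweepL k n : local_op true k (k + n).+1 (K k n).
Proof.
elim: n k => [|n IH] k /=; first exact: loc_id.
apply: loc_comp; first by apply: loc_t => //; lia.
by apply: locW (IH k.+1) _ _ _; lia.
Qed.

Lemma loc_longest k n : local_op true k (k + n) (D k n).
Proof.
elim: n k => [|n IH] k /=; first exact: loc_id.
apply: loc_comp; first by apply: locW (IH k.+1) _ _ _; lia.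
by apply: locW (loc_sweepL k n) _ _ _; lia.
Qed.

Lemma loc_dots b k n : local_op b k k.+1 (dots_op k n).
Proof.
by elim: n => [|n IH] /=; [exact: loc_id | apply: loc_comp => //; apply: loc_x; lia].
Qed.

Lemma loc_delta b k n : local_op b k (k + n) (dl k n).
Proof.
elim: n k => [|n IH] k /=; first exact: loc_id.
apply: loc_comp; first by apply: locW (loc_dots b k n) _ _ _; lia.
by apply: locW (IH k.+1) _ _ _; lia.
Qed.

Lemma loc_thick k n : local_op true k (k + n) (thick_op k n).
Proof. by apply: loc_comp; [apply: loc_delta | apply: loc_longest]. Qed.

Lemma sweepR_last k n z : R k n.+1 z = t (k + n) (R k n z).
Proof.
elim: n k z => [|n IH] k z; first by rewrite addn0.
by rewrite [LHS]IH addSnnS.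
Qed.

Lemma sweepL_last k n z : K k n.+1 z = K k n (t (k + n) z).
Proof.
elim: n k z => [|n IH] k z; first by rewrite addn0.
by rewrite -addSnnS; exact: (congr1 (t k) (IH k.+1 z)).
Qed.

Lemma col_sweepR k n c z : col k c z -> col (k + n) c (R k n z).
Proof.
elim: n k z => [|n IH] k z zc; first by rewrite addn0.
by rewrite -addSnnS; apply: IH; apply: col_crs_r.
Qed.

Lemma col_sweepL k n c z : col (k + n) c z -> col k c (K k n z).
Proof.
elim: n k z => [|n IH] k z; first by rewrite addn0.
by rewrite -addSnnS => zc; apply: col_crs_l; apply: IH.
Qed.

Lemma mono_sweepR k n c z : mono k.+1 n c z -> mono k n c (R k n z).
Proof.
elim: n k z => [|n IH] k z zc j hj; first by lia.
have [->|jk] := eqVneq j k.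
  apply: (col_loc (loc_sweepR k.+1 n)); first by lia.
  by apply: col_crs_l; apply: zc; lia.
apply: (IH k.+1); last by lia.
by move=> i hi; apply: col_crs; [lia | apply: zc; lia].
Qed.

Lemma mono_sweepL k n c z : mono k n c z -> mono k.+1 n c (K k n z).
Proof.
elim: n k z => [|n IH] k z zc j hj; first by lia.
have zc' : mono k.+2 n c (K k.+1 n z).
  by apply: IH; apply: monoW zc _ _; lia.
have [->|jk] := eqVneq j k.+1; last by apply: col_crs; [lia | apply: zc'; lia].
apply: col_crs_r; apply: (col_loc (loc_sweepL k.+1 n)); first by lia.
by apply: zc; lia.
Qed.

(** Relation (5) has a correction only if the outer colours agree and differ from the middle one.
    Two strands of colour d and a passing strand of colour c never form this pattern, so the
    crossing passes freely, also when c = d. *)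
Lemma sweepR_crs l n j c d z : col l c z -> mono l.+1 n d z ->
  (l <= j)%N -> (j.+1 < l + n)%N -> R l n (t j.+1 z) = t j (R l n z).
Proof.
elim: n l z => [|n IH] l z zc zd lj jn; first by lia.
have [jl|jl] := eqVneq j l.
  rewrite {}jl in lj jn *; case: n IH zd jn => [|n] IH zd jn; first by lia.
  rewrite /= -(@braid V l c d d) //; last by case: (c == d).
  - by rewrite -(loc_comm _ (loc_t1 l) (loc_sweepR l.+2 n)) //; lia.
  - by apply: zd; lia.
  - by apply: zd; lia.
rewrite /= -IH; first 1 last.
- exact: col_crs_r.
- by move=> i hi; apply: col_crs; [lia | apply: zd; lia].
- by lia.
- by lia.
by rewrite crsC //; lia.
Qed.

Lemma sweepL_crs l n j c d z : mono l n d z -> col (l + n) c z ->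
  (l <= j)%N -> (j.+1 < l + n)%N -> K l n (t j z) = t j.+1 (K l n z).
Proof.
elim: n l z => [|n IH] l z zd zc lj jn; first by lia.
have [jl|jl] := eqVneq j l.
  rewrite {}jl in lj jn *; case: n IH zd zc jn => [|n] IH zd zc jn; first by lia.
  rewrite /= -(loc_comm _ (loc_t1 l) (loc_sweepL l.+2 n)) //; [|lia..].
  rewrite (@braid V l d d c) //; last by rewrite eqxx andbF.
  - by apply: (col_loc (loc_sweepL l.+2 n)); [lia | apply: zd; lia].
  - by apply: (col_loc (loc_sweepL l.+2 n)); [lia | apply: zd; lia].
  - by apply: col_sweepL; move: zc; rewrite !addSnnS.
rewrite /= IH; [|by apply: monoW zd _ _; lia|by rewrite addSnnS|lia..].
by rewrite crsC //; lia.
Qed.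

Lemma sweepR_dot l n j c d z : c != d -> col l c z -> mono l.+1 n d z ->
  (l <= j)%N -> (j < l + n)%N -> R l n (x j.+1 z) = x j (R l n z).
Proof.
move=> cd; elim: n l z => [|n IH] l z zc zd lj jn; first by lia.
have [jl|jl] := eqVneq j l.
  rewrite jl /= -(@slide_l V l c d) //; last by apply: zd; lia.
  by rewrite (loc_comm _ (loc_x1 true l) (loc_sweepR l.+1 n)) //; lia.
rewrite /= -IH; first 1 last.
- exact: col_crs_r.
- by move=> i hi; apply: col_crs; [lia | apply: zd; lia].
- by lia.
- by lia.
by rewrite crs_dotC //; lia.
Qed.

Lemma sweepL_dot l n j c d z : c != d -> mono l n d z -> col (l + n) c z ->
  (l <= j)%N -> (j < l + n)%N -> K l n (x j z) = x j.+1 (K l n z).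
Proof.
move=> cd; elim: n l z => [|n IH] l z zd zc lj jn; first by lia.
have [jl|jl] := eqVneq j l.
  rewrite jl /= (@slide_r V l d c) //; first by
    rewrite (loc_comm _ (loc_x1 true l) (loc_sweepL l.+1 n)) //; lia.
  - by rewrite eq_sym.
  - by apply: (col_loc (loc_sweepL l.+1 n)); [lia | apply: zd; lia].
  - by apply: col_sweepL; rewrite addSnnS.
rewrite /= IH; [|by apply: monoW zd _ _; lia|by rewrite addSnnS|lia..].
by rewrite crs_dotC //; lia.
Qed.

Lemma sweepR_dot_first l n c d z : c != d -> col l c z -> mono l.+1 n d z ->
  R l n (x l z) = x (l + n) (R l n z).
Proof.
move=> cd; elim: n l z => [|n IH] l z zc zd; first by rewrite addn0.
rewrite /= -(@slide_r V l c d) //; last by apply: zd; lia.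
rewrite IH ?addSnnS //; first exact: col_crs_r.
by move=> i hi; apply: col_crs; [lia | apply: zd; lia].
Qed.

Lemma sweepL_dot_last l n c d z : c != d -> mono l n d z -> col (l + n) c z ->
  K l n (x (l + n) z) = x l (K l n z).
Proof.
move=> cd; elim: n l z => [|n IH] l z zd zc; first by rewrite addn0.
rewrite /= -addSnnS IH ?addSnnS //; last by apply: monoW zd _ _; lia.
rewrite -(@slide_l V l d c) //; first by rewrite eq_sym.
  by apply: (col_loc (loc_sweepL l.+1 n)); [lia | apply: zd; lia].
by apply: col_sweepL; rewrite addSnnS.
Qed.

(* [shift_pair b l n f g]: f acts on the strands l+1, ..., l+n as g acts on the
   strands l, ..., l+n-1; it uses no dots if [b = false]. *)
Inductive shift_pair (b : bool) l n : (V -> V) -> (V -> V) -> Prop :=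
| par_id : shift_pair b l n id id
| par_x j : b -> (l <= j < l + n)%N -> shift_pair b l n (x j.+1) (x j)
| par_t j : (l <= j)%N && (j.+1 < l + n)%N -> shift_pair b l n (t j.+1) (t j)
| par_comp f g f' g' : shift_pair b l n f g -> shift_pair b l n f' g' ->
    shift_pair b l n (f \o f') (g \o g').

Lemma shift_loc b l n f g : shift_pair b l n f g ->
  local_op true l.+1 (l + n).+1 f /\ local_op true l (l + n) g.
Proof.
elim=> [|j _ hj|j hj|f1 g1 f2 g2 _ [H1 H1'] _ [H2 H2']]; split.
all: try exact: loc_id.
all: try by apply: loc_x; lia.
all: try by apply: loc_t => //; lia.
all: by apply: loc_comp.
Qed.

(** Crossings pass through a sweep for all colours, dots only for different colours, by relation
    (4); hence the flag b. With b false the lemma still moves longest elements through a sweep of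
    their own colour. *)
Lemma sweepR_shift b l n f g c d z : shift_pair b l n f g -> b ==> (c != d) ->
  col l c z -> mono l.+1 n d z -> R l n (f z) = g (R l n z).
Proof.
move=> H cd; elim: H z => //= [j bt hj|j hj|f1 g1 f2 g2 _ H1 P2 H2] z zc zd.
- by apply: sweepR_dot zc zd _ _; [move: cd; rewrite bt | lia..].
- by apply: sweepR_crs zc zd _ _; lia.
have [L2 _] := shift_loc P2.
rewrite H1 ?H2 //; first by apply: (col_loc L2) zc; lia.
by apply: (mono_loc L2) zd; lia.
Qed.

Lemma sweepL_shift b l n f g c d z : shift_pair b l n f g -> b ==> (c != d) ->
  mono l n d z -> col (l + n) c z -> K l n (g z) = f (K l n z).
Proof.
move=> H cd; elim: H z => //= [j bt hj|j hj|f1 g1 f2 g2 _ H1 P2 H2] z zd zc.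
- by apply: sweepL_dot zd zc _ _; [move: cd; rewrite bt | lia..].
- by apply: sweepL_crs zd zc _ _; lia.
have [_ L2] := shift_loc P2.
rewrite H1 ?H2 //; first by apply: (mono_loc L2) zd; lia.
by apply: (col_loc L2) zc; lia.
Qed.

Lemma shift_sweepR b l n k m : (l <= k)%N -> (k + m < l + n)%N -> shift_pair b l n (R
  k.+1 m) (R k m).
Proof.
elim: m k => [|m IH] k lk km /=; first exact: par_id.
by apply: par_comp; [apply: IH; lia | apply: par_t; lia].
Qed.

Lemma shift_sweepL b l n k m : (l <= k)%N -> (k + m < l + n)%N -> shift_pair b l n (K
  k.+1 m) (K k m).
Proof.
elim: m k => [|m IH] k lk km /=; first exact: par_id.
by apply: par_comp; [apply: par_t; lia | apply: IH; lia].
Qed.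

Lemma shift_D b l n k m : (l <= k)%N -> (k + m <= l + n)%N -> shift_pair b l n (D k.+1
  m) (D k m).
Proof.
elim: m k => [|m IH] k lk km /=; first exact: par_id.
by apply: par_comp; [apply: IH; lia | apply: shift_sweepL; lia].
Qed.

Lemma shift_dots l n k m : (l <= k < l + n)%N -> shift_pair true l n (dots_op k.+1 m)
  (dots_op k m).
Proof.
move=> hk; elim: m => [|m IH] /=; first exact: par_id.
by apply: par_comp => //; apply: par_x.
Qed.

Lemma shift_delta l n k m : (l <= k)%N -> (k + m <= l + n)%N ->
  shift_pair true l n (dl k.+1 m) (dl k m).
Proof.
elim: m k => [|m IH] k lk km /=; first exact: par_id.
by apply: par_comp; [apply: shift_dots; lia | apply: IH; lia].
Qed.

Lemma shift_E l n : shift_pair true l n (thick_op l.+1 n) (thick_op l n).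
Proof. by apply: par_comp; [apply: shift_delta; lia | apply: shift_D; lia]. Qed.

End KlrModule.

(** * One colour: the nilHecke relations *)

Section NilHecke.
Local Open Scope ring_scope.
Variable V : klrModule.
Implicit Types (u v w z : V) (k l j n m p q r s : nat) (c d : colour).
Local Notation x := (@dot V).
Local Notation t := (@crs V).
Local Notation R := (@sweepR V).
Local Notation K := (@sweepL V).
Local Notation D := (@longest_op V).
Local Notation dl := (@delta_op V).
Local Notation dots_op := (@dots_op V).

(** The longest element factors into a sweep and a shorter longest element in four ways: the sweep
    goes left or right, and comes first or last. One way is the recursion of [longest_op]; this
    lemma and the next two give the others. *)
Lemma longest_sweepL k n c z : mono k n.+1 c z -> D k n.+1 z = K k n (D k n z).
Proof.
move=> zc; rewrite (@sweepL_shift V false k n (D k.+1 n) (D k n) c c) //.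
- by apply: shift_D; lia.
- by apply: monoW zc _ _; lia.
- by apply: zc; lia.
Qed.

Lemma longest_sweepR k n c z : mono k n.+1 c z -> D k n.+1 z = D k n (R k n z).
Proof.
elim: n k z => [|n IH] k z zc //.
have -> : D k n.+2 z = D k.+1 n.+1 (K k n.+1 z) by [].
rewrite IH; last first.
  by apply: mono_sweepL; apply: monoW zc _ _; lia.
have P : shift_pair false k n.+1 (R k.+1 n) (R k n) by apply: shift_sweepR; lia.
rewrite -(sweepL_shift P (c := c) (d := c)) //; first 1 last.
- by apply: monoW zc _ _; lia.
- by apply: zc; lia.
(* The crossing in the middle is the first letter of the leftward sweep and the last letter of the
   rightward one, so it can change sides. *)
by rewrite sweepL_last -sweepR_last.
Qed.

Lemma longest_sweepR' k n c z : mono k n.+1 c z -> D k n.+1 z = R k n (D k.+1 n z).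
Proof.
move=> zc; rewrite (@sweepR_shift V false k n (D k.+1 n) (D k n) c c) //.
- exact: longest_sweepR zc.
- by apply: shift_D; lia.
- by apply: zc; lia.
- by apply: monoW zc _ _; lia.
Qed.

(** The strands j and j+1 lie among the last or the first n-1 strands, and one of the factorisations
    has the longest element of these strands outermost. On two strands this is relation (2).
    [longest_crs] is the same argument with innermost factors. *)
Lemma crs_longest k n c j z : mono k n c z -> (k <= j)%N -> (j.+1 < k + n)%N ->
  t j (D k n z) = 0.
Proof.
elim: n k z => [|n IH] k z zc kj jn; first by lia.
have [jk|jk] := eqVneq j k; last first.
  by rewrite /= IH //; [apply: mono_sweepL; apply: monoW zc _ _; lia | lia..].
case: n IH zc jn => [|n] IH zc jn; first by lia.
case: n IH zc jn => [|n] IH zc jn.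
  by rewrite jk; apply: (@crs_sq V k c); apply: zc; lia.
rewrite (longest_sweepR zc) IH //; last by lia.
by apply: mono_sweepR; apply: monoW zc _ _; lia.
Qed.

Lemma longest_crs k n c j z : mono k n c z -> (k <= j)%N -> (j.+1 < k + n)%N ->
  D k n (t j z) = 0.
Proof.
elim: n k z => [|n IH] k z zc kj jn; first by lia.
have zt : mono k n.+1 c (t j z).
  exact: mono_crs.
have [jk|jk] := eqVneq j k; last first.
  rewrite (longest_sweepR' zt) IH; first by rewrite (loc0 (loc_sweepR _ _ _)).
  - by apply: monoW zc _ _; lia.
  - by lia.
  - by lia.
case: n IH zc zt jn => [|n] IH zc zt jn; first by lia.
case: n IH zc zt jn => [|n] IH zc zt jn.
  by rewrite jk; apply: (@crs_sq V k c); apply: zc; lia.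
rewrite (longest_sweepL zt) IH; first by rewrite (loc0 (loc_sweepL _ _ _)).
- by apply: monoW zc _ _; lia.
- by lia.
- by lia.
Qed.

(* (x_l^m - x_e^m) / (x_l - x_e) *)
Fixpoint dots_diff l e m z : V := if m is m'.+1 then x l (dots_diff l e m' z) +
  dots_op e m' z else 0.

Lemma loc_dots_diff b l e m k h : (k <= l < h)%N -> (k <= e < h)%N -> local_op b k h
  (dots_diff l e m).
Proof.
move=> hl he; elim: m => [|m IH] /=; first exact: loc_zero.
have He : local_op b k h (dots_op e m) by apply: locW (loc_dots V b e m) _ _ _; lia.
change (local_op b k h (fun z => (x l \o dots_diff l e m) z + dots_op e m z)).
by apply: loc_add => //; apply: loc_comp => //; apply: loc_x.
Qed.

Definition signed n z : V := if odd n then - z else z.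

Lemma signedS n z : signed n.+1 z = - signed n z.
Proof. by rewrite /signed /=; case: odd; rewrite ?opprK. Qed.

Lemma signedN n z : signed n (- z) = - signed n z.
Proof. by rewrite /signed; case: odd. Qed.

Lemma signedK n z : signed n (signed n z) = z.
Proof. by rewrite /signed; case: odd; rewrite ?opprK. Qed.

Lemma signedD n u v : signed n (u + v) = signed n u + signed n v.
Proof. by rewrite /signed; case: odd; rewrite ?opprD. Qed.

Lemma loc_signed b l h f n z : local_op b l h f -> f (signed n z) = signed n (f z).
Proof. by move=> H; rewrite /signed; case: odd; rewrite ?(locN _ H). Qed.

Lemma dot_dots_diff j l e m z : x j (dots_diff l e m z) = dots_diff l e m (x j z).
Proof.
have hl : (0 <= l < (l + e).+1)%N by lia.
have he : (0 <= e < (l + e).+1)%N by lia.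
by apply: pol_comm (loc_dots_diff _ m hl he); apply: (@loc_x V false j j.+1); lia.
Qed.

Lemma dot_dots j e m z : x j (dots_op e m z) = dots_op e m (x j z).
Proof.
by apply: pol_comm (loc_dots V false e m); apply: (@loc_x V false j j.+1); lia.
Qed.

Lemma dots_opD e m u v : dots_op e m (u + v) = dots_op e m u + dots_op e m v.
Proof. exact: (locD _ _ (loc_dots V true e m)). Qed.

Lemma dots_op0 e m : dots_op e m 0 = 0.
Proof. exact: (loc0 (loc_dots V true e m)). Qed.

(** Iterating relation (1), a crossing passes m dots up to the divided difference of the m-th power.
    For dots on the right strand, in [crs_xp'], the error has the opposite sign; this is the origin
    of the sign in [sweepL_dots_longest], and so of that of the homotopy. *)
Lemma crs_dots k m c z : mono k 2 c z ->
  t k (dots_op k m z) = dots_op k.+1 m (t k z) + dots_diff k k.+1 m z.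
Proof.
elim: m z => [|m IH] z zc; first by rewrite addr0.
have zx : mono k 2 c (x k z) by move=> j hj; apply: col_dot; apply: zc.
have -> : dots_op k m.+1 z = dots_op k m (x k z) by rewrite -dot_dots.
rewrite (IH _ zx) (@crs_dot V k c); [|by apply: zc; lia..].
rewrite dots_opD /= dot_dots -addrA; congr (_ + _).
by rewrite addrC dot_dots_diff.
Qed.

Lemma crs_xp' k m c z : mono k 2 c z ->
  t k (dots_op k.+1 m z) = dots_op k m (t k z) - dots_diff k.+1 k m z.
Proof.
elim: m z => [|m IH] z zc; first by rewrite subr0.
have zx : mono k 2 c (x k.+1 z) by move=> j hj; apply: col_dot; apply: zc.
have -> : dots_op k.+1 m.+1 z = dots_op k.+1 m (x k.+1 z) by rewrite -dot_dots.
have := @dot_crs V k c z; move=> /(_ _ _)/esym/(canRL (addrK _)) e.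
rewrite (IH _ zx) e; [|by apply: zc; lia..].
rewrite dots_opD (locN _ (loc_dots V true k m)) /= dot_dots -addrA; congr (_ + _).
by rewrite opprD addrC dot_dots_diff.
Qed.

Lemma dot_crs_dots k m c z : mono k 2 c z ->
  dots_op k m (t k z) = t k (dots_op k.+1 m z) + dots_diff k k.+1 m z.
Proof.
elim: m => [|m IH] zc; first by rewrite addr0.
rewrite /= (IH zc) dotD (@dot_crs V k c).
- by rewrite -addrA; congr (_ + _); apply: addrC.
all: by apply: (col_pol (loc_dots V false k.+1 m)); apply: zc; lia.
Qed.

(** A crossing kills the image of the longest element, so there each of the n crossings acts on the
    dots as a divided difference and lowers the degree by one: fewer than n dots give 0, and n dots
    give 1. *)
Lemma sweepR_dots_longest k n r c z : mono k n.+1 c z -> (r <= n)%N ->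
  R k n (dots_op k r (D k n.+1 z)) = if r == n then D k n.+1 z else 0.
Proof.
elim: n k r z => [|n IH] k r z zc rn; first by case: r rn.
set v := D k n.+2 z.
have vc : mono k n.+2 c v by apply: (mono_loc (loc_longest V k n.+2)) => //; lia.
have -> : R k n.+1 (dots_op k r v) = R k.+1 n (dots_diff k k.+1 r v).
  rewrite /= (@crs_dots k r c); last by apply: monoW vc _ _; lia.
  by rewrite (crs_longest zc) ?dots_op0 ?add0r //; lia.
(* By its recursion the divided difference for r+1 is x_k times the one for r, which has too few
   dots, plus the r-th power of x_(k+1), to which the outer induction hypothesis applies. *)
elim: r rn => [|r IHr] rn; first by rewrite (loc0 (loc_sweepR _ _ _)).
rewrite /= (locD _ _ (loc_sweepR V k.+1 n)).
have -> : R k.+1 n (dots_op k.+1 r v) = if r == n then v else 0.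
  apply: (IH k.+1) => //.
  by apply: mono_sweepL; apply: monoW zc _ _; lia.
rewrite -(loc_comm _ (loc_x1 V true k) (loc_sweepR V k.+1 n)) //; try lia.
rewrite IHr; last by lia.
have -> : (r == n.+1) = false by lia.
by rewrite dot0 add0r eqSS.
Qed.

(** The mirror image, with the dots on the last strand: each crossing now contributes -1, whence the
    sign (-1)^n. *)
Lemma sweepL_dots_longest k n r c z : mono k n.+1 c z -> (r <= n)%N ->
  K k n (dots_op (k + n) r (D k n.+1 z)) = if r == n then signed n (D k n.+1 z) else 0.
Proof.
elim: n r z => [|n IH] r z zc rn; first by case: r rn.
set v := D k n.+2 z.
have vc : mono k n.+2 c v by apply: (mono_loc (loc_longest V k n.+2)) => //; lia.
have -> : K k n.+1 (dots_op (k + n.+1) r v) = - K k n (dots_diff (k + n).+1 (k + n) r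
  v).
  rewrite sweepL_last addnS (@crs_xp' _ r c); last by apply: monoW vc _ _; lia.
  rewrite (crs_longest zc) ?dots_op0 ?add0r; [|lia..].
  by rewrite (locN _ (loc_sweepL V k n)).
have -> : K k n (dots_diff (k + n).+1 (k + n) r v) = if r == n.+1 then signed n v else
  0.
  elim: r rn => [|r IHr] rn; first by rewrite (loc0 (loc_sweepL _ _ _)).
  rewrite /= (locD _ _ (loc_sweepL V k n)).
  have -> : K k n (dots_op (k + n) r v) = if r == n then signed n v else 0.
    rewrite /v (longest_sweepR zc); apply: IH => //.
    by apply: mono_sweepR; apply: monoW zc _ _; lia.
  rewrite -(loc_comm _ (loc_x V true (l := (k + n).+1) (h := (k + n).+2) _)
    (loc_sweepL V k n)) //; try lia.
  rewrite IHr; last by lia.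
  have -> : (r == n.+1) = false by lia.
  by rewrite dot0 add0r eqSS.
by rewrite signedS; case: eqP => // _; rewrite oppr0.
Qed.

(** This is what makes e_a idempotent. The longest element on all strands but the first absorbs its
    part of delta by induction, and the n dots on the first strand are exactly those that the
    remaining sweep turns into 1. *)
Lemma longest_delta_longest k n c z : mono k n c z -> D k n (dl k n (D k n z)) = D k n
  z.
Proof.
elim: n k z => [|n IH] k z zc //.
have zD : mono k n.+1 c (D k n.+1 z).
  by apply: (mono_loc (loc_longest V k n.+1)) => //; lia.
rewrite (longest_sweepR' (c := c)); last first.
  by apply: (mono_loc (loc_delta V true k n.+1)) => //; lia.
have zK : mono k.+1 n c (K k n z) by apply: mono_sweepL; apply: monoW zc _ _; lia.
rewrite [dl k n.+1 _]/= (loc_comm _ (loc_longest V k.+1 n) (loc_dots V true k n));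
  last by lia.
by rewrite IH // [LHS](sweepR_dots_longest zc) ?eqxx.
Qed.

(** A longest element has the shorter ones on its first or last n strands as factors, and so absorbs
    the idempotents of these. This lemma and the next two remove the idempotents between consecutive
    thick diagrams. *)
Lemma longest_delta_longest_r k n c z : mono k n.+1 c z ->
  D k.+1 n (dl k.+1 n (D k n.+1 z)) = D k n.+1 z.
Proof.
by move=> zc; apply: (longest_delta_longest (c := c)); apply: mono_sweepL;
  apply: monoW zc _ _; lia.
Qed.

Lemma longest_delta_longest_l k n c z : mono k n.+1 c z ->
  D k n (dl k n (D k n.+1 z)) = D k n.+1 z.
Proof.
move=> zc; rewrite (longest_sweepR zc) (longest_delta_longest (c := c)) //.
by apply: mono_sweepR; apply: monoW zc _ _; lia.
Qed.

Lemma longest_idem_r k n c z : mono k n.+1 c z ->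
  D k n.+1 (dl k.+1 n (D k.+1 n z)) = D k n.+1 z.
Proof.
move=> zc; have zE : mono k n.+1 c (thick_op k.+1 n z).
  by apply: (mono_loc (loc_thick V k.+1 n)) => //; lia.
rewrite (longest_sweepR' zE) (longest_sweepR' zc) (longest_delta_longest (c := c)) //.
by apply: monoW zc _ _; lia.
Qed.

End NilHecke.

(** * Two colours *)

Section Mixed.
Local Open Scope ring_scope.
Variable V : klrModule.
Implicit Types (u v w z : V) (k l j n m p q r s b e : nat).
Local Notation x := (@dot V).
Local Notation t := (@crs V).
Local Notation R := (@sweepR V).
Local Notation K := (@sweepL V).
Local Notation D := (@longest_op V).
Local Notation dots_op := (@dots_op V).
Local Notation dots_diff := (@dots_diff V).
Local Notation signed := (@signed V).

(* [link_poly j e n] is the product of x_i + x_e over j <= i < j + n;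
   [link_diff l j e n] is the divided difference of u |-> prod_i (x_i + u) at x_l and x_e. *)
Fixpoint link_poly j e n z : V :=
  if n is n'.+1 then x j (link_poly j.+1 e n' z) + x e (link_poly j.+1 e n' z) else z.
Fixpoint link_diff l j e n z : V :=
  if n is n'.+1
  then link_poly j.+1 e n' z + (x l (link_diff l j.+1 e n' z) + x j (link_diff l j.+1
    e n' z)) else 0.

Lemma loc_link_poly j e n k h : (k <= j)%N -> (j + n <= h)%N -> (k <= e < h)%N ->
  local_op false k h (link_poly j e n).
Proof.
elim: n j => [|n IH] j kj jh he; first exact: loc_id.
have {}IH : local_op false k h (link_poly j.+1 e n) by apply: IH => //; lia.
change (local_op false k h (fun z => (x j \o link_poly j.+1 e n) z + (x e \o link_poly
  j.+1 e n) z)).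
by apply: loc_add; apply: loc_comp => //; apply: loc_x => //; lia.
Qed.

Lemma loc_link_diff l j e n k h : (k <= l < h)%N -> (k <= j)%N -> (j + n <= h)%N ->
  (k <= e < h)%N -> local_op false k h (link_diff l j e n).
Proof.
move=> hl; elim: n j => [|n IH] j kj jh he; first exact: loc_zero.
have {}IH : local_op false k h (link_diff l j.+1 e n) by apply: IH => //; lia.
have HQ : local_op false k h (link_poly j.+1 e n) by apply: loc_link_poly => //; lia.
change (local_op false k h (fun z => link_poly j.+1 e n z +
   (fun z => (x l \o link_diff l j.+1 e n) z + (x j \o link_diff l j.+1 e n) z) z)).
apply: loc_add => //; apply: loc_add; apply: loc_comp => //; apply: loc_x => //.
by lia.
Qed.

Lemma dot_link_poly i j e n z : x i (link_poly j e n z) = link_poly j e n (x i z).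
Proof.
apply: (@pol_comm V i i.+1 0 (j + n + e).+1); first by apply: loc_x; lia.
by apply: loc_link_poly; lia.
Qed.

Lemma dot_link_diff i l j e n z : x i (link_diff l j e n z) = link_diff l j e n (x i z).
Proof.
apply: (@pol_comm V i i.+1 0 (j + n + e + l).+1); first by apply: loc_x; lia.
by apply: loc_link_diff; lia.
Qed.

Lemma link_poly_add j e n u v : link_poly j e n (u + v) = link_poly j e n u +
  link_poly j e n v.
Proof.
by apply: (@locD V false 0 (j + n + e).+1); apply: loc_link_poly; lia.
Qed.

Lemma link_diff_add l j e n u v : link_diff l j e n (u + v) = link_diff l j e n u +
  link_diff l j e n v.
Proof.
by apply: (@locD V false 0 (j + n + e + l).+1); apply: loc_link_diff; lia.
Qed.

Lemma col_link_poly i a j e n z : col i a z -> col i a (link_poly j e n z).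
Proof.
by apply: (@col_pol V 0 (j + n + e).+1); apply: loc_link_poly; lia.
Qed.

Lemma col_link_diff i a l j e n z : col i a z -> col i a (link_diff l j e n z).
Proof.
by apply: (@col_pol V 0 (j + n + e + l).+1); apply: loc_link_diff; lia.
Qed.

Lemma crs_link_poly l j n a a' z : a != a' -> col l a z -> col l.+1 a' z -> (l.+1 <
  j)%N ->
  t l (link_poly j l.+1 n z) = link_poly j l n (t l z).
Proof.
move=> aa zl zl'; elim: n j => [|n IH] j lj //=.
rewrite crsD crs_dotC; last by lia.
rewrite -(@slide_l V l a a') ?IH //; first (by lia); exact: col_link_poly.
Qed.

Lemma crs_link_diff l j e n a a' z : a != a' -> col l a z -> col l.+1 a' z ->
  (l.+1 < j)%N -> (l.+1 < e)%N ->
  t l (link_diff l.+1 j e n z) = link_diff l j e n (t l z).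
Proof.
move=> aa zl zl' + le; elim: n j => [|n IH] j lj /=; first exact: crs0.
rewrite !crsD [t l (x j _)]crs_dotC; last by lia.
rewrite -(@slide_l V l a a') ?IH //; try (by lia); try exact: col_link_diff.
congr (_ + _).
apply: (@loc_comm V true false l l.+2 l.+2 (j + n + e).+1).
- by apply: loc_t; lia.
- by apply: loc_link_poly; lia.
- by lia.
Qed.

Lemma dotD_crs l a a' u : a != a' -> col l a u -> col l.+1 a' u ->
  t l (t l u) = x l u + x l.+1 u.
Proof. by move=> aa ua ua'; apply: crs_r2 aa ua ua'. Qed.

Variables c d : colour.
Hypothesis cd : c != d.

(** Where the strand turns round it crosses its neighbour twice. Relation (3) replaces this by a dot
    on either strand, relation (4) slides the dot of the moving strand to its end, and one strand
    fewer remains. In the opposite order, in the next lemma, the polynomial arises inside and has to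
    pass the outer crossing. *)
Lemma sweepR_sweepL_link_poly l n z : col (l + n) c z -> mono l n d z ->
  R l n (K l n z) = link_poly l (l + n) n z.
Proof.
elim: n l z => [|n IH] l z zc zd //=.
have zd' : mono l.+1 n d z by apply: monoW zd _ _; lia.
have zc' : col (l.+1 + n) c z by rewrite addSnnS.
have uc : col l.+1 c (K l.+1 n z) by apply: col_sweepL.
have ul : col l d (K l.+1 n z).
  by apply: (col_loc (loc_sweepL V l.+1 n)); [lia | apply: zd; lia].
have um : mono l.+2 n d (K l.+1 n z) by apply: mono_sweepL.
rewrite (@dotD_crs l d c) //; last by rewrite eq_sym.
rewrite (locD _ _ (loc_sweepR V l.+1 n)).
rewrite -(loc_comm _ (loc_x1 V true l) (loc_sweepR V l.+1 n)) //; try lia.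
by rewrite (sweepR_dot_first cd) // IH // -addSnnS.
Qed.

Lemma sweepL_sweepR_link_poly l n z : col l c z -> mono l.+1 n d z ->
  K l n (R l n z) = link_poly l.+1 l n z.
Proof.
elim: n l z => [|n IH] l z zc zd //=.
have zl : col l.+1 d z by apply: zd; lia.
have zm : mono l.+2 n d z by apply: monoW zd _ _; lia.
rewrite IH; last 2 first.
- exact: col_crs_r.
- by move=> j hj; apply: col_crs; [lia | apply: zm].
rewrite (@crs_link_poly l _ n d c) //; first 1 last.
- by rewrite eq_sym.
- exact: col_crs_l.
- exact: col_crs_r.
by rewrite (dotD_crs cd) // link_poly_add !dot_link_poly addrC.
Qed.

(** Relation (5) moves the crossing of the two strands of colour c through the strands of colour d
    one by one. A correction at the j-th of these leaves the left strand doubly crossing those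
    before it and the right strand doubly crossing those after it. By relation (3), with e the
    position of the right strand, the corrections add up to the sum over j of prod_{i<j} (x_l + x_i)
    prod_{i>j} (x_i + x_e), a telescoping form of the divided difference. *)
Lemma sweepL_crs_sweepR l n z : col l c z -> mono l.+1 n d z -> col (l.+1 + n) c z ->
  K l n (t (l + n) (R l n z)) =
  R l.+1 n (t l (K l.+1 n z)) + link_diff l l.+1 (l.+1 + n) n z.
Proof.
elim: n l z => [|n IH] l z zc zd zc'; first by rewrite addn0 addr0.
have zl : col l.+1 d z by apply: zd; lia.
have zm : mono l.+2 n d z by apply: monoW zd _ _; lia.
have zc2 : col (l.+2 + n) c z by rewrite addSnnS.
have zt : mono l.+2 n d (t l z).
  by move=> j hj; apply: col_crs; [lia | apply: zm].
rewrite /= -addSnnS IH //; first 1 last.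
- exact: col_crs_r.
- by apply: col_crs; [lia |].
set u := K l.+2 n z.
have -> : K l.+2 n (t l z) = t l u.
  by rewrite /u (loc_comm _ (loc_t1 V l) (loc_sweepL V l.+2 n)) //; lia.
have uc : col l c u by apply: (col_loc (loc_sweepL V l.+2 n)) => //; lia.
have ud : col l.+1 d u by apply: (col_loc (loc_sweepL V l.+2 n)) => //; lia.
have uc2 : col l.+2 c u by apply: col_sweepL.
rewrite crsD (loc_comm _ (loc_t1 V l) (loc_sweepR V l.+2 n)) //; try lia.
rewrite (@braid1 V l c d) // (locD _ _ (loc_sweepR V l.+2 n)) -!addrA.
congr (_ + _); rewrite sweepR_sweepL_link_poly // -!addSnnS; congr (_ + _).
rewrite (@crs_link_diff l _ _ n d c) //; try lia; first 1 last.
- by rewrite eq_sym.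
- exact: col_crs_l.
- exact: col_crs_r.
by rewrite (dotD_crs cd) // link_diff_add !dot_link_diff.
Qed.

Lemma sweepL_dots l n m z : mono l n d z -> col (l + n) c z ->
  K l n (dots_op (l + n) m z) = dots_op l m (K l n z).
Proof.
move=> zd zc; elim: m => //= m <-; apply: sweepL_dot_last (cd) _ _.
- exact: (mono_pol (loc_dots V false _ _)).
- exact: (col_pol (loc_dots V false _ _)).
Qed.

(** The colour pattern c, c, d has no correction in relation (5). This is the slide behind the
    vanishing of the square of the differential. *)
Lemma sweepR_crs2 l n z : col l c z -> col l.+1 c z -> mono l.+2 n d z ->
  R l n (R l.+1 n (t l z)) = t (l + n) (R l n (R l.+1 n z)).
Proof.
elim: n l z => [|n IH] l z zl zl' zd; first by rewrite addn0.
have z2 : col l.+2 d z by apply: zd; lia.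
have zm : mono l.+3 n d z by apply: monoW zd _ _; lia.
have Rt u : t l (R l.+2 n u) = R l.+2 n (t l u).
  by rewrite (loc_comm _ (loc_t1 V l) (loc_sweepR V l.+2 n)) //; lia.
rewrite /= !Rt (@braid V l c c d) //; last by rewrite eqxx andbF.
rewrite IH ?addSnnS //.
- by apply: col_crs_r; apply: col_crs => //; lia.
- by apply: col_crs; [lia | apply: col_crs_r].
- by move=> j hj; do 2![apply: col_crs; first lia]; apply: zm.
Qed.

(** Expand the product of the x_i + x_p. A factor x_i lies outside the thick strand, commutes with
    its longest element and is pulled into w; then too few dots remain on strand p. Only the pure
    power of x_p counts. *)
Lemma sweepL_link_poly p j n r w : mono 0 p.+1 c w -> (p < j)%N -> (r + n <= p)%N ->
  K 0 p (dots_op p r (link_poly j p n (D 0 p.+1 w))) =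
  if (r + n == p)%N then signed p (D 0 p.+1 w) else 0.
Proof.
elim: n j r w => [|n IH] j r w wc pj rn.
  by rewrite addn0 in rn *; exact: (sweepL_dots_longest wc rn).
rewrite /= dots_opD (locD _ _ (loc_sweepL V 0 p)).
have -> : K 0 p (dots_op p r (x j (link_poly j.+1 p n (D 0 p.+1 w)))) = 0.
  rewrite dot_link_poly (loc_comm _ (loc_x1 V true j) (loc_longest V 0 p.+1));
    last by lia.
  rewrite IH; [|by apply: (mono_pol (loc_x1 V false j))|lia..].
  by case: eqP => // rp; move: rn; rewrite addnS rp ltnn.
rewrite add0r -dot_dots.
by rewrite (IH j.+1 r.+1) ?addSnnS //; lia.
Qed.

Lemma sweepR_link_poly e q j n r w : mono e q.+1 c w -> (j + n <= e)%N -> (r + n <=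
  q)%N ->
  R e q (dots_op e r (link_poly j e n (D e q.+1 w))) =
  if (r + n == q)%N then D e q.+1 w else 0.
Proof.
elim: n j r w => [|n IH] j r w wc je rn.
  by rewrite addn0 in rn *; exact: (sweepR_dots_longest wc rn).
rewrite /= dots_opD (locD _ _ (loc_sweepR V e q)).
have -> : R e q (dots_op e r (x j (link_poly j.+1 e n (D e q.+1 w)))) = 0.
  rewrite dot_link_poly (loc_comm _ (loc_x1 V true j) (loc_longest V e q.+1));
    last by lia.
  rewrite IH; [|by apply: (mono_pol (loc_x1 V false j))|lia..].
  by case: eqP => // rp; move: rn; rewrite addnS rp ltnn.
rewrite add0r -dot_dots.
by rewrite (IH j.+1 r.+1) ?addSnnS //; lia.
Qed.

Section TwoSides.
Variables p q e : nat.
Hypothesis pe : (p < e)%N.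

(** In the middle of the complex the thick strands of colour c occupy the positions 0, ..., p and e,
    ..., e+q. [twoD] applies their longest elements, [twoS] the two sweeps that remain after
    straightening, and the dots to be evaluated sit between them, on the strands p and e. *)
Definition twoD w := D 0 p.+1 (D e q.+1 w).
Definition twoS z := K 0 p (R e q z).

Lemma twoS_add u v : twoS (u + v) = twoS u + twoS v.
Proof. by rewrite /twoS (locD _ _ (loc_sweepR V e q)) (locD _ _ (loc_sweepL V 0 p)).
  Qed.

(* The left longest element kills fewer than p dots and the right one fewer
   than q, so that for s + r <= p + q only s = p, r = q survives. *)
Lemma twoS_dots s r w : mono 0 p.+1 c w -> mono e q.+1 c w -> (s + r <= p + q)%N ->
  twoS (dots_op p s (dots_op e r (twoD w))) =
  if (s == p) && (r == q) then signed p (twoD w) else 0.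
Proof.
move=> wp we sr; rewrite /twoS /twoD.
rewrite (loc_comm _ (loc_dots V true e r) (loc_longest V 0 p.+1)); last by lia.
rewrite -(loc_comm _ (loc_dots V true p s) (loc_sweepR V e q)); last by lia.
rewrite (loc_comm _ (loc_sweepR V e q) (loc_longest V 0 p.+1)); last by lia.
have [rq|qr] := leqP r q.
  rewrite (sweepR_dots_longest we rq); case: (r =P q) => [rq'|_]; last first.
    by rewrite (loc0 (loc_longest V _ _)) dots_op0 (loc0 (loc_sweepL V _ _)) andbF.
  rewrite andbT; apply: sweepL_dots_longest; last by lia.
  by apply: (mono_loc (loc_longest V _ _)) wp; lia.
rewrite (@sweepL_dots_longest V 0 p s c); last by lia.
  have -> : (s == p) = false by lia.
  by [].
apply: (mono_loc (loc_sweepR V _ _)); first by lia.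
apply: (mono_pol (loc_dots V false _ _)).
by apply: (mono_loc (loc_longest V _ _)) wp; lia.
Qed.

Lemma dot_twoD j w : (p < j < e)%N -> x j (twoD w) = twoD (x j w).
Proof.
move=> hj; rewrite /twoD (loc_comm _ (loc_x1 V true j) (loc_longest V 0 p.+1));
  last by lia.
by rewrite (loc_comm _ (loc_x1 V true j) (loc_longest V e q.+1)) //; lia.
Qed.

Lemma twoS_link_poly j n s r w : mono 0 p.+1 c w -> mono e q.+1 c w ->
  (p < j)%N -> (j + n <= e)%N -> (s + r + n <= p + q)%N ->
  twoS (dots_op p s (dots_op e r (link_poly j e n (twoD w)))) =
  if (s == p) && (r + n == q)%N then signed p (twoD w) else 0.
Proof.
elim: n j r w => [|n IH] j r w wp we pj je srn.
  by rewrite addn0; apply: twoS_dots => //; lia.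
rewrite /= !dots_opD twoS_add.
rewrite dot_link_poly dot_twoD; last by lia.
rewrite IH; [|by apply: (mono_pol (loc_x1 V false j))..|lia|lia|lia].
have -> : (s == p) && (r + n == q)%N = false by lia.
rewrite add0r -[dots_op e r (x e _)]dot_dots.
by rewrite (IH _ r.+1) ?addSnnS //; lia.
Qed.

(** Of the monomials x_p^i x_e^(m-1-i) with i < m only i = p - s completes the dots on strand p to
    p; the degree then decides whether strand e carries q dots. *)
Lemma twoS_dots_diff j n s m w : mono 0 p.+1 c w -> mono e q.+1 c w ->
  (p < j)%N -> (j + n <= e)%N -> (s + m + n <= (p + q).+1)%N ->
  twoS (dots_op p s (dots_diff p e m (link_poly j e n (twoD w)))) =
  if (s <= p < s + m)%N && (s + m + n == (p + q).+1)%N then signed p (twoD w) else 0.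
Proof.
move=> wp we pj je; elim: m s => [|m IH] s smn /=.
  have -> : (s <= p < s + 0)%N = false by lia.
  by rewrite dots_op0 /twoS (loc0 (loc_sweepR V _ _)) (loc0 (loc_sweepL V _ _)).
rewrite !dots_opD twoS_add -[dots_op p s (x p _)]dot_dots.
rewrite (IH s.+1); last by lia.
rewrite twoS_link_poly //; last by lia.
have [sp|sp] := eqVneq s p.
  have -> : (s < p < s.+1 + m)%N = false by lia.
  rewrite add0r /=; congr (if _ then _ else _); lia.
rewrite addr0; congr (if _ then _ else _); lia.
Qed.

(** Only monomials without dots on the strands between the two thick ones survive, and these are the
    x_p^i x_e^(n-1-i). In the induction, s = p selects the present summand and s < p a later one. *)
Lemma twoS_link_diff j n s r w : mono 0 p.+1 c w -> mono e q.+1 c w ->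
  (p < j)%N -> (j + n <= e)%N -> (s + r + n <= (p + q).+1)%N ->
  twoS (dots_op p s (dots_op e r (link_diff p j e n (twoD w)))) =
  if (s <= p < s + n)%N && (s + r + n == (p + q).+1)%N then signed p (twoD w) else 0.
Proof.
elim: n j s r w => [|n IH] j s r w wp we pj je srn.
  have -> : (s <= p < s + 0)%N = false by lia.
  by rewrite !dots_op0 /twoS (loc0 (loc_sweepR V _ _)) (loc0 (loc_sweepL V _ _)).
rewrite /= !dots_opD !twoS_add -dot_dots dot_link_diff dot_twoD; last by lia.
rewrite (IH j.+1 s r (x j w)); [|by apply: (mono_pol (loc_x1 V false j))..|lia|lia|lia].
rewrite -[dots_op p s (x p _)]dot_dots.
rewrite (IH j.+1 s.+1 r) //; [|lia..].
rewrite twoS_link_poly //; [|lia..].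
have -> : (s + r + n == (p + q).+1)%N = false by lia.
rewrite andbF addr0.
have [sp|sp] := eqVneq s p.
  have -> : (s < p < s.+1 + n)%N = false by lia.
  rewrite addr0 /=; congr (if _ then _ else _); lia.
rewrite add0r; congr (if _ then _ else _); lia.
Qed.

End TwoSides.

End Mixed.

(** * The differential and the homotopy as operators *)

Section Serre.
Local Open Scope ring_scope.
Variable V : klrModule.
Variables c d : colour.
Implicit Types (u v w z : V) (k l j n m p q r s b e : nat).
Local Notation t := (@crs V).
Local Notation R := (@sweepR V).
Local Notation K := (@sweepL V).
Local Notation D := (@longest_op V).
Local Notation dl := (@delta_op V).
Local Notation dots_op := (@dots_op V).
Local Notation dots_diff := (@dots_diff V).
Local Notation signed := (@signed V).
Local Notation E := (@thick_op V).
Local Notation link_poly := (@link_poly V).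

(** The differential after absorption: [D 0 p.+1] with [dl 0 p] is the splitter, and delta and D on
    the right are the merger. [diag_op_serre_d_diag] identifies this with the composite of thick
    diagrams. *)
Definition serre_d p b q z : V :=
  dl 0 p (dl (p + b) q.+1 (D (p + b) q.+1 (R p b (D 0 p.+1 (E p.+1 b z))))).

(* The strand that is moved back carries m dots; it is used for
   m = p + q - b. *)
Definition serre_h p b q m z : V :=
  signed p (dl 0 p.+1 (D 0 p.+1 (dl (p.+1 + b) q (K p b (dots_op (p + b) m
    (D (p + b) q.+1 (E p b z))))))).

Record shape p b q z : Prop := Shape {
  shape_l : mono 0 p c z;
  shape_m : mono p b d z;
  shape_r : mono (p + b) q c z }.

Lemma delta_idem k n a z : mono k n a z -> D k n (E k n z) = D k n z.
Proof. exact: longest_delta_longest. Qed.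

Lemma idemK k n a z : mono k n a z -> E k n (E k n z) = E k n z.
Proof. by move=> zc; rewrite /thick_op /= (longest_delta_longest zc). Qed.

Lemma shape_loc (f : V -> V) (b' : bool) h p b q z : local_op b' 0 h f -> (h <= p)%N ->
  shape p b q z -> shape p b q (f z).
Proof.
by move=> Hf lp [zl zm zr]; split; apply: (mono_loc Hf) => //; lia.
Qed.

Lemma shape_loc_m (f : V -> V) (b' : bool) l h p b q z : local_op b' l h f -> (p <=
  l)%N -> (h <= p + b)%N ->
  shape p b q z -> shape p b q (f z).
Proof.
by move=> Hf lp pb [zl zm zr]; split; apply: (mono_loc Hf) => //; lia.
Qed.

Lemma shape_loc_r (f : V -> V) (b' : bool) l h p b q z : local_op b' l h f -> (p + b
  <= l)%N ->
  (h <= p + b + q)%N -> shape p b q z -> shape p b q (f z).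
Proof.
by move=> Hf lp pb [zl zm zr]; split; apply: (mono_loc Hf) => //; lia.
Qed.

Lemma shape_sweepR p b q z : shape p.+1 b q z -> shape p b q.+1 (R p b z).
Proof.
move=> [zl zm zr]; split.
- by apply: (mono_loc (loc_sweepR V p b)); [lia | apply: monoW zl _ _; lia].
- exact: mono_sweepR.
move=> j hj; have [->|jp] := eqVneq j (p + b)%N.
  by apply: col_sweepR; apply: zl; lia.
by apply: (col_loc (loc_sweepR V p b)); [lia | apply: zr; lia].
Qed.

Lemma shape_sweepL p b q z : shape p b q.+1 z -> shape p.+1 b q (K p b z).
Proof.
move=> [zl zm zr]; split.
- move=> j hj; have [->|jp] := eqVneq j p; first by apply: col_sweepL; apply: zr; lia.
  by apply: (col_loc (loc_sweepL V p b)); [lia | apply: zl; lia].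
- exact: mono_sweepL.
by apply: (mono_loc (loc_sweepL V p b)); [lia | apply: monoW zr _ _; lia].
Qed.

Lemma shape_serre_d p b q z : shape p.+1 b q z -> shape p b q.+1 (serre_d p b q z).
Proof.
move=> sz; apply: (shape_loc (loc_delta V true 0 p)) => //.
apply: (shape_loc_r (loc_delta V true (p + b) q.+1)) => //.
apply: (shape_loc_r (loc_longest V (p + b) q.+1)) => //.
apply: shape_sweepR; apply: (shape_loc (loc_longest V 0 p.+1)) => //.
exact: (shape_loc_m (loc_thick V p.+1 b)).
Qed.

Lemma shape_signed p b q n z : shape p b q z -> shape p b q (signed n z).
Proof.
rewrite /signed; case: odd => // -[zl zm zr].
by split=> j hj; apply: colN; [apply: zl | apply: zm | apply: zr].
Qed.

Lemma shape_serre_h p b q m z : shape p b q.+1 z -> shape p.+1 b q (serre_h p b q m z).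
Proof.
move=> sz; apply: shape_signed; apply: (shape_loc (loc_delta V true 0 p.+1)) => //.
apply: (shape_loc (loc_longest V 0 p.+1)) => //.
apply: (shape_loc_r (loc_delta V true (p.+1 + b) q)) => //.
apply: shape_sweepL; apply: (shape_loc_r (loc_dots V true (p + b) m)) => //;
  first by lia.
apply: (shape_loc_r (loc_longest V (p + b) q.+1)) => //.
exact: (shape_loc_m (loc_thick V p b)).
Qed.

Hypothesis cd : c != d.

Lemma idem_sweepR p b z : col p c z -> mono p.+1 b d z ->
  E p b (R p b z) = R p b (E p.+1 b z).
Proof. by move=> zc zd; rewrite (sweepR_shift (shift_E V p b) (c := c) (d := d)). Qed.

Lemma idem_sweepL p b z : mono p b d z -> col (p + b) c z ->
  E p.+1 b (K p b z) = K p b (E p b z).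
Proof.
by move=> zd zc; rewrite (sweepL_shift (shift_E V p b) (c := c) (d := d)) // eq_sym.
Qed.

(* The two strands that are moved cross at the bottom; this crossing slides
   through the strands of colour d to the top, where the merger kills it. *)
Lemma serre_d_serre_d p b q z : shape p.+2 b q z -> serre_d p b q.+1 (serre_d p.+1 b q
  z) = 0.
Proof.
move=> sz; rewrite /serre_d.
set y := D 0 p.+2 (E p.+2 b z).
have sy : shape p.+2 b q y.
  by apply: (shape_loc (loc_longest V 0 p.+2)) => //;
    apply: (shape_loc_m (loc_thick V p.+2 b)).
(* The idempotent on the strands of colour d slides down through the sweep and meets its copy in
   y. *)
have e1 : E p.+1 b (dl 0 p.+1 (dl (p.+1 + b) q.+1 (D (p.+1 + b) q.+1 (R p.+1 b y)))) =
  dl 0 p.+1 (dl (p.+1 + b) q.+1 (D (p.+1 + b) q.+1 (R p.+1 b y))).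
  rewrite (loc_comm _ (loc_thick V p.+1 b) (loc_delta V true 0 p.+1)); last by lia.
  rewrite (loc_comm _ (loc_thick V p.+1 b) (loc_delta V true (p.+1 + b) q.+1));
    last by lia.
  rewrite (loc_comm _ (loc_thick V p.+1 b) (loc_longest V (p.+1 + b) q.+1));
    last by lia.
  case: sy => yl ym yr; rewrite idem_sweepR //; last by apply: yl; lia.
  rewrite /y (loc_comm _ (loc_thick V p.+2 b) (loc_longest V 0 p.+2)); last by lia.
  by rewrite (idemK (shape_m sz)).
rewrite {}e1.
(* The delta of the first splitter is absorbed, because the longest element on p+2 strands lies
   below it. *)
have e2 : D 0 p.+1 (dl 0 p.+1 (dl (p.+1 + b) q.+1 (D (p.+1 + b) q.+1 (R p.+1 b y)))) =
  dl (p.+1 + b) q.+1 (D (p.+1 + b) q.+1 (R p.+1 b y)).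
  have cE (f : V -> V) (b' : bool) l h u : local_op b' l h f -> (p.+1 <= l)%N ->
    D 0 p.+1 (dl 0 p.+1 (f u)) = f (D 0 p.+1 (dl 0 p.+1 u)).
    move=> Hf hl; rewrite (loc_comm _ (loc_delta V true 0 p.+1) Hf); last by lia.
    by rewrite (loc_comm _ (loc_longest V 0 p.+1) Hf) //; lia.
  rewrite (cE _ _ _ _ _ (loc_delta V true (p.+1 + b) q.+1)) ?leq_addr //.
  rewrite (cE _ _ _ _ _ (loc_longest V (p.+1 + b) q.+1)) ?leq_addr //.
  rewrite (cE _ _ _ _ _ (loc_sweepR V p.+1 b)) //.
  have zE : mono 0 p.+2 c (E p.+2 b z).
    by apply: (mono_loc (loc_thick V p.+2 b)); [lia | case: sz].
  by rewrite /y (longest_delta_longest_l zE).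
rewrite {}e2.
have Rc u : R p b (dl (p.+1 + b) q.+1 (D (p.+1 + b) q.+1 u)) =
   dl (p.+1 + b) q.+1 (D (p.+1 + b) q.+1 (R p b u)).
  rewrite (loc_comm _ (loc_sweepR V p b) (loc_delta V true (p.+1 + b) q.+1));
    last by lia.
  by rewrite (loc_comm _ (loc_sweepR V p b) (loc_longest V (p.+1 + b) q.+1)) //; lia.
rewrite {}Rc.
have sRR : shape p b q.+2 (R p b (R p.+1 b y)) by do 2!apply: shape_sweepR.
(* The second merger absorbs the first one. *)
rewrite (longest_idem_r (shape_r sRR)).
suff -> : D (p + b) q.+2 (R p b (R p.+1 b y)) = 0.
  by rewrite (loc0 (loc_delta V true _ _)) (loc0 (loc_delta V true _ _)).
have zE : mono 0 p.+2 c (E p.+2 b z).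
  by apply: (mono_loc (loc_thick V p.+2 b)); [lia | case: sz].
have sy' : shape p.+2 b q (R 0 p (D 1 p.+1 (E p.+2 b z))).
  apply: (shape_loc (b' := true) (h := p.+2) _ _ _) => //.
    by apply: locW (loc_sweepR V 0 p) _ _ _.
  apply: (shape_loc (b' := true) (h := p.+2) _ _ _) => //.
    by apply: locW (loc_longest V 1 p.+1) _ _ _.
  exact: (shape_loc_m (loc_thick V p.+2 b)).
(* This factorisation ends with the crossing at p, which crosses the two strands that are about to
   move. *)
rewrite /y (longest_sweepR' zE) sweepR_last.
case: (sy') => yl ym yr; rewrite (sweepR_crs2 cd) //; [|by apply: yl; lia..].
apply: (longest_crs (c := c)); [|lia..].
by apply: (shape_r (p := p) (b := b)); do 2!apply: shape_sweepR.
Qed.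

Lemma serre_d_signed p b q n z : serre_d p b q (signed n z) = signed n (serre_d p b q
  z).
Proof.
rewrite /serre_d (loc_signed _ _ (loc_thick V _ _)) (loc_signed _ _ (loc_longest V 0
  _)).
rewrite (loc_signed _ _ (loc_sweepR V _ _)) (loc_signed _ _ (loc_longest V _ _)).
by rewrite (loc_signed _ _ (loc_delta V true (p + b) _)) (loc_signed _ _ (loc_delta V
  true 0 _)).
Qed.

(** A normal form in which hd and dh can be compared: the longest elements of the intermediate
    object are absorbed, those of the source stand next to z, and the deltas come last. In between
    one strand travels to the far right and then another to the far left; for dh, in the next lemma,
    these journeys come in the other order. *)
Lemma serre_h_serre_d p b q m z : shape p.+1 b q z -> E p.+1 b z = z ->
  serre_h p b q m (serre_d p b q z) =
  signed p (dl 0 p.+1 (dl (p.+1 + b) q (K 0 p (K p b (dots_op (p + b) m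
    (R (p + b) q (R p b (D 0 p.+1 (D (p.+1 + b) q z))))))))).
Proof.
move=> sz zE; rewrite /serre_h /serre_d zE; set e := (p.+1 + b)%N.
set y := D 0 p.+1 z; set Y := D 0 p.+1 (D e q z).
have sy : shape p.+1 b q y by apply: (shape_loc (loc_longest V 0 p.+1)).
set u := D (p + b) q.+1 (R p b y).
(* The longest element on the right gives up a sweep, which continues the journey of the moving
   strand; what is left of it commutes down to z. *)
have uE : u = R (p + b) q (R p b Y).
  rewrite /u (longest_sweepR' (shape_r (shape_sweepR sy))); congr (R _ _ _).
  rewrite (loc_comm _ (loc_longest V (p + b).+1 q) (loc_sweepR V p b)); last by lia.
  by rewrite /y (loc_comm _ (loc_longest V (p + b).+1 q) (loc_longest V 0 p.+1)) //;
    lia.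
have su : shape p b q.+1 u.
  by apply: (shape_loc_r (loc_longest V (p + b) q.+1)) => //; apply: shape_sweepR.
have -> : E p b (dl 0 p (dl (p + b) q.+1 u)) = dl 0 p (dl (p + b) q.+1 u).
  rewrite (loc_comm _ (loc_thick V p b) (loc_delta V true 0 p)); last by lia.
  rewrite (loc_comm _ (loc_thick V p b) (loc_delta V true (p + b) q.+1)); last by lia.
  rewrite /u (loc_comm _ (loc_thick V p b) (loc_longest V (p + b) q.+1)); last by lia.
  case: sy => yl ym yr; rewrite idem_sweepR //; last by apply: yl; lia.
  by rewrite /y (loc_comm _ (loc_thick V p.+1 b) (loc_longest V 0 p.+1)) ?zE //; lia.
have -> : D (p + b) q.+1 (dl 0 p (dl (p + b) q.+1 u)) = dl 0 p u.
  rewrite (loc_comm _ (loc_longest V (p + b) q.+1) (loc_delta V true 0 p)); last by lia.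
  by rewrite /u (longest_delta_longest (shape_r (shape_sweepR sy))).
congr (signed p (dl 0 p.+1 _)).
rewrite -(loc_comm _ (loc_delta V true 0 p) (loc_dots V true (p + b) m)); last by lia.
rewrite -(loc_comm _ (loc_delta V true 0 p) (loc_sweepL V p b)); last by lia.
rewrite -(loc_comm _ (loc_delta V true 0 p) (loc_delta V true e q)); last by lia.
set v := dl e q _.
have sv : shape p.+1 b q v.
  apply: (shape_loc_r (loc_delta V true e q)) => //; apply: shape_sweepL.
  by apply: (shape_loc_r (loc_dots V true (p + b) m)) => //; lia.
have sv' : shape p.+1 b q (dl 0 p v).
  by apply: (shape_loc (b' := true) (h := p.+1) _ _ _) => //;
    apply: locW (loc_delta V true 0 p) _ _ _.
(* With the sweep taken off on the outside, the shorter longest element meets delta_p and both are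
   absorbed below. *)
rewrite (longest_sweepL (shape_l sv')).
have cE (f : V -> V) (b' : bool) l h w : local_op b' l h f -> (p <= l)%N ->
    D 0 p (dl 0 p (f w)) = f (D 0 p (dl 0 p w)).
  move=> Hf hl; rewrite (loc_comm _ (loc_delta V true 0 p) Hf); last by lia.
  by rewrite (loc_comm _ (loc_longest V 0 p) Hf) //; lia.
rewrite /v uE (cE _ _ _ _ _ (loc_delta V true e q)); last by lia.
rewrite (cE _ _ _ _ _ (loc_sweepL V p b)) // (cE _ _ _ _ _ (loc_dots V true (p + b)
  m)) ?leq_addr //.
rewrite (cE _ _ _ _ _ (loc_sweepR V (p + b) q)) ?leq_addr // (cE _ _ _ _ _ (loc_sweepR
  V p b)) //.
rewrite /Y (@longest_delta_longest_l V 0 p c); last first.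
  by apply: (mono_loc (loc_longest V e q)); [lia | case: sz].
by rewrite (loc_comm _ (loc_sweepL V 0 p) (loc_delta V true e q)) //; lia.
Qed.

Lemma serre_d_serre_h p b q m z : shape p b q.+1 z -> E p b z = z ->
  serre_d p b q (serre_h p b q m z) =
  signed p (dl 0 p (dl (p + b) q.+1 (R (p + b) q (R p b (K 0 p (K p b (dots_op (p + b) m
    (D 0 p (D (p + b) q.+1 z))))))))).
Proof.
move=> sz zE; rewrite /serre_h serre_d_signed zE; congr (signed p _).
set e := (p + b)%N; set Y := D 0 p (D e q.+1 z).
rewrite -[(p.+1 + b)%N]/e.+1 /serre_d -/e.
set y := D e q.+1 z.
have sy : shape p b q.+1 y by apply: (shape_loc_r (loc_longest V e q.+1)).
set v := dl e.+1 q (K p b (dots_op e m y)).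
have sv : shape p.+1 b q v.
  apply: (shape_loc_r (loc_delta V true e.+1 q)) => //; apply: shape_sweepL.
  by apply: (shape_loc_r (loc_dots V true e m)) => //; lia.
have -> : E p.+1 b (dl 0 p.+1 (D 0 p.+1 v)) = dl 0 p.+1 (D 0 p.+1 v).
  rewrite (loc_comm _ (loc_thick V p.+1 b) (loc_delta V true 0 p.+1)); last by lia.
  rewrite (loc_comm _ (loc_thick V p.+1 b) (loc_longest V 0 p.+1)); last by lia.
  rewrite /v (loc_comm _ (loc_thick V p.+1 b) (loc_delta V true e.+1 q)); last by lia.
  have sx : shape p b q.+1 (dots_op e m y).
    by apply: (shape_loc_r (loc_dots V true e m)) => //; lia.
  rewrite (idem_sweepL (shape_m sx)); last by apply: (shape_r sx); lia.
  rewrite (loc_comm _ (loc_thick V p b) (loc_dots V true e m)); last by lia.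
  by rewrite /y (loc_comm _ (loc_thick V p b) (loc_longest V e q.+1)) ?zE //; lia.
rewrite (longest_delta_longest (shape_l sv)) (longest_sweepL (shape_l sv)).
have sKv : shape p.+1 b q (K 0 p (D 0 p v)).
  by rewrite -(longest_sweepL (shape_l sv)); apply: (shape_loc (loc_longest V 0 p.+1)).
rewrite (longest_sweepR' (shape_r (shape_sweepR sKv))).
congr (dl 0 p (dl e q.+1 (R e q _))).
have cD (f : V -> V) (b' : bool) l h w : local_op b' l h f -> (p <= l)%N ->
    D 0 p (f w) = f (D 0 p w).
  by move=> Hf hl; rewrite (loc_comm _ (loc_longest V 0 p) Hf) //; lia.
rewrite /v (cD _ _ _ _ _ (loc_delta V true e.+1 q)); last by lia.
rewrite (cD _ _ _ _ _ (loc_sweepL V p b)) // (cD _ _ _ _ _ (loc_dots V true e m))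
  ?leq_addr //.
rewrite -/Y.
have cE (f : V -> V) (b' : bool) l h w : local_op b' l h f -> (h <= e.+1)%N ->
    D e.+1 q (f w) = f (D e.+1 q w).
  by move=> Hf hl; rewrite (loc_comm _ (loc_longest V e.+1 q) Hf) //; lia.
have cE' (f : V -> V) (b' : bool) l h w : local_op b' l h f -> (h <= e.+1)%N ->
    dl e.+1 q (f w) = f (dl e.+1 q w).
  by move=> Hf hl; rewrite (loc_comm _ (loc_delta V true e.+1 q) Hf) //; lia.
rewrite (cE' _ _ _ _ _ (loc_sweepL V p b)) // (cE' _ _ _ _ _ (loc_dots V true e m)) //.
rewrite (cE _ _ _ _ _ (loc_sweepR V p b)) // (cE _ _ _ _ _ (loc_sweepL V 0 p));
  last by lia.
rewrite (cE _ _ _ _ _ (loc_sweepL V p b)) // (cE _ _ _ _ _ (loc_dots V true e m)) //.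
rewrite {1}/Y (cE' _ _ _ _ _ (loc_longest V 0 p)); last by lia.
rewrite (cE _ _ _ _ _ (loc_longest V 0 p)); last by lia.
by rewrite (longest_delta_longest_r (shape_r sz)).
Qed.

Lemma dots_link_poly k m j e n z : dots_op k m (link_poly j e n z) = link_poly j e n
  (dots_op k m z).
Proof. by elim: m => //= m ->; rewrite dot_link_poly. Qed.

(** At the left end of the complex dh is absent. The strand moves right and returns over the same
    strands, so relation (3) adds a product of b factors to its m dots, and m + b = p is exactly the
    degree that the last sweep turns into (-1)^p. *)
Lemma homotopy_first p b m z : shape p.+1 b 0 z ->
  E 0 p.+1 z = z -> E p.+1 b z = z -> (m + b)%N = p ->
  serre_h p b 0 m (serre_d p b 0 z) = z.
Proof.
move=> sz e0 e1 mb; rewrite serre_h_serre_d //.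
set Y := D 0 p.+1 z.
change (signed p (dl 0 p.+1 (K 0 p (K p b (dots_op (p + b) m (R p b Y))))) = z).
have sY : shape p.+1 b 0 Y by apply: (shape_loc (loc_longest V 0 p.+1)).
have sR := shape_sweepR sY.
rewrite (sweepL_dots cd); [|exact: (shape_m sR)|by apply: (shape_r sR); lia].
rewrite (sweepL_sweepR_link_poly cd); [|by apply: (shape_l sY);
  lia|exact: (shape_m sY)].
rewrite (@sweepL_link_poly V c d) //; [|exact: (shape_l sz)|lia].
by rewrite mb eqxx (loc_signed _ _ (loc_delta V true 0 p.+1)) signedK.
Qed.

(** At the right end hd is absent and the strand goes left and returns; the left thickness is 0, so
    the sign is trivial. *)
Lemma homotopy_last b q m z : shape 0 b q.+1 z ->
  E 0 b z = z -> E b q.+1 z = z -> (m + b)%N = q ->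
  serre_d 0 b q (serre_h 0 b q m z) = z.
Proof.
move=> sz e0 e1 mb; rewrite serre_d_serre_h //.
set Y := D b q.+1 z.
change (dl b q.+1 (R b q (R 0 b (K 0 b (dots_op b m Y)))) = z).
have sY : shape 0 b q.+1 Y by apply: (shape_loc_r (loc_longest V b q.+1)).
have sx : shape 0 b q.+1 (dots_op b m Y).
  by apply: (shape_loc_r (loc_dots V true b m)) => //; lia.
rewrite (sweepR_sweepL_link_poly cd); [|by apply: (shape_r sx);
  lia|exact: (shape_m sx)].
rewrite -dots_link_poly (@sweepR_link_poly V c d) //; [|exact: (shape_r sz)|lia].
by rewrite mb eqxx.
Qed.

(* Straightening the two strands of colour c that pass the thick strand of
   colour d turns [serre_h_serre_d] into [serre_d_serre_h]
     plus polynomials in the dots; the longest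
   elements on both sides leave only one of their monomials. *)
Lemma homotopy_mid p b q m z : shape p.+1 b q.+1 z ->
  E 0 p.+1 z = z -> E p.+1 b z = z -> E (p.+1 + b) q.+1 z = z ->
  (m + b)%N = (p + q).+1 ->
  serre_h p b q.+1 m (serre_d p b q.+1 z) + serre_d p.+1 b q (serre_h p.+1 b q m z) = z.
Proof.
move=> sz e0 e1 e2 mb; rewrite serre_h_serre_d // serre_d_serre_h //.
set e := (p.+1 + b)%N; rewrite signedS -signedN -signedD.
set Y := D 0 p.+1 (D e q.+1 z).
have sY : shape p.+1 b q.+1 Y.
  by apply: (shape_loc (loc_longest V 0 p.+1)) => //;
    apply: (shape_loc_r (loc_longest V e q.+1)).
have Yl : col p c Y by apply: (shape_l sY); lia.
have Ye : col e c Y by apply: (shape_r sY); lia.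
have Ym := shape_m sY.
rewrite -(locN _ (loc_delta V true 0 p.+1)) -(locN _ (loc_delta V true e q.+1)).
rewrite -(locD _ _ (loc_delta V true 0 p.+1)) -(locD _ _ (loc_delta V true e q.+1)).
set A := K 0 p _; set B := K 0 p.+1 _.
(* It suffices to find (-1)^p Y here: the deltas in front complete the longest elements in Y to
   idempotents that fix z. *)
suff -> : A - R e q (R p.+1 b B) = signed p Y.
  rewrite (loc_signed _ _ (loc_delta V true e q.+1)) (loc_signed _ _ (loc_delta V true
    0 p.+1)) signedK.
  rewrite (loc_comm _ (loc_delta V true e q.+1) (loc_longest V 0 p.+1)); last by lia.
  by rewrite -[dl e q.+1 (D e q.+1 z)]/(E e q.+1 z) e2.
have -> : B = K 0 p (t p (K p.+1 b (dots_op e m Y))) by rewrite /B sweepL_last.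
set u := K p.+1 b Y.
have ue : K p.+1 b (dots_op e m Y) = dots_op p.+1 m u by rewrite (sweepL_dots cd).
have sR := shape_sweepR sY.
have stR : shape p b q.+2 (t (p + b) (R p b Y)).
  by apply: (shape_loc_r (loc_t1 V (p + b))) => //; lia.
(* In hd the two moving strands meet in the first letter of the right sweep, at p + b; the dots are
   slid along their strand to position p. *)
have -> : A = K 0 p (R e q (dots_op p m (K p b (t (p + b) (R p b Y))))).
  rewrite /A -(sweepL_dots cd); [|exact: (shape_m stR)|by apply: (shape_r stR); lia].
  rewrite -(loc_comm _ (loc_sweepL V p b) (loc_sweepR V e q)); last by lia.
  by rewrite -(loc_comm _ (loc_dots V true (p + b) m) (loc_sweepR V e q)) //; lia.
rewrite (sweepL_crs_sweepR cd) // dots_opD -/u (locD _ _ (loc_sweepR V e q)) (locD _ _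
  (loc_sweepL V 0 p)).
have su : shape p.+2 b q u by apply: shape_sweepL.
have u2 : mono p 2 c u by apply: monoW (shape_l su) _ _; lia.
rewrite (loc_comm _ (loc_dots V true p m) (loc_sweepR V p.+1 b)); last by lia.
(* Relation (1): taking the m dots through the crossing costs the divided difference of the m-th
   power. *)
rewrite (dot_crs_dots _ u2) (locD _ _ (loc_sweepR V p.+1 b)) (locD _ _ (loc_sweepR V e
  q)).
rewrite (locD _ _ (loc_sweepL V 0 p)) ue -addrA addrC addrA.
have -> : R e q (R p.+1 b (K 0 p (t p (dots_op p.+1 m u)))) =
          K 0 p (R e q (R p.+1 b (t p (dots_op p.+1 m u)))).
  rewrite (loc_comm _ (loc_sweepL V 0 p) (loc_sweepR V e q)); last by lia.
  by rewrite (loc_comm _ (loc_sweepL V 0 p) (loc_sweepR V p.+1 b)) //; lia.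
(* The fully crossed terms of hd and dh coincide and cancel by the alternating sign. *)
rewrite addrNK.
(* Carried below the sweep, the divided difference has strand e as its second variable, and the
   sweeps become adjacent, so that their double crossings can be resolved. *)
have hpK : dots_diff p p.+1 m u = K p.+1 b (dots_diff p e m Y).
  elim: m {A B mb ue stR} => [|m IH] /=; first by rewrite (loc0 (loc_sweepL _ _ _)).
  rewrite IH (locD _ _ (loc_sweepL V p.+1 b)) -(sweepL_dots cd) //; congr (_ + _).
  by rewrite (loc_comm _ (loc_x1 V true p) (loc_sweepL V p.+1 b)) //; lia.
have Lh : local_op false 0 e.+1 (dots_diff p e m) by apply: loc_dots_diff; lia.
have LQ : local_op false 0 e.+1 (link_poly p.+1 e b) by apply: (@loc_link_poly V) =>
  //; lia.
have Yh : shape p.+1 b q.+1 (dots_diff p e m Y).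
  by split; apply: (mono_pol Lh); [exact: (shape_l sY) | exact: Ym |
    exact: (shape_r sY)].
rewrite hpK (sweepR_sweepL_link_poly cd); [|by apply: (shape_r Yh);
  lia|exact: (shape_m Yh)].
rewrite -/e (pol_comm _ LQ Lh).
have pe : (p < e)%N by lia.
have := @twoS_link_diff V c d cd p q e pe p.+1 b m 0 z (shape_l sz) (shape_r sz).
rewrite /twoS -/e -[twoD _ _ _ _]/Y => ->; [|lia..].
have := @twoS_dots_diff V c d cd p q e pe p.+1 b 0 m z (shape_l sz) (shape_r sz).
rewrite /twoS -/e -[twoD _ _ _ _]/Y => ->; [|lia..].
rewrite addn0 add0n mb eqxx !andbT.
(* One Leibniz half survives for m <= p < m + b, the other for p < m. As p < m + b always holds,
   exactly one contributes. *)
have [mp|pm] := leqP m p; first by rewrite addr0 ltnS leq_addr.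
by rewrite add0r.
Qed.

End Serre.

(** * Diagrams as operators *)

#[local] Hint Resolve deq_refl : core.

Definition typed (A B : word) (f : diag) := [&& dwf f, ddom f == A & dcod f == B].

Lemma typedP A B f : reflect [/\ dwf f, ddom f = A & dcod f = B] (typed A B f).
Proof. by apply: (iffP and3P) => -[-> /eqP-> /eqP->]. Qed.

Lemma typed_deq A B f g : deq f g -> typed A B f -> typed A B g.
Proof.
by move=> /deq_type[e h] /typedP[wf <- <-]; have [d c] := h wf; apply/typedP;
  rewrite -e.
Qed.

Lemma typed_Comp A B C g f : typed B C g -> typed A B f -> typed A C (Comp g f).
Proof.
move=> /typedP[wg dg cg] /typedP[wf df cf].
by apply/typedP; rewrite /= wg wf df cg cf dg eqxx.
Qed.

Lemma typed_Tens A B C D f g : typed A B f -> typed C D g ->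
  typed (A ++ C) (B ++ D) (Tens f g).
Proof. by move=> /typedP[? <- <-] /typedP[? <- <-]; apply/typedP; split=> //;
  apply/andP. Qed.

Lemma typed_Id A : typed A A (Id A).
Proof. by apply/typedP. Qed.

Lemma typed_Zero A B : typed A B (Zero A B).
Proof. by apply/typedP. Qed.

Lemma typed_Add A B f g : typed A B f -> typed A B g -> typed A B (Add f g).
Proof.
move=> /typedP[wf df cf] /typedP[wg dg cg].
by apply/typedP; rewrite /= wf wg df dg cf cg !eqxx.
Qed.

Lemma typed_Opp A B f : typed A B f -> typed A B (Opp f).
Proof. by move=> /typedP[wf df cf]; apply/typedP. Qed.

Section DiagEquations.
Variables (A B : word).
Implicit Types f g h : diag.

Lemma deq_addr0 f : typed A B f -> deq (Add f (Zero A B)) f.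
Proof. by move=> /typedP[_ <- <-]; apply: deq_Add0. Qed.

Lemma deq_add0r f : typed A B f -> deq (Add (Zero A B) f) f.
Proof. by move=> tf; rewrite (deq_AddC (Zero A B) f); apply: deq_addr0. Qed.

Lemma deq_addrN f : typed A B f -> deq (Add f (Opp f)) (Zero A B).
Proof. by move=> /typedP[wf <- <-]; apply: deq_AddN. Qed.

Lemma deq_double0 f : typed A B f -> deq (Add f f) f -> deq f (Zero A B).
Proof.
move=> tf e; have : deq (Add (Add f f) (Opp f)) (Add f (Opp f)) by rewrite e.
by rewrite -deq_AddA (deq_addrN tf) (deq_addr0 tf).
Qed.

Lemma deq_oppr_uniq f g : typed A B f -> typed A B g ->
  deq (Add f g) (Zero A B) -> deq g (Opp f).
Proof.
move=> tf tg e.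
have : deq (Add (Opp f) (Add f g)) (Add (Opp f) (Zero A B)) by rewrite e.
rewrite deq_AddA (deq_AddC (Opp f)) (deq_addrN tf) (deq_add0r tg).
by rewrite (deq_addr0 (typed_Opp tf)).
Qed.

Lemma deq_opp0 : deq (Opp (Zero A B)) (Zero A B).
Proof.
symmetry; apply: deq_oppr_uniq; rewrite ?typed_Zero //.
by apply: deq_addr0; apply: typed_Zero.
Qed.

Lemma deq_sub f g h : typed A B f -> typed A B g ->
  deq (Sub f g) h -> deq f (Add h g).
Proof.
move=> tf tg <-; rewrite /Sub -deq_AddA (deq_AddC (Opp g)) (deq_addrN tg).
by rewrite (deq_addr0 tf).
Qed.

Lemma deq_comp1l f : typed A B f -> deq (Comp (Id B) f) f.
Proof. by move=> /typedP[_ _ <-]; apply: deq_Comp1l. Qed.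

Lemma deq_comp1r f : typed A B f -> deq (Comp f (Id A)) f.
Proof. by move=> /typedP[_ <- _]; apply: deq_Comp1r. Qed.

Lemma deq_idid : deq (Comp (Id A) (Id A)) (Id A).
Proof. exact: (deq_Comp1l (Id A)). Qed.

End DiagEquations.

Section DiagZero.
Variables (A B C D : word).
Implicit Types f g h : diag.

Lemma deq_compr0 g : typed B C g -> deq (Comp g (Zero A B)) (Zero A C).
Proof.
move=> tg; apply: deq_double0; first exact: typed_Comp tg (typed_Zero _ _).
by rewrite -deq_CompDr (deq_addr0 (typed_Zero A B)).
Qed.

Lemma deq_comp0r f : typed A B f -> deq (Comp (Zero B C) f) (Zero A C).
Proof.
move=> tf; apply: deq_double0; first exact: typed_Comp (typed_Zero _ _) tf.
by rewrite -deq_CompDl (deq_addr0 (typed_Zero B C)).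
Qed.

Lemma deq_compN g f : typed B C g -> typed A B f ->
  deq (Comp (Opp g) f) (Opp (Comp g f)).
Proof.
move=> tg tf; apply: deq_oppr_uniq.
- exact: typed_Comp tg tf.
- exact: typed_Comp (typed_Opp tg) tf.
by rewrite -deq_CompDl (deq_addrN tg) (deq_comp0r tf).
Qed.

Lemma deq_tens0r f : typed A B f -> deq (Tens f (Zero C D)) (Zero (A ++ C) (B ++ D)).
Proof.
move=> tf; apply: deq_double0; first exact: typed_Tens tf (typed_Zero _ _).
by rewrite -deq_TensDr (deq_addr0 (typed_Zero C D)).
Qed.

Lemma deq_tens0l f : typed C D f -> deq (Tens (Zero A B) f) (Zero (A ++ C) (B ++ D)).
Proof.
move=> tf; apply: deq_double0; first exact: typed_Tens (typed_Zero _ _) tf.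
by rewrite -deq_TensDl (deq_addr0 (typed_Zero A B)).
Qed.

Lemma deq_tensrN f g : typed A B f -> typed C D g ->
  deq (Tens f (Opp g)) (Opp (Tens f g)).
Proof.
move=> tf tg; apply: deq_oppr_uniq.
- exact: typed_Tens tf tg.
- exact: typed_Tens tf (typed_Opp tg).
by rewrite -deq_TensDr (deq_addrN tg) (deq_tens0r tf).
Qed.

Lemma deq_tensNr f g : typed A B f -> typed C D g ->
  deq (Tens (Opp f) g) (Opp (Tens f g)).
Proof.
move=> tf tg; apply: deq_oppr_uniq.
- exact: typed_Tens tf tg.
- exact: typed_Tens (typed_Opp tf) tg.
by rewrite -deq_TensDl (deq_addrN tf) (deq_tens0l tg).
Qed.

End DiagZero.

(** * Diagrams padded by identity strands *)

Definition box A f C := Tens (Id A) (Tens f (Id C)).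

#[global] Instance box_Proper : Proper (eq ==> deq ==> eq ==> deq) box.
Proof. by move=> A _ <- f g fg C _ <-; rewrite /box fg. Qed.

Section Box.
Implicit Types (f g h : diag) (A B C : word).

Lemma typed_box A f C U W : typed U W f -> typed (A ++ U ++ C) (A ++ W ++ C) (box A f
  C).
Proof. by move=> tf; do !apply: typed_Tens => //; apply: typed_Id. Qed.

Lemma box_comp A g f C : dcod f = ddom g ->
  deq (box A (Comp g f) C) (Comp (box A g C) (box A f C)).
Proof.
move=> e; rewrite /box deq_interchange //=; last by rewrite e.
by rewrite deq_interchange //= !deq_idid.
Qed.

Lemma box_add A f g C : deq (box A (Add f g) C) (Add (box A f C) (box A g C)).
Proof. by rewrite /box deq_TensDl deq_TensDr. Qed.

Lemma box_id A B C : deq (box A (Id B) C) (Id (A ++ B ++ C)).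
Proof. by rewrite /box !deq_TensId. Qed.

Lemma box_idl A B f C : deq (box A (Tens (Id B) f) C) (box (A ++ B) f C).
Proof. by rewrite /box -deq_TensA deq_TensA deq_TensId. Qed.

Lemma box_idr A B f C : deq (box A (Tens f (Id B)) C) (box A f (B ++ C)).
Proof. by rewrite /box -deq_TensA deq_TensId. Qed.

Lemma tens_comp U W U' W' f g : typed U W f -> typed U' W' g ->
  deq (Tens f g) (Comp (Tens f (Id W')) (Tens (Id U) g)).
Proof.
move=> tf tg; have [_ df _] := typedP _ _ _ tf; have [_ _ cg] := typedP _ _ _ tg.
by rewrite deq_interchange //= (deq_comp1r tf) (deq_comp1l tg).
Qed.

Lemma tens_comp' U W U' W' f g : typed U W f -> typed U' W' g ->
  deq (Tens f g) (Comp (Tens (Id W) g) (Tens f (Id U'))).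
Proof.
move=> tf tg; have [_ _ cf] := typedP _ _ _ tf; have [_ dg _] := typedP _ _ _ tg.
by rewrite deq_interchange //= (deq_comp1l tf) (deq_comp1r tg).
Qed.

Lemma box_tens A C U W U' W' f g : typed U W f -> typed U' W' g ->
  deq (box A (Tens f g) C) (Comp (box A f (W' ++ C)) (box (A ++ U) g C)).
Proof.
move=> tf tg; have [_ df _] := typedP _ _ _ tf; have [_ _ cg] := typedP _ _ _ tg.
by rewrite (tens_comp tf tg) box_comp /= ?df ?cg // box_idl box_idr.
Qed.

Lemma box_far A B C U W U' W' f g : typed U W f -> typed U' W' g ->
  deq (Comp (box A f (B ++ W' ++ C)) (box (A ++ U ++ B) g C))
      (Comp (box (A ++ W ++ B) g C) (box A f (B ++ U' ++ C))).
Proof.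
move=> tf tg; have tg' := typed_Tens (typed_Id B) tg.
have -> : A ++ U ++ B = (A ++ U) ++ B by rewrite catA.
have -> : A ++ W ++ B = (A ++ W) ++ B by rewrite catA.
rewrite !(catA B) -(box_idl (A ++ U) B) -(box_idl (A ++ W) B) -(box_tens A C tf tg').
have [_ _ cf] := typedP _ _ _ tf; have [_ dg _] := typedP _ _ _ tg'.
by rewrite (tens_comp' tf tg') box_comp /= ?cf -?dg // box_idl box_idr.
Qed.

End Box.

(** * The abelian group of families of morphisms out of a fixed word *)

Section Families.
Variable w0 : word.

Record family := Family {
  family_val :> word -> diag;
  familyP : forall w, typed w0 w (family_val w) }.

HB.instance Definition _ := gen_eqMixin family.
HB.instance Definition _ := gen_choiceMixin family.

Definition family_eq (f g : family) := `[< forall w, deq (f w) (g w) >].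

Lemma family_eq_refl : reflexive family_eq.
Proof. by move=> f; apply/asboolP. Qed.

Lemma family_eq_sym : symmetric family_eq.
Proof. by move=> f g; apply/asboolP/asboolP => h w; rewrite h. Qed.

Lemma family_eq_trans : transitive family_eq.
Proof. by move=> f g h /asboolP e1 /asboolP e2; apply/asboolP => w; rewrite e1. Qed.

Canonical family_equiv :=
  EquivRel family_eq family_eq_refl family_eq_sym family_eq_trans.

(** The product over all w of Hom_H(w0, w). The classical quotient turns [deq] into equality, so
    that operators can be rewritten in a [zmodType]; with all codomains at once, a crossing acts as
    an endomorphism although it changes the word. *)
Definition homs := {eq_quot family_equiv}%qT.

HB.instance Definition _ := Choice.on homs.

Definition hom_at (z : homs) (w : word) : diag := repr z w.

Lemma hom_at_typed z w : typed w0 w (hom_at z w).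
Proof. exact: familyP. Qed.

Definition clip w f := if typed w0 w f then f else Zero w0 w.

Lemma clipP w f : typed w0 w (clip w f).
Proof. by rewrite /clip; case: ifP => // _; apply: typed_Zero. Qed.

Definition homs_of (h : word -> diag) : homs :=
  (\pi_homs (Family (fun w => clipP w (h w))))%qT.

Lemma hom_at_homs_of h w : typed w0 w (h w) -> deq (hom_at (homs_of h) w) (h w).
Proof.
move=> th; have : (\pi_homs (repr (homs_of h)) = \pi_homs (Family (fun w => clipP w (h
  w))))%qT.
  by rewrite reprK.
by move=> /eqmodP/asboolP/(_ w); rewrite /= /clip th.
Qed.

Lemma homs_ext u v : (forall w, deq (hom_at u w) (hom_at v w)) -> u = v.
Proof.
by move=> e; rewrite -[u]reprK -[v]reprK; apply/eqmodP/asboolP.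
Qed.

Definition homs_zero := homs_of (Zero w0).
Definition homs_add u v := homs_of (fun w => Add (hom_at u w) (hom_at v w)).
Definition homs_opp u := homs_of (fun w => Opp (hom_at u w)).

Lemma hom_at_zero w : deq (hom_at homs_zero w) (Zero w0 w).
Proof. exact: hom_at_homs_of (typed_Zero _ _). Qed.

Lemma hom_at_add u v w : deq (hom_at (homs_add u v) w) (Add (hom_at u w) (hom_at v w)).
Proof. by apply: hom_at_homs_of; apply: typed_Add; apply: hom_at_typed. Qed.

Lemma hom_at_opp u w : deq (hom_at (homs_opp u) w) (Opp (hom_at u w)).
Proof. by apply: hom_at_homs_of; apply: typed_Opp; apply: hom_at_typed. Qed.

Lemma homs_addA : associative homs_add.
Proof. by move=> u v w; apply: homs_ext => a; rewrite !hom_at_add deq_AddA. Qed.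

Lemma homs_addC : commutative homs_add.
Proof. by move=> u v; apply: homs_ext => a; rewrite !hom_at_add deq_AddC. Qed.

Lemma homs_add0 : left_id homs_zero homs_add.
Proof.
by move=> u; apply: homs_ext => a; rewrite hom_at_add hom_at_zero (deq_add0r
  (hom_at_typed _ _)).
Qed.

Lemma homs_addN : left_inverse homs_zero homs_opp homs_add.
Proof.
move=> u; apply: homs_ext => a.
by rewrite hom_at_add hom_at_opp hom_at_zero deq_AddC (deq_addrN (hom_at_typed _ _)).
Qed.

HB.instance Definition _ :=
  GRing.isZmodule.Build homs homs_addA homs_addC homs_add0 homs_addN.

Lemma hom_at0 w : deq (hom_at 0%R w) (Zero w0 w). Proof. exact: hom_at_zero. Qed.
Lemma hom_atD u v w : deq (hom_at (u + v)%R w) (Add (hom_at u w) (hom_at v w)). Proof.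
  exact: hom_at_add. Qed.
Lemma hom_atN u w : deq (hom_at (- u)%R w) (Opp (hom_at u w)). Proof. exact:
  hom_at_opp. Qed.

(* The family supported at the codomain of f (zero if f is not a morphism from
   w0). *)
Definition pure (f : diag) : homs :=
  homs_of (fun w => if typed w0 w f then f else Zero w0 w).

Lemma hom_at_pure f w : deq (hom_at (pure f) w) (if typed w0 w f then f else Zero w0 w).
Proof. by apply: hom_at_homs_of; case: ifP => // _; apply: typed_Zero. Qed.

Lemma pure_deq f g : deq f g -> pure f = pure g.
Proof.
move=> e; apply: homs_ext => w; rewrite !hom_at_pure.
have -> : typed w0 w f = typed w0 w g.
  by apply/idP/idP; apply: typed_deq; rewrite e.
by case: ifP.
Qed.

Lemma pure_inj w f g : typed w0 w f -> typed w0 w g -> pure f = pure g -> deq f g.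
Proof.
move=> tf tg e; have := hom_at_pure f w; have := hom_at_pure g w.
by rewrite tf tg e => eg ef; apply: deq_trans (deq_sym ef) eg.
Qed.

(* A generator of width [n]: [gen_perm] sends the codomain to the domain. *)
Record generator (n : nat) := Generator {
  gen_perm : word -> word;
  gen_diag : word -> diag;
  gen_size : forall u, size (gen_perm u) = size u;
  gen_typed : forall u, typed (gen_perm u) u (gen_diag u);
  gen_inj : injective gen_perm }.

(** The component at w comes from the component at the word below the generator, which is why
    generators are indexed by codomains. Too short words give zero, so the action is total. *)
Definition gen_act n (G : generator n) (k : nat) (z : homs) : homs :=
  homs_of (fun w => if k + n <= size w then
    let u := take n (drop k w) in
    Comp (box (take k w) (gen_diag G u) (drop n (drop k w)))
         (hom_at z (take k w ++ gen_perm G u ++ drop n (drop k w)))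
    else Zero w0 w).

Lemma hom_at_gen_act_out n (G : generator n) k z w : ~~ (k + n <= size w) ->
  deq (hom_at (gen_act G k z) w) (Zero w0 w).
Proof. by move=> /negPf h; rewrite hom_at_homs_of h //; apply: typed_Zero. Qed.

Lemma typed_gen_act n (G : generator n) A u C z :
  typed w0 (A ++ u ++ C) (Comp (box A (gen_diag G u) C) (hom_at z (A ++ gen_perm G u
    ++ C))).
Proof. by apply: typed_Comp (hom_at_typed _ _); apply: typed_box; apply: gen_typed. Qed.

Lemma hom_at_gen_act n (G : generator n) k z A u C : k = size A -> size u = n ->
  deq (hom_at (gen_act G k z) (A ++ u ++ C))
      (Comp (box A (gen_diag G u) C) (hom_at z (A ++ gen_perm G u ++ C))).
Proof.
move=> -> su; subst n; rewrite hom_at_homs_of take_size_cat // drop_size_cat //.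
  by rewrite take_size_cat // drop_size_cat // !size_cat leq_add2l leq_addr.
rewrite take_size_cat // drop_size_cat // !size_cat leq_add2l leq_addr.
exact: typed_gen_act.
Qed.

Lemma cat3P n k (w : word) : k + n <= size w ->
  exists A u C, [/\ w = A ++ u ++ C, size A = k & size u = n].
Proof.
move=> h; exists (take k w), (take n (drop k w)), (drop n (drop k w)).
by rewrite !cat_take_drop !size_takel // ?size_drop; lia.
Qed.

Lemma gen_act_add n (G : generator n) k u v : gen_act G k (u + v)%R = (gen_act G k u +
  gen_act G k v)%R.
Proof.
apply: homs_ext => w; rewrite hom_atD; have [h|h] := boolP (k + n <= size w).
  have [A [a [C [-> sA sa]]]] := cat3P h.
  by rewrite !hom_at_gen_act // hom_atD deq_CompDr.
by rewrite !hom_at_gen_act_out // (deq_addr0 (typed_Zero _ _)).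
Qed.

Lemma gen_act_far n n' (G : generator n) (G' : generator n') k k' z : k + n <= k' ->
  gen_act G k (gen_act G' k' z) = gen_act G' k' (gen_act G k z).
Proof.
move=> hk; apply: homs_ext => w.
have [h|h] := boolP (k' + n' <= size w); last first.
  rewrite (hom_at_gen_act_out _ _ h); have [h'|h'] := boolP (k + n <= size w);
    last first.
    by rewrite hom_at_gen_act_out.
  have [A [a [C [ew sA sa]]]] := cat3P h'; rewrite {}ew in h h' *.
  rewrite hom_at_gen_act // hom_at_gen_act_out; last by move: h;
    rewrite !size_cat gen_size.
  rewrite deq_compr0 //; apply: typed_box; exact: gen_typed.
have [B [b [C [ew sB sb]]]] := cat3P h; rewrite {}ew in h *.
have hB : k + n <= size B by lia.
have [A [a [A' [eB sA sa]]]] := cat3P hB; rewrite {}eB in sB h hB *.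
rewrite -!catA [X in deq X _]hom_at_gen_act //.
have e1 : A ++ gen_perm G a ++ A' ++ b ++ C = (A ++ gen_perm G a ++ A') ++ b ++ C.
  by rewrite -!catA.
have e2 : A ++ a ++ A' ++ b ++ C = (A ++ a ++ A') ++ b ++ C by rewrite -!catA.
rewrite e1 hom_at_gen_act //; last by rewrite -sB !size_cat gen_size.
rewrite e2 hom_at_gen_act // -!catA hom_at_gen_act // !deq_CompA.
by rewrite (box_far A A' C (gen_typed G a) (gen_typed G' b)).
Qed.

(** Injectivity of [gen_perm] enters here: two codomains with the same word below the generator
    would spread a pure family over several words. *)
Lemma pure_gen_act n (G : generator n) A u C f : size u = n ->
  typed w0 (A ++ gen_perm G u ++ C) f ->
  pure (Comp (box A (gen_diag G u) C) f) = gen_act G (size A) (pure f).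
Proof.
move=> su tf; apply: homs_ext => w; rewrite hom_at_pure.
have tc : typed w0 (A ++ u ++ C) (Comp (box A (gen_diag G u) C) f).
  by apply: typed_Comp tf; apply: typed_box; apply: gen_typed.
case: ifP => [tw|tw].
  have [_ _ <-] := typedP _ _ _ tw; have [_ _ ->] := typedP _ _ _ tc.
  by rewrite hom_at_gen_act // hom_at_pure tf.
have [h|h] := boolP (size A + n <= size w); last by rewrite hom_at_gen_act_out.
have [A' [a [C' [ew sA sa]]]] := cat3P h; rewrite {}ew in tw h *.
rewrite hom_at_gen_act // hom_at_pure; case: ifP => [tf'|_]; last first.
  by rewrite deq_compr0 //; apply: typed_box; apply: gen_typed.
case/negP: tw; have [_ _ e1] := typedP _ _ _ tf; have [_ _ e2] := typedP _ _ _ tf'.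
move: e2; rewrite e1 => /eqP; rewrite eqseq_cat // eqseq_cat ?gen_size ?su //.
by case/and3P => /eqP <- /eqP/gen_inj <- /eqP <-.
Qed.

End Families.

(** Indexing is by codomain, so the crossing that ends in the word c d is [Cross d c]. The values at
    words of other lengths are well-typed fillers. *)
Definition dot_diag (u : word) := if u is [:: c] then Dot c else Id u.
Definition crs_perm (u : word) := if u is [:: c; d] then [:: d; c] else u.
Definition crs_diag (u : word) := if u is [:: c; d] then Cross d c else Id u.

Lemma dot_diag_typed u : typed u u (dot_diag u).
Proof. by case: u => [|c [|d u]]; apply/typedP. Qed.

Lemma crs_perm_size u : size (crs_perm u) = size u.
Proof. by case: u => [|c [|d [|e u]]]. Qed.

Lemma crs_diag_typed u : typed (crs_perm u) u (crs_diag u).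
Proof. by case: u => [|c [|d [|e u]]]; apply/typedP. Qed.

Lemma crs_perm_inj : injective crs_perm.
Proof. by move=> [|c [|d [|e u]]] [|c' [|d' [|e' u']]] //= [-> ->]. Qed.

Definition dot_gen : generator 1 :=
  @Generator 1 id dot_diag (fun u => erefl) dot_diag_typed (fun u v e => e).
Definition crs_gen : generator 2 :=
  @Generator 2 crs_perm crs_diag crs_perm_size crs_diag_typed crs_perm_inj.

(** * Relations (1) to (5) as identities of operators *)

Section Klr.
Variable w0 : word.
Local Notation H := (homs w0).
Implicit Types (u v z : H) (A C w : word) (j k n : nat) (c d : colour).

Definition hdot k z : H := gen_act dot_gen k z.
Definition hcrs k z : H := gen_act crs_gen k z.
Definition hcol k c z := forall w, ~~ ((k < size w) && (nth One w k == c)) ->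
  deq (hom_at z w) (Zero w0 w).

Lemma hom_at_gen_act_zero n (G : generator n) k z w :
  (forall A (s : word) C, w = A ++ s ++ C -> size A = k -> size s = n ->
     deq (hom_at z (A ++ gen_perm G s ++ C)) (Zero w0 (A ++ gen_perm G s ++ C))) ->
  deq (hom_at (gen_act G k z) w) (Zero w0 w).
Proof.
move=> h; have [hw|hw] := boolP (k + n <= size w); last by rewrite hom_at_gen_act_out.
have [A [a [C [ew sA sa]]]] := cat3P hw; have := h _ _ _ ew sA sa.
rewrite ew => e; rewrite hom_at_gen_act // e deq_compr0 //.
by apply: typed_box; apply: gen_typed.
Qed.

Lemma hcol0 k c : hcol k c 0%R.
Proof. by move=> w _; apply: hom_at0. Qed.

Lemma hcolD k c u v : hcol k c u -> hcol k c v -> hcol k c (u + v)%R.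
Proof.
by move=> hu hv w hw; rewrite hom_atD hu // hv // (deq_addr0 (typed_Zero _ _)).
Qed.

Lemma hcolN k c u : hcol k c u -> hcol k c (- u)%R.
Proof. by move=> hu w hw; rewrite hom_atN hu // deq_opp0. Qed.

Lemma hcol_dot j k c u : hcol k c u -> hcol k c (hdot j u).
Proof. by move=> hu w hw; apply: hom_at_gen_act_zero => A v C ew _ _; apply: hu;
  rewrite -ew. Qed.

Lemma hcol_crs j k c u : (k < j) || (j.+1 < k) -> hcol k c u -> hcol k c (hcrs j u).
Proof.
move=> jk hu w hw; apply: hom_at_gen_act_zero => A v C ew sA sv; apply: hu.
move: hw; rewrite ew !size_cat !nth_cat gen_size sv sA.
case: (ltnP k j) => // kj; case: (ltnP (k - j) 2) => // kj2; lia.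
Qed.

Lemma hcol_crs_l j c u : hcol j.+1 c u -> hcol j c (hcrs j u).
Proof.
move=> hu w hw; apply: hom_at_gen_act_zero => A [|a [|b [|? ?]]] // C ew sA sv;
  apply: hu.
move: hw; rewrite ew !nth_cat !size_cat /= sA ltnn subnn subSnn /=.
have -> : (j.+1 < j) = false by lia.
by apply: contra => /andP[_ ->]; rewrite andbT; lia.
Qed.

Lemma hcol_crs_r j c u : hcol j c u -> hcol j.+1 c (hcrs j u).
Proof.
move=> hu w hw; apply: hom_at_gen_act_zero => A [|a [|b [|? ?]]] // C ew sA sv;
  apply: hu.
move: hw; rewrite ew !nth_cat !size_cat /= sA ltnn subnn subSnn /=.
have -> : (j.+1 < j) = false by lia.
by apply: contra => /andP[_ ->]; rewrite andbT; lia.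
Qed.

Lemma hdotC j k u : hdot j (hdot k u) = hdot k (hdot j u).
Proof.
case: (ltngtP j k) => [h|h|->] //; first by apply: gen_act_far; lia.
by apply/esym/gen_act_far; lia.
Qed.

Lemma hcrs_dotC j k u : (k < j) || (j.+1 < k) -> hcrs j (hdot k u) = hdot k (hcrs j u).
Proof. by case/orP => h; [apply/esym/gen_act_far | apply: gen_act_far]; lia. Qed.

Lemma hcrsC j k u : j.+1 < k -> hcrs j (hcrs k u) = hcrs k (hcrs j u).
Proof. by move=> h; apply: gen_act_far; lia. Qed.

Section Local.
Variables (A C : word).
Local Notation at_ s := (A ++ s ++ C).
Local Notation k := (size A).

Lemma hom_at_dot2_l a b z : deq (hom_at (hdot k z) (at_ [:: a; b]))
  (Comp (box A (Tens (Dot a) (Id [:: b])) C) (hom_at z (at_ [:: a; b]))).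
Proof. by rewrite (@hom_at_gen_act _ _ dot_gen k z A [:: a] (b :: C)) //= box_idr. Qed.

Lemma hom_at_dot2_r a b z : deq (hom_at (hdot k.+1 z) (at_ [:: a; b]))
  (Comp (box A (Tens (Id [:: a]) (Dot b)) C) (hom_at z (at_ [:: a; b]))).
Proof.
have e : at_ [:: a; b] = (A ++ [:: a]) ++ [:: b] ++ C by rewrite -catA.
by rewrite e (@hom_at_gen_act _ _ dot_gen _ z (A ++ [:: a]) [:: b]
  C) ?size_cat ?addn1 //= box_idl.
Qed.

Lemma hom_at_crs2 a b z : deq (hom_at (hcrs k z) (at_ [:: a; b]))
  (Comp (box A (Cross b a) C) (hom_at z (at_ [:: b; a]))).
Proof. by rewrite (@hom_at_gen_act _ _ crs_gen k z A [:: a; b] C). Qed.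

Lemma hom_at_crs3_l a b c z : deq (hom_at (hcrs k z) (at_ [:: a; b; c]))
  (Comp (box A (Tens (Cross b a) (Id [:: c])) C) (hom_at z (at_ [:: b; a; c]))).
Proof. by rewrite (@hom_at_gen_act _ _ crs_gen k z A [:: a; b]
  (c :: C)) //= box_idr. Qed.

Lemma hom_at_crs3_r a b c z : deq (hom_at (hcrs k.+1 z) (at_ [:: a; b; c]))
  (Comp (box A (Tens (Id [:: a]) (Cross c b)) C) (hom_at z (at_ [:: a; c; b]))).
Proof.
have e s : at_ (a :: s) = (A ++ [:: a]) ++ s ++ C by rewrite -catA.
by rewrite !e (@hom_at_gen_act _ _ crs_gen _ z (A ++ [:: a]) [:: b; c]
  C) ?size_cat ?addn1 //= box_idl.
Qed.

End Local.

Lemma box_merge A C g f h : dcod f = ddom g ->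
  deq (Comp (box A g C) (Comp (box A f C) h)) (Comp (box A (Comp g f) C) h).
Proof. by move=> e; rewrite deq_CompA -box_comp. Qed.

Lemma box_zero A U W C :
  deq (box A (Zero U W) C) (Zero (A ++ U ++ C) (A ++ W ++ C)).
Proof. by rewrite /box (deq_tens0l _ _ (typed_Id C)) (deq_tens0r _ _ (typed_Id A)). Qed.

(** Both sides vanish at words with other colours at k and k+1, so a relation is tested only where
    its colours occur. These are colours of the codomain: after one crossing they appear
    exchanged. *)
Lemma homs_ext2 k c d u v :
  hcol k c u -> hcol k.+1 d u -> hcol k c v -> hcol k.+1 d v ->
  (forall A C, size A = k ->
     deq (hom_at u (A ++ [:: c; d] ++ C)) (hom_at v (A ++ [:: c; d] ++ C))) -> u = v.
Proof.
move=> uc ud vc vd h; apply: homs_ext => w.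
have [wc|wc] := boolP ((k < size w) && (nth One w k == c)); last by rewrite uc ?vc.
have [wld|wld] := boolP ((k.+1 < size w) && (nth One w k.+1 == d));
  last by rewrite ud ?vd.
case/andP: wc => kw /eqP wc; case/andP: wld => kw' /eqP wld.
rewrite -(cat_take_drop k w) (drop_nth One kw) (drop_nth One kw') wc wld.
by apply: (h _ (drop k.+2 w)); rewrite size_takel // ltnW.
Qed.

Lemma homs_ext3 k c d e u v :
  hcol k c u -> hcol k.+1 d u -> hcol k.+2 e u ->
  hcol k c v -> hcol k.+1 d v -> hcol k.+2 e v ->
  (forall A C, size A = k ->
     deq (hom_at u (A ++ [:: c; d; e] ++ C)) (hom_at v (A ++ [:: c; d; e]
       ++ C))) -> u = v.
Proof.
move=> uc ud ue vc vd ve h; apply: (homs_ext2 uc ud vc vd) => A C sA.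
case: C => [|e' C]; first by rewrite ue ?ve // size_cat sA addn2 ltnn.
have [->|ne] := eqVneq e' e; first exact: h.
have out : ~~ ((k.+2 < size (A ++ [:: c, d, e' & C])) &&
               (nth One (A ++ [:: c, d, e' & C]) k.+2 == e)).
  by rewrite -(addn2 k) -sA nth_cat [size A + 2 < size A]ltnNge leq_addr /= addKn /=
    (negPf ne) andbF.
exact: deq_trans (ue _ out) (deq_sym (ve _ out)).
Qed.

Lemma add_nil_l c :
  deq (Comp (Cross c c) (Tens (Dot c) (Id [:: c])))
      (Add (Id [:: c; c]) (Comp (Tens (Id [:: c]) (Dot c)) (Cross c c))).
Proof.
by apply: (@deq_sub [:: c; c] [:: c; c]) (rel_nil_l c); apply/typedP; rewrite /= !eqxx.
Qed.

Lemma add_nil_r c :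
  deq (Comp (Tens (Dot c) (Id [:: c])) (Cross c c))
      (Add (Id [:: c; c]) (Comp (Cross c c) (Tens (Id [:: c]) (Dot c)))).
Proof.
by apply: (@deq_sub [:: c; c] [:: c; c]) (rel_nil_r c); apply/typedP; rewrite /= !eqxx.
Qed.

Lemma add_r3 c d e :
  deq (Comp (Tens (Cross d e) (Id [:: c]))
        (Comp (Tens (Id [:: d]) (Cross c e)) (Tens (Cross c d) (Id [:: e]))))
      (Add (if (c == e) && (c != d) then Id [:: c; d; e]
            else Zero [:: c; d; e] [:: e; d; c])
        (Comp (Tens (Id [:: e]) (Cross c d))
          (Comp (Tens (Cross c e) (Id [:: d])) (Tens (Id [:: c]) (Cross d e))))).
Proof.
apply: (@deq_sub [:: c; d; e] [:: e; d; c]) (rel_r3 c d e);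
  by apply/typedP; rewrite /= !eqxx.
Qed.

Ltac hcol_solve := repeat first [ eassumption | apply: hcolD | apply: hcol_dot
  | apply: hcol_crs_l | apply: hcol_crs_r | apply: hcol_crs; first lia ].

Lemma hcrs_dot k c u : hcol k c u -> hcol k.+1 c u ->
  hcrs k (hdot k u) = (hdot k.+1 (hcrs k u) + u)%R.
Proof.
move=> h0 h1; apply: (@homs_ext2 k c c); try by hcol_solve.
move=> A C <-; rewrite hom_at_crs2 hom_at_dot2_l box_merge // hom_atD hom_at_dot2_r
  hom_at_crs2 box_merge //.
by rewrite add_nil_l box_add box_id deq_CompDl (deq_comp1l (hom_at_typed _ _)) deq_AddC.
Qed.

Lemma hdot_crs k c u : hcol k c u -> hcol k.+1 c u ->
  hdot k (hcrs k u) = (hcrs k (hdot k.+1 u) + u)%R.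
Proof.
move=> h0 h1; apply: (@homs_ext2 k c c); try by hcol_solve.
move=> A C <-; rewrite hom_at_dot2_l hom_at_crs2 box_merge // hom_atD hom_at_crs2
  hom_at_dot2_r box_merge //.
by rewrite add_nil_r box_add box_id deq_CompDl (deq_comp1l (hom_at_typed _ _)) deq_AddC.
Qed.

Lemma hcrs_sq k c u : hcol k c u -> hcol k.+1 c u -> hcrs k (hcrs k u) = 0%R.
Proof.
move=> h0 h1; apply: (@homs_ext2 k c c); try by hcol_solve.
- exact: hcol0.
- exact: hcol0.
move=> A C <-; rewrite !hom_at_crs2 box_merge // rel_sq hom_at0 box_zero.
exact: deq_comp0r (hom_at_typed _ _).
Qed.

Lemma hcrs_r2 k c d u : c != d -> hcol k c u -> hcol k.+1 d u ->
  hcrs k (hcrs k u) = (hdot k u + hdot k.+1 u)%R.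
Proof.
move=> cd h0 h1; apply: (@homs_ext2 k c d); try by hcol_solve.
move=> A C <-; rewrite !hom_at_crs2 box_merge // rel_r2 // hom_atD hom_at_dot2_l
  hom_at_dot2_r.
by rewrite box_add deq_CompDl.
Qed.

Lemma hslide_l k c d u : c != d -> hcol k c u -> hcol k.+1 d u ->
  hdot k (hcrs k u) = hcrs k (hdot k.+1 u).
Proof.
move=> cd h0 h1; apply: (@homs_ext2 k d c); try by hcol_solve.
move=> A C <-; rewrite hom_at_dot2_l hom_at_crs2 box_merge // hom_at_crs2
  hom_at_dot2_r box_merge //.
by rewrite rel_slide_l.
Qed.

Lemma hslide_r k c d u : c != d -> hcol k c u -> hcol k.+1 d u ->
  hdot k.+1 (hcrs k u) = hcrs k (hdot k u).
Proof.
move=> cd h0 h1; apply: (@homs_ext2 k d c); try by hcol_solve.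
move=> A C <-; rewrite hom_at_dot2_r hom_at_crs2 box_merge // hom_at_crs2
  hom_at_dot2_l box_merge //.
by rewrite rel_slide_r.
Qed.

Lemma hbraid_gen k c d e u : hcol k c u -> hcol k.+1 d u -> hcol k.+2 e u ->
  hcrs k (hcrs k.+1 (hcrs k u)) = (hcrs k.+1 (hcrs k (hcrs k.+1 u)) +
    (if (c == e) && (c != d) then u else 0))%R.
Proof.
move=> h0 h1 h2; apply: (@homs_ext3 k e d c); try by hcol_solve.
1-3: case: ifP => [/andP[/eqP ce _]|_]; hcol_solve; subst; hcol_solve; exact: hcol0.
move=> A C <-; rewrite hom_atD !(hom_at_crs3_l, hom_at_crs3_r) !box_merge //.
rewrite -!deq_CompA add_r3 box_add deq_CompDl deq_AddC.
case: ifP => [/andP[/eqP <- _]|_]; first by rewrite box_id (deq_comp1l (hom_at_typed _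
  _)).
by rewrite box_zero hom_at0 (deq_comp0r _ (hom_at_typed _ _)).
Qed.

Lemma hbraid k c d e u : hcol k c u -> hcol k.+1 d u -> hcol k.+2 e u ->
  ~~ ((c == e) && (c != d)) ->
  hcrs k (hcrs k.+1 (hcrs k u)) = hcrs k.+1 (hcrs k (hcrs k.+1 u)).
Proof. by move=> h0 h1 h2 ne; rewrite (hbraid_gen h0 h1 h2) (negPf ne) addr0. Qed.

Lemma hbraid1 k c d u : hcol k c u -> hcol k.+1 d u -> hcol k.+2 c u -> c != d ->
  hcrs k (hcrs k.+1 (hcrs k u)) = (hcrs k.+1 (hcrs k (hcrs k.+1 u)) + u)%R.
Proof. by move=> h0 h1 h2 cd; rewrite (hbraid_gen h0 h1 h2) eqxx cd. Qed.

Definition klr_homs : klrModule :=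
  @KlrModule H hdot hcrs hcol (fun k => @gen_act_add _ _ dot_gen k)
    (fun k => @gen_act_add _ _ crs_gen k) hcol0 hcolD hcolN hcol_dot hcol_crs hcol_crs_l
    hcol_crs_r hdotC hcrs_dotC hcrsC hcrs_dot hdot_crs hcrs_sq hcrs_r2 hslide_l
    hslide_r hbraid hbraid1.

End Klr.

(** * From operators back to diagrams *)

(** Colour labels are dropped, since the vector knows the colours. In a tensor product the second
    factor acts first, and its offset is the domain of the first factor, the word then standing on
    its left. *)
Fixpoint diag_op (V : klrModule) (f : diag) (k : nat) : V -> V :=
  match f with
  | Id _ => id
  | Dot _ => @dot V k
  | Cross _ _ => @crs V k
  | Comp g f => @diag_op V g k \o @diag_op V f k
  | Tens f g => @diag_op V f k \o @diag_op V g (k + size (ddom f))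
  | Zero _ _ => fun=> 0%R
  | Add f g => fun z => (@diag_op V f k z + @diag_op V g k z)%R
  | Opp f => fun z => (- @diag_op V f k z)%R
  end.

Arguments diag_op V f k : clear implicits.

Section Reflection.
Variable w0 : word.
Local Notation V := (klr_homs w0).

Lemma pure_add w f g : typed w0 w f -> typed w0 w g ->
  pure w0 (Add f g) = (pure w0 f + pure w0 g)%R.
Proof.
move=> tf tg; apply: homs_ext => w'; rewrite hom_atD !hom_at_pure.
have ta := typed_Add tf tg.
have [[_ _ cf] [_ _ cg]] := (typedP _ _ _ tf, typedP _ _ _ tg).
have [ww|ww] := eqVneq w w'; first by rewrite -ww tf tg ta.
have no f' : dcod f' = w -> typed w0 w' f' = false.
  by move=> cf'; apply/typedP => -[_ _ e]; rewrite -e cf' eqxx in ww.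
by rewrite !no // (deq_addr0 (typed_Zero _ _)).
Qed.

Lemma pure_zero w : pure w0 (Zero w0 w) = 0%R.
Proof.
apply: homs_ext => w'; rewrite hom_at_pure hom_at0; case: ifP => //.
by move=> /typedP[_ _ /= ->].
Qed.

Lemma pure_opp w f : typed w0 w f -> pure w0 (Opp f) = (- pure w0 f)%R.
Proof.
move=> tf; apply/eqP; rewrite -addr_eq0 -(pure_add (typed_Opp tf) tf).
by rewrite (pure_deq w0 (deq_AddC _ _)) (pure_deq w0 (deq_addrN tf)) pure_zero.
Qed.

Lemma diag_op_pure g A C f : dwf g -> typed w0 (A ++ ddom g ++ C) f ->
  pure w0 (Comp (box A g C) f) = diag_op V g (size A) (pure w0 f).
Proof.
elim: g A C f => [B|i|i j|g2 IH2 g1 IH1|g1 IH1 g2 IH2|B B'|g1 IH1 g2 IH2|g IH] A C f /=.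
- move=> _ tf; apply: pure_deq; rewrite box_id; exact: deq_comp1l tf.
- by move=> _ tf; apply: (@pure_gen_act w0 1 dot_gen A [:: i] C f).
- by move=> _ tf; apply: (@pure_gen_act w0 2 crs_gen A [:: j; i] C f).
- case/and3P => w2 w1 /eqP e tf.
  rewrite (pure_deq w0 (deq_Comp (box_comp A C e) (deq_refl f))).
  rewrite -(pure_deq w0 (deq_CompA _ _ _)) IH2 // ?IH1 // -e.
  by apply: typed_Comp tf; apply: typed_box; apply/typedP.
- case/andP=> w1 w2; rewrite -catA => tf.
  have t1 : typed (ddom g1) (dcod g1) g1 by apply/typedP.
  have t2 : typed (ddom g2) (dcod g2) g2 by apply/typedP.
  rewrite (pure_deq w0 (deq_Comp (box_tens A C t1 t2) (deq_refl f))).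
  rewrite -(pure_deq w0 (deq_CompA _ _ _)) IH1 //.
    by rewrite IH2 ?size_cat -?catA.
  apply: typed_Comp; last exact: tf.
  by rewrite (catA A) (catA A _ (dcod g2 ++ C)); apply: typed_box.
- move=> _ tf; rewrite -(pure_zero (A ++ B' ++ C)); apply: pure_deq.
  by rewrite box_zero (deq_comp0r _ tf).
- case/and4P => w1 w2 /eqP ed /eqP ec tf.
  have t1 : typed (ddom g1) (dcod g1) g1 by apply/typedP.
  have t2 : typed (ddom g1) (dcod g1) g2 by apply/typedP; rewrite ed ec.
  rewrite (pure_deq w0 (deq_Comp (box_add A g1 g2 C) (deq_refl f))).
  rewrite (pure_deq w0 (deq_CompDl _ _ _)).
  rewrite (pure_add (typed_Comp (typed_box A C t1) tf) (typed_Comp (typed_box A C t2)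
    tf)).
  by rewrite IH1 // IH2 // -ed.
- move=> wg tf; have tg : typed (ddom g) (dcod g) g by apply/typedP.
  have e : deq (Comp (box A (Opp g) C) f) (Opp (Comp (box A g C) f)).
    rewrite /box (deq_tensNr tg (typed_Id C)).
    rewrite (deq_tensrN (typed_Id A) (typed_Tens tg (typed_Id C))).
    exact: deq_compN (typed_box A C tg) tf.
  rewrite (pure_deq w0 e) (pure_opp (typed_Comp (typed_box A C tg) tf)).
  by rewrite IH.
Qed.

(** Applied to the identity of its domain, the operator of a diagram returns the family of the
    diagram itself; this carries operator identities back to H. *)
Lemma deq_diag_op g g' U W : typed U W g -> typed U W g' ->
  w0 = U -> diag_op V g 0 (pure w0 (Id U)) = diag_op V g' 0 (pure w0 (Id U)) -> deq g
    g'.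
Proof.
move=> tg tg' e0; have [wg dg _] := typedP _ _ _ tg; have [wg' dg' _]
  := typedP _ _ _ tg'.
have tI : typed w0 ([::] ++ U ++ [::]) (Id U) by rewrite /= cats0 e0 typed_Id.
have := @diag_op_pure g [::] [::] (Id U) wg; rewrite dg => /(_ tI) /= <-.
have := @diag_op_pure g' [::] [::] (Id U) wg'; rewrite dg' => /(_ tI) /= <-.
have e f : typed U W f -> pure w0 (Comp (box [::] f [::]) (Id U)) = pure w0 f.
  move=> tf; apply: pure_deq; rewrite /box deq_Tens1l deq_Tens1r.
  exact: deq_comp1r tf.
rewrite !e //; apply: (@pure_inj w0 W); by rewrite e0.
Qed.

End Reflection.

Lemma hcol_id U k c : (k < size U) -> nth One U k = c ->
  @col (klr_homs U) k c (pure U (Id U)).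
Proof.
move=> kU e w; rewrite hom_at_pure; case: ifP => // /typedP[_ _ /= <-].
by rewrite kU e eqxx.
Qed.

(** * The diagrams of the complex, their types and degrees *)

Fixpoint uncross (i j : colour) (l : nat) : diag :=
  if l is l'.+1 then
    Comp (Tens (Cross j i) (Id (nseq l' j))) (Tens (Id [:: j]) (uncross i j l'))
  else Id [:: i].

Lemma nseq_rcons (i : colour) n : nseq n i ++ [:: i] = i :: nseq n i.
Proof. by elim: n => //= n ->. Qed.

Lemma typed_dots i m : typed [:: i] [:: i] (dots i m).
Proof.
elim: m => [|m IH] /=; first exact: typed_Id.
by apply: typed_Comp IH; apply/typedP.
Qed.

Lemma typed_delta i n : typed (nseq n i) (nseq n i) (delta i n).
Proof.
elim: n => [|n IH] /=; first exact: typed_Id.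
exact: typed_Tens (typed_dots i n) IH.
Qed.

Lemma typed_uncross i j l : typed (nseq l j ++ [:: i]) (i :: nseq l j) (uncross i j l).
Proof.
elim: l => [|l IH] /=; first exact: typed_Id.
apply: (@typed_Comp _ (j :: i :: nseq l j)).
  by apply: (@typed_Tens [:: j; i] [:: i; j]); [apply/typedP | apply: typed_Id].
exact: (@typed_Tens [:: j] [:: j] _ _ _ _ (typed_Id _) IH).
Qed.

Lemma last_to_first_uncross i n : last_to_first i n = uncross i i n.
Proof. by elim: n => //= n ->. Qed.

Lemma typed_longest i n : typed (nseq n i) (nseq n i) (longest i n).
Proof.
elim: n => [|n IH] /=; first exact: typed_Id.
apply: (@typed_Comp _ (i :: nseq n i)).
  exact: (@typed_Tens [:: i] [:: i] _ _ _ _ (typed_Id _) IH).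
by rewrite last_to_first_uncross -{1}nseq_rcons; apply: typed_uncross.
Qed.

Lemma typed_idem i n : typed (nseq n i) (nseq n i) (thick_idem i n).
Proof. exact: typed_Comp (typed_delta i n) (typed_longest i n). Qed.

Lemma typed_cross1 i j l : typed (i :: nseq l j) (nseq l j ++ [:: i]) (cross1 i j l).
Proof.
elim: l => [|l IH] /=; first exact: typed_Id.
apply: (@typed_Comp _ (j :: i :: nseq l j)).
  exact: (@typed_Tens [:: j] [:: j] _ _ _ _ (typed_Id _) IH).
by apply: (@typed_Tens [:: i; j] [:: j; i]); [apply/typedP | apply: typed_Id].
Qed.

Lemma typed_chi1 i j l : typed (i :: nseq l j) (nseq l j ++ [:: i]) (chi i j 1 l).
Proof.
rewrite /=; apply: (@typed_Comp _ (i :: nseq l j)).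
  rewrite -[i :: _]cats0 -[X in typed _ X _]cats0.
  exact: typed_Tens (typed_cross1 i j l) (typed_Id _).
exact: (@typed_Tens [:: i] [:: i] _ _ _ _ (typed_Id _) (typed_Id _)).
Qed.

Section Op.
Variable V : klrModule.

Lemma diag_op_dots i m k : diag_op V (dots i m) k = dots_op k m.
Proof. by elim: m => //= m ->. Qed.

Lemma ddom_typed A B f : typed A B f -> ddom f = A.
Proof. by case/typedP. Qed.

Lemma diag_op_delta i n k : diag_op V (delta i n) k = delta_op k n.
Proof.
elim: n k => //= n IH k.
by rewrite (ddom_typed (typed_dots i n)) diag_op_dots addn1 IH.
Qed.

Lemma diag_op_uncross i j n k : diag_op V (uncross i j n) k = sweepL k n.
Proof. by elim: n k => //= n IH k; rewrite addn1 IH. Qed.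

Lemma diag_op_longest i n k : diag_op V (longest i n) k = longest_op k n.
Proof.
by elim: n k => //= n IH k; rewrite addn1 IH last_to_first_uncross diag_op_uncross.
Qed.

Lemma diag_op_thick_idem i n k : diag_op V (thick_idem i n) k = thick_op k n.
Proof. by rewrite /= diag_op_delta diag_op_longest. Qed.

Lemma diag_op_cross1 i j n k : diag_op V (cross1 i j n) k = sweepR k n.
Proof. by elim: n k => //= n IH k; rewrite addn1 IH. Qed.

Lemma diag_op_chi1 i j n k : diag_op V (chi i j 1 n) k = sweepR k n.
Proof. by rewrite /= diag_op_cross1. Qed.

End Op.

Definition triangle n : int := ((n * n.-1)./2)%:Z.

Lemma triangleS n : triangle n.+1 = (triangle n + n%:Z)%R.
Proof.
rewrite /triangle; case: n => // n.
have -> : n.+2 * n.+2.-1 = n.+1 * n.+1.-1 + (n.+1).*2.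
  by rewrite /= -mul2n mulnC [2 * _]mulnC -mulnDr addn2.
by rewrite halfD odd_double andbF doubleK add0n PoszD.
Qed.

Lemma hdeg_eq f s t : hdeg f s -> s = t -> hdeg f t.
Proof. by move=> h <-. Qed.

Lemma hdeg_dots i m : hdeg (dots i m) (2 * m%:Z)%R.
Proof.
elim: m => [|m IH]; first exact: hdeg_Id.
apply: hdeg_eq (hdeg_Comp (hdeg_Dot i) IH) _; lia.
Qed.

Lemma hdeg_delta i n : hdeg (delta i n) (2 * triangle n)%R.
Proof.
elim: n => [|n IH]; first exact: hdeg_Id.
apply: hdeg_eq (hdeg_Tens (hdeg_dots i n) IH) _; rewrite triangleS; lia.
Qed.

Lemma hdeg_uncross i j n : hdeg (uncross i j n) (- (n%:Z * pairing j i))%R.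
Proof.
elim: n => [|n IH]; first by rewrite mul0r; apply: hdeg_Id.
apply: hdeg_eq (hdeg_Comp (hdeg_Tens (hdeg_Cross j i) (hdeg_Id _)) (hdeg_Tens (hdeg_Id
  _) IH)) _.
by rewrite -addn1 PoszD; ring.
Qed.

Lemma hdeg_longest i n : hdeg (longest i n) (- (2 * triangle n))%R.
Proof.
elim: n => [|n IH]; first exact: hdeg_Id.
have := hdeg_uncross i i n; rewrite -last_to_first_uncross /pairing eqxx => h.
apply: hdeg_eq (hdeg_Comp (hdeg_Tens (hdeg_Id _) IH) h) _; rewrite triangleS; lia.
Qed.

Lemma hdeg_idem i n : hdeg (thick_idem i n) 0%R.
Proof. by apply: hdeg_eq (hdeg_Comp (hdeg_delta i n) (hdeg_longest i n)) _;
  rewrite addrN. Qed.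

Lemma hdeg_cross1 i j n : hdeg (cross1 i j n) (- (n%:Z * pairing i j))%R.
Proof.
elim: n => [|n IH]; first by rewrite mul0r; apply: hdeg_Id.
apply: hdeg_eq (hdeg_Comp (hdeg_Tens (hdeg_Id _) IH) (hdeg_Tens (hdeg_Cross i j)
  (hdeg_Id _))) _.
by rewrite -addn1 PoszD; ring.
Qed.

Lemma hdeg_chi1 i j n : hdeg (chi i j 1 n) (- (n%:Z * pairing i j))%R.
Proof.
apply: hdeg_eq (hdeg_Comp (hdeg_Tens (hdeg_cross1 i j n) (hdeg_Id _))
  (hdeg_Tens (hdeg_Id _) (hdeg_Id _))) _.
by rewrite !addr0.
Qed.

Definition serre_word p b q : word := (nseq p One ++ nseq b Two) ++ nseq q One.

Definition serre_e_diag p b q := Tens (Tens (thick_idem One p) (thick_idem Two b))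
  (thick_idem One q).

Definition serre_d_bottom p b q : diag :=
  Comp (Tens (Tens (thick_idem One p)
           (Comp (chi One Two 1 b) (Tens (thick_idem One 1) (thick_idem Two b))))
         (thick_idem One q))
   (Tens (Tens (Comp (Tens (delta One p) (delta One 1)) (longest One (p + 1)))
           (thick_idem Two b))
      (thick_idem One q)).

(** The merger is represented by an idempotent; with the identities beside it, the top layer of the
    differential is therefore the idempotent of the target. *)
Definition serre_d_diag p b q : diag := Comp (serre_e_diag p b q.+1) (serre_d_bottom p
  b q).

(** [longest] and [delta] on the right represent the splitter into thicknesses 1 and q, and the
    merger on the left is part of the outer idempotent. The idempotents at both ends make this a
    morphism of the Karoubi envelope. *)
Definition serre_h_diag0 p b q m : diag :=
  Comp (serre_e_diag p.+1 b q)
  (Comp (Tens (Id (nseq p One)) (Tens (uncross One Two b) (Id (nseq q One))))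
  (Comp (Tens (Id (nseq p One ++ nseq b Two)) (Tens (dots One m) (delta One q)))
  (Comp (Tens (Id (nseq p One ++ nseq b Two)) (longest One q.+1))
    (serre_e_diag p b q.+1)))).

Definition serre_h_diag p b q m := if odd p then Opp (serre_h_diag0 p b q m) else
  serre_h_diag0 p b q m.

Lemma typed_serre_e_diag p b q : typed (serre_word p b q) (serre_word p b q)
  (serre_e_diag p b q).
Proof. by do !apply: typed_Tens; apply: typed_idem. Qed.

Lemma nseq_S1 p (c : colour) : nseq (p + 1) c = nseq p c ++ [:: c].
Proof. by rewrite nseqD. Qed.

Lemma serre_wordS p b q : serre_word p.+1 b q = nseq p One ++ One :: nseq b Two ++
  nseq q One.
Proof. by rewrite /serre_word -addn1 nseq_S1 -!catA. Qed.

Lemma typed_serre_d_diag_bottom p b q : typed (serre_word p.+1 b q) (serre_word p b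
  q.+1) (serre_d_bottom p b q).
Proof.
apply: (@typed_Comp _ ((nseq p One ++ (nseq 1 One ++ nseq b Two)) ++ nseq q One)).
  have -> : serre_word p b q.+1 = (nseq p One ++ (nseq b Two ++ [:: One])) ++ nseq q
    One.
    by rewrite /serre_word -!catA.
  apply: typed_Tens; last exact: typed_idem.
  apply: typed_Tens; first exact: typed_idem.
  apply: typed_Comp (typed_chi1 _ _ _) _.
  exact: (@typed_Tens [:: One] [:: One] _ _ _ _ (typed_idem One 1) (typed_idem _ _)).
rewrite (_ : serre_word p.+1 b q = (nseq (p + 1) One ++ nseq b Two) ++ nseq q One);
  last first.
  by rewrite addn1.
rewrite (catA (nseq p One)) -nseqD.
apply: typed_Tens; last exact: typed_idem.
apply: typed_Tens; last exact: typed_idem.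
apply: typed_Comp (typed_longest _ _).
by rewrite nseqD; apply: typed_Tens; apply: typed_delta.
Qed.

Lemma typed_serre_d_diag p b q : typed (serre_word p.+1 b q) (serre_word p b q.+1)
  (serre_d_diag p b q).
Proof. exact: typed_Comp (typed_serre_e_diag p b q.+1) (typed_serre_d_diag_bottom p b
  q). Qed.

Lemma typed_serre_h_diag0 p b q m : typed (serre_word p b q.+1) (serre_word p.+1 b q)
  (serre_h_diag0 p b q m).
Proof.
have e : serre_word p b q.+1 = nseq p One ++ ((nseq b Two ++ [:: One]) ++ nseq q One).
  by rewrite /serre_word -!catA.
apply: typed_Comp (typed_serre_e_diag _ _ _) _.
apply: (@typed_Comp _ (serre_word p b q.+1)).
  rewrite serre_wordS e; apply: typed_Tens (typed_Id _) _.
  exact: typed_Tens (typed_uncross _ _ _) (typed_Id _).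
apply: (@typed_Comp _ (serre_word p b q.+1)).
  apply: typed_Tens (typed_Id _) _.
  exact: (@typed_Tens [:: One] [:: One] _ _ _ _ (typed_dots _ _) (typed_delta _ _)).
apply: typed_Comp (typed_serre_e_diag _ _ _).
exact: typed_Tens (typed_Id _) (typed_longest _ _).
Qed.

Lemma typed_serre_h_diag p b q m : typed (serre_word p b q.+1) (serre_word p.+1 b q)
  (serre_h_diag p b q m).
Proof.
by rewrite /serre_h_diag; case: odd; first apply: typed_Opp; apply: typed_serre_h_diag0.
Qed.

Lemma hdeg_serre_e_diag p b q : hdeg (serre_e_diag p b q) 0%R.
Proof.
exact: hdeg_eq (hdeg_Tens (hdeg_Tens (hdeg_idem _ _) (hdeg_idem _ _)) (hdeg_idem _ _))
  _.
Qed.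

Lemma hdeg_serre_d_diag p b q : hdeg (serre_d_diag p b q) (b%:Z - 2 * p%:Z)%R.
Proof.
apply: hdeg_eq (hdeg_Comp (hdeg_serre_e_diag _ _ _)
  (hdeg_Comp (hdeg_Tens (hdeg_Tens (hdeg_idem _ _)
     (hdeg_Comp (hdeg_chi1 _ _ _) (hdeg_Tens (hdeg_idem _ _) (hdeg_idem _ _))))
     (hdeg_idem _ _))
   (hdeg_Tens (hdeg_Tens
     (hdeg_Comp (hdeg_Tens (hdeg_delta _ _) (hdeg_delta _ _)) (hdeg_longest _ _))
     (hdeg_idem _ _)) (hdeg_idem _ _)))) _.
rewrite addn1 !triangleS (_ : triangle 0 = 0%R) // /pairing /=; lia.
Qed.

Lemma hdeg_serre_h_diag0 p b q m : hdeg (serre_h_diag0 p b q m) (b%:Z + 2 * m%:Z - 2 *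
  q%:Z)%R.
Proof.
apply: hdeg_eq (hdeg_Comp (hdeg_serre_e_diag _ _ _)
  (hdeg_Comp (hdeg_Tens (hdeg_Id _) (hdeg_Tens (hdeg_uncross _ _ _) (hdeg_Id _)))
  (hdeg_Comp (hdeg_Tens (hdeg_Id _) (hdeg_Tens (hdeg_dots _ _) (hdeg_delta _ _)))
  (hdeg_Comp (hdeg_Tens (hdeg_Id _) (hdeg_longest _ _)) (hdeg_serre_e_diag _ _ _))))) _.
rewrite !triangleS /pairing /=; lia.
Qed.

Lemma hdeg_serre_h_diag p b q m : hdeg (serre_h_diag p b q m) (b%:Z + 2 * m%:Z - 2 *
  q%:Z)%R.
Proof.
by rewrite /serre_h_diag; case: odd; first apply: hdeg_Opp; apply: hdeg_serre_h_diag0.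
Qed.

(** * Thick diagrams evaluated as operators *)

Section OpSerre.
Variable V : klrModule.
Local Notation E := (@thick_op V).
Local Notation R := (@sweepR V).
Local Notation K := (@sweepL V).
Local Notation D := (@longest_op V).
Local Notation dl := (@delta_op V).
Local Notation sh := (@shape V One Two).
Local Notation dots_op := (@dots_op V).
Local Notation signed := (@signed V).
Implicit Types (z : V).

Definition serre_e p b q z : V := E 0 p (E p b (E (p + b) q z)).

Lemma diag_op_comp g f k z : diag_op V (Comp g f) k z = diag_op V g k (diag_op V f k z).
Proof. by []. Qed.

Lemma diag_op_opp f k z : diag_op V (Opp f) k z = (- diag_op V f k z)%R.
Proof. by []. Qed.

Lemma diag_op_tens A B f g k z : typed A B f ->
  diag_op V (Tens f g) k z = diag_op V f k (diag_op V g (k + size A) z).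
Proof. by case/typedP => _ <- _. Qed.

Lemma diag_op_serre_e_diag p b q z : diag_op V (serre_e_diag p b q) 0 z = serre_e p b
  q z.
Proof.
rewrite /serre_e_diag (diag_op_tens _ _ _ (typed_Tens (typed_idem One p) (typed_idem
  Two b))).
rewrite (diag_op_tens _ _ _ (typed_idem One p)) !diag_op_thick_idem.
by rewrite size_cat !size_nseq !add0n.
Qed.

Lemma serre_eK p b q z : sh p b q z ->
  [/\ E 0 p (serre_e p b q z) = serre_e p b q z,
    E p b (serre_e p b q z) = serre_e p b q z &
      E (p + b) q (serre_e p b q z) = serre_e p b q z].
Proof.
move=> sz; have sr : sh p b q (E (p + b) q z) by apply: (shape_loc_r (loc_thick V (p +
  b) q)).
have sm : sh p b q (E p b (E (p + b) q z)) by apply: (shape_loc_m (loc_thick V p b)).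
rewrite /serre_e; split.
- exact: idemK (shape_l sm).
- rewrite (loc_comm _ (loc_thick V p b) (loc_thick V 0 p)); last by lia.
  by rewrite (idemK (shape_m sr)).
rewrite (loc_comm _ (loc_thick V (p + b) q) (loc_thick V 0 p)); last by lia.
rewrite (loc_comm _ (loc_thick V (p + b) q) (loc_thick V p b)); last by lia.
by rewrite (idemK (shape_r sz)).
Qed.

Lemma shape_serre_e p b q z : sh p b q z -> sh p b q (serre_e p b q z).
Proof.
move=> sz; apply: (shape_loc (loc_thick V 0 p)) => //.
by apply: (shape_loc_m (loc_thick V p b)) => //;
  apply: (shape_loc_r (loc_thick V (p + b) q)).
Qed.

Lemma serre_e_idem p b q z : sh p b q z -> serre_e p b q (serre_e p b q z) = serre_e p
  b q z.
Proof. by move=> /serre_eK[e1 e2 e3]; rewrite {1}/serre_e e3 e2 e1. Qed.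

(** The right idempotent slides up to the longest element of the merger, which absorbs it. *)
Lemma absorb_idem_r p b q z : sh p.+1 b q z ->
  D (p + b) q.+1 (R p b (D 0 p.+1 (E p.+1 b (E (p.+1 + b) q z)))) =
  D (p + b) q.+1 (R p b (D 0 p.+1 (E p.+1 b z))).
Proof.
move=> sz; rewrite -(loc_comm _ (loc_thick V (p.+1 + b) q) (loc_thick V p.+1 b));
  last by lia.
rewrite -(loc_comm _ (loc_thick V (p.+1 + b) q) (loc_longest V 0 p.+1)); last by lia.
rewrite -(loc_comm _ (loc_thick V (p.+1 + b) q) (loc_sweepR V p b)); last by lia.
set u := R p b _; have su : sh p b q.+1 u.
  apply: shape_sweepR; apply: (shape_loc (loc_longest V 0 p.+1)) => //.
  exact: (shape_loc_m (loc_thick V p.+1 b)).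
exact: longest_idem_r (shape_r su).
Qed.

Lemma serre_d_serre_e p b q z : sh p.+1 b q z -> serre_d p b q (serre_e p.+1 b q z) =
  serre_d p b q z.
Proof.
move=> sz; rewrite /serre_d; congr (dl 0 p (dl (p + b) q.+1 _)).
have [_ -> _] := serre_eK sz; rewrite /serre_e.
have sm : sh p.+1 b q (E p.+1 b (E (p.+1 + b) q z)).
  apply: (shape_loc_m (loc_thick V p.+1 b)) => //.
  exact: (shape_loc_r (loc_thick V (p.+1 + b) q)).
by rewrite (delta_idem (shape_l sm)) absorb_idem_r.
Qed.

Lemma serre_e_serre_d p b q z : sh p.+1 b q z -> serre_e p b q.+1 (serre_d p b q z) =
  serre_d p b q z.
Proof.
move=> sz; rewrite /serre_e /serre_d; set y := E p.+1 b z.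
have sy : sh p.+1 b q y by apply: (shape_loc_m (loc_thick V p.+1 b)).
have sD : sh p.+1 b q (D 0 p.+1 y) by apply: (shape_loc (loc_longest V 0 p.+1)).
have -> : E (p + b) q.+1 (dl 0 p (dl (p + b) q.+1 (D (p + b) q.+1 (R p b (D 0 p.+1
  y))))) =
  dl 0 p (dl (p + b) q.+1 (D (p + b) q.+1 (R p b (D 0 p.+1 y)))).
  rewrite (loc_comm _ (loc_thick V (p + b) q.+1) (loc_delta V true 0 p)); last by lia.
  by rewrite [X in dl 0 p X](idemK (shape_r (shape_sweepR sD))).
have -> : E p b (dl 0 p (dl (p + b) q.+1 (D (p + b) q.+1 (R p b (D 0 p.+1 y))))) =
  dl 0 p (dl (p + b) q.+1 (D (p + b) q.+1 (R p b (D 0 p.+1 y)))).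
  rewrite (loc_comm _ (loc_thick V p b) (loc_delta V true 0 p)); last by lia.
  rewrite (loc_comm _ (loc_thick V p b) (loc_delta V true (p + b) q.+1)); last by lia.
  rewrite (loc_comm _ (loc_thick V p b) (loc_longest V (p + b) q.+1)); last by lia.
  rewrite (idem_sweepR (c := One) (d := Two)) //; last 2 first.
  - by apply: (shape_l sD); lia.
  - exact: shape_m sD.
  rewrite (loc_comm _ (loc_thick V p.+1 b) (loc_longest V 0 p.+1)); last by lia.
  by rewrite /y (idemK (shape_m sz)).
rewrite /thick_op /=; congr (dl 0 p _).
have cE (f : V -> V) (b' : bool) l h w : local_op b' l h f -> p <= l ->
    D 0 p (dl 0 p (f w)) = f (D 0 p (dl 0 p w)).
  move=> Hf hl; rewrite (loc_comm _ (loc_delta V true 0 p) Hf); last by lia.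
  by rewrite (loc_comm _ (loc_longest V 0 p) Hf) //; lia.
rewrite (cE _ _ _ _ _ (loc_delta V true (p + b) q.+1)) ?leq_addr //.
rewrite (cE _ _ _ _ _ (loc_longest V (p + b) q.+1)) ?leq_addr //.
rewrite (cE _ _ _ _ _ (loc_sweepR V p b)) //.
by rewrite (longest_delta_longest_l (shape_l sy)).
Qed.

(** Every layer of the composite carries idempotents. Those of colour 1 disappear into the longest
    elements of the splitter and the merger, and those of colour 2 slide together into a single
    one. *)
Lemma diag_op_serre_d_diag p b q z : sh p.+1 b q z -> diag_op V (serre_d_diag p b q) 0
  z = serre_d p b q z.
Proof.
move=> sz; rewrite /serre_d_diag diag_op_comp diag_op_serre_e_diag /serre_d_bottom
  diag_op_comp.
have st : forall (n : nat) (c : colour), size (nseq n c) = n by move=> *;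
  rewrite size_nseq.
have t1 : typed (nseq p.+1 One) (nseq p One ++ [:: One])
    (Comp (Tens (delta One p) (delta One 1)) (longest One (p + 1))).
  rewrite -addn1; apply: typed_Comp (typed_longest _ _).
  by rewrite nseqD; apply: typed_Tens; apply: typed_delta.
rewrite (diag_op_tens _ _ _ (typed_Tens t1 (typed_idem Two b))).
rewrite (diag_op_tens _ _ _ t1) diag_op_comp (diag_op_tens _ _ _ (typed_delta One p)).
rewrite !diag_op_delta diag_op_longest !diag_op_thick_idem size_cat !st !add0n addn1.
have t2 : typed (One :: nseq b Two) (nseq b Two ++ [:: One])
   (Comp (chi One Two 1 b) (Tens (thick_idem One 1) (thick_idem Two b))).
  apply: typed_Comp (typed_chi1 _ _ _) _.
  exact: (@typed_Tens [:: One] [:: One] _ _ _ _ (typed_idem One 1) (typed_idem _ _)).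
rewrite (diag_op_tens _ _ _ (typed_Tens (typed_idem One p) t2)).
rewrite (diag_op_tens _ _ _ (typed_idem One p)) diag_op_comp (diag_op_tens _ _ _
  (typed_idem One 1)).
rewrite diag_op_chi1 !diag_op_thick_idem size_cat /= !st !add0n addn1 addnS -addSn.
set y := E p.+1 b (E (p.+1 + b) q z).
change (serre_e p b q.+1 (E 0 p (R p b (E p.+1 b (E (p.+1 + b) q (dl 0 p (D 0 p.+1
  y))))))
  = serre_d p b q z).
have sr : sh p.+1 b q (E (p.+1 + b) q z).
  by apply: (shape_loc_r (loc_thick V (p.+1 + b) q)).
have ey : E p.+1 b (E (p.+1 + b) q y) = y.
  rewrite /y (loc_comm _ (loc_thick V (p.+1 + b) q) (loc_thick V p.+1 b)); last by lia.
  by rewrite (idemK (shape_r sz)) (idemK (shape_m sr)).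
rewrite (loc_comm _ (loc_thick V (p.+1 + b) q) (loc_delta V true 0 p)); last by lia.
rewrite (loc_comm _ (loc_thick V (p.+1 + b) q) (loc_longest V 0 p.+1)); last by lia.
rewrite (loc_comm _ (loc_thick V p.+1 b) (loc_delta V true 0 p)); last by lia.
rewrite (loc_comm _ (loc_thick V p.+1 b) (loc_longest V 0 p.+1)); last by lia.
rewrite ey (loc_comm _ (loc_sweepR V p b) (loc_delta V true 0 p)); last by lia.
have e0 u : sh p b q.+1 u -> serre_e p b q.+1 (E 0 p u) = E 0 p (E p b (E (p + b) q.+1
  u)).
  move=> su; rewrite /serre_e (loc_comm _ (loc_thick V (p + b) q.+1) (loc_thick V 0
    p)); last by lia.
  rewrite (loc_comm _ (loc_thick V p b) (loc_thick V 0 p)); last by lia.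
  rewrite (@idemK V 0 p One) //.
  apply: (@shape_l V One Two p b q.+1); apply: (shape_loc_m (loc_thick V p b)) => //.
  exact: (shape_loc_r (loc_thick V (p + b) q.+1)).
have sy : sh p.+1 b q (D 0 p.+1 y).
  by apply: (shape_loc (loc_longest V 0 p.+1)) => //;
    apply: (shape_loc_m (loc_thick V p.+1 b)).
rewrite e0; last by apply: (shape_loc (loc_delta V true 0 p)) => //;
  apply: shape_sweepR.
rewrite (loc_comm _ (loc_thick V (p + b) q.+1) (loc_delta V true 0 p)); last by lia.
have -> : dl 0 p (E (p + b) q.+1 (R p b (D 0 p.+1 y))) = serre_d p b q z.
  by rewrite /serre_d -(absorb_idem_r sz).
have sd : sh p b q.+1 (serre_d p b q z) by apply: shape_serre_d.
have [_ _] := serre_eK sd; rewrite (serre_e_serre_d sz) => e3.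
by rewrite -{1}e3; exact: serre_e_serre_d sz.
Qed.

Definition serre_h_core p b q m z : V :=
  K p b (dots_op (p + b) m (dl (p.+1 + b) q (D (p + b) q.+1 z))).

Lemma shape_hcore p b q m z : sh p b q.+1 z -> sh p.+1 b q (serre_h_core p b q m z).
Proof.
move=> sz; apply: shape_sweepL; apply: (shape_loc_r (loc_dots V true (p + b) m)) =>
  //; first lia.
apply: (shape_loc_r (loc_delta V true (p.+1 + b) q)) => //; try lia.
exact: (shape_loc_r (loc_longest V (p + b) q.+1)).
Qed.

Lemma diag_op_serre_h_diag0 p b q m z : diag_op V (serre_h_diag0 p b q m) 0 z =
  serre_e p.+1 b q (serre_h_core p b q m (serre_e p b q.+1 z)).
Proof.
have st : forall (n : nat) (c : colour), size (nseq n c) = n by move=> *;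
  rewrite size_nseq.
rewrite /serre_h_diag0 diag_op_comp diag_op_serre_e_diag 3!diag_op_comp
  diag_op_serre_e_diag.
rewrite !(diag_op_tens _ _ _ (typed_Id _)) (diag_op_tens _ _ _ (typed_uncross One Two
  b)).
rewrite (diag_op_tens _ _ _ (typed_dots One m)) diag_op_uncross diag_op_dots
  diag_op_delta diag_op_longest.
by rewrite !size_cat !st !add0n (addn1 (p + b)).
Qed.

(** The outer sign cancels the one inside [serre_h], as this diagram is the unsigned one. *)
Lemma diag_op_serre_h_diag0_serre_h p b q m z : sh p b q.+1 z ->
  diag_op V (serre_h_diag0 p b q m) 0 z = signed p (serre_h p b q m (serre_e p b q.+1
    z)).
Proof.
move=> sz; rewrite diag_op_serre_h_diag0 /serre_h signedK; have [_ e1 _]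
  := serre_eK sz; rewrite e1.
set z' := serre_e p b q.+1 z; have sz' : sh p b q.+1 z' by apply: shape_serre_e.
rewrite /serre_e /serre_h_core.
set y := D (p + b) q.+1 z'.
have sy : sh p b q.+1 y by apply: (shape_loc_r (loc_longest V (p + b) q.+1)).
have -> : E (p.+1 + b) q (K p b (dots_op (p + b) m (dl (p.+1 + b) q y))) =
  dl (p.+1 + b) q (K p b (dots_op (p + b) m y)).
  rewrite /thick_op /=; congr (dl _ _ _).
  rewrite (loc_comm _ (loc_longest V (p.+1 + b) q) (loc_sweepL V p b)); last by lia.
  rewrite (loc_comm _ (loc_longest V (p.+1 + b) q) (loc_dots V true (p + b) m));
    last by lia.
  by rewrite (longest_delta_longest_r (shape_r sz')).
have sx : sh p b q.+1 (dots_op (p + b) m y).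
  by apply: (shape_loc_r (loc_dots V true (p + b) m)) => //; lia.
rewrite (loc_comm _ (loc_thick V p.+1 b) (loc_delta V true (p.+1 + b) q)); last by lia.
rewrite (idem_sweepL (c := One) _ (shape_m sx)) //; last by apply: (shape_r sx); lia.
rewrite (loc_comm _ (loc_thick V p b) (loc_dots V true (p + b) m)); last by lia.
by rewrite /y (loc_comm _ (loc_thick V p b) (loc_longest V (p + b) q.+1)) ?e1 //; lia.
Qed.

Lemma diag_op_serre_h_diag p b q m z : sh p b q.+1 z ->
  diag_op V (serre_h_diag p b q m) 0 z = serre_h p b q m (serre_e p b q.+1 z).
Proof.
move=> sz; rewrite /serre_h_diag; case: ifP => e;
  rewrite ?diag_op_opp diag_op_serre_h_diag0_serre_h // /signed e //.
exact: opprK.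
Qed.

Lemma serre_e_serre_h p b q m z : sh p b q.+1 z ->
  serre_e p.+1 b q (serre_h p b q m (serre_e p b q.+1 z)) = serre_h p b q m (serre_e p
    b q.+1 z).
Proof.
move=> sz; have := diag_op_serre_h_diag0_serre_h m sz;
  rewrite diag_op_serre_h_diag0 => /(congr1 (signed p)); rewrite signedK => <-.
have Esg n u : serre_e p.+1 b q (signed n u) = signed n (serre_e p.+1 b q u).
  by rewrite /serre_e !(loc_signed _ _ (loc_thick V _ _)).
by rewrite Esg serre_e_idem //; apply: shape_hcore; apply: shape_serre_e.
Qed.

End OpSerre.

(** * Identities between diagrams in H *)

Section DiagFacts.
Implicit Types p b q m : nat.

Definition unit_vec p b q : klr_homs (serre_word p b q) := pure (serre_word p b q) (Id
  (serre_word p b q)).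

(** The identity is a family supported at one word, so the colour hypotheses of the operator
    identities hold for it; they are evaluated at this vector. *)
Lemma shape_unit p b q : shape One Two p b q (unit_vec p b q).
Proof.
have sz : size (serre_word p b q) = p + b + q by rewrite !size_cat !size_nseq.
split=> j hj; apply: hcol_id; rewrite ?sz; try lia;
  rewrite !nth_cat !size_cat !size_nseq.
- have -> : j < p + b by lia.
  have -> : j < p by lia.
  by rewrite nth_nseq; case: ifP.
- have -> : j < p + b by lia.
  have -> : (j < p) = false by lia.
  by rewrite nth_nseq (_ : j - p < b) //; lia.
have -> : (j < p + b) = false by lia.
by rewrite nth_nseq; case: ifP.
Qed.

Lemma deq_serre_e_diag p b q : deq (Comp (serre_e_diag p b q) (serre_e_diag p b q))
  (serre_e_diag p b q).
Proof.
have t := typed_serre_e_diag p b q; have s := shape_unit p b q.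
apply: (deq_diag_op (typed_Comp t t) t erefl);
  rewrite diag_op_comp !diag_op_serre_e_diag.
exact: serre_e_idem s.
Qed.

Lemma deq_serre_d_diag p b q :
  deq (Comp (serre_e_diag p b q.+1) (Comp (serre_d_diag p b q) (serre_e_diag p.+1 b
    q))) (serre_d_diag p b q).
Proof.
have t := typed_serre_d_diag p b q; have s := shape_unit p.+1 b q.
apply: (deq_diag_op _ t erefl).
  exact: typed_Comp (typed_serre_e_diag _ _ _) (typed_Comp t (typed_serre_e_diag _ _
    _)).
rewrite 2!diag_op_comp !diag_op_serre_e_diag (diag_op_serre_d_diag (shape_serre_e s))
  (diag_op_serre_d_diag s).
by rewrite serre_d_serre_e // serre_e_serre_d.
Qed.

Lemma deq_serre_d_diag_serre_d_diag p b q :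
  deq (Comp (serre_d_diag p b q.+1) (serre_d_diag p.+1 b q)) (Zero (serre_word p.+2 b
    q) (serre_word p b q.+2)).
Proof.
have t1 := typed_serre_d_diag p b q.+1; have t2 := typed_serre_d_diag p.+1 b q.
have s := shape_unit p.+2 b q.
apply: (deq_diag_op (typed_Comp t1 t2) (typed_Zero _ _) erefl).
rewrite diag_op_comp (diag_op_serre_d_diag s) (diag_op_serre_d_diag (shape_serre_d s)).
exact: (serre_d_serre_d (isT : One != Two) s).
Qed.

Lemma deq_serre_h_diag0 p b q m :
  deq (Comp (serre_e_diag p.+1 b q) (Comp (serre_h_diag p b q m) (serre_e_diag p b
    q.+1))) (serre_h_diag p b q m).
Proof.
have t := typed_serre_h_diag p b q m; have s := shape_unit p b q.+1.
apply: (deq_diag_op _ t erefl).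
  exact: typed_Comp (typed_serre_e_diag _ _ _) (typed_Comp t (typed_serre_e_diag _ _
    _)).
rewrite 2!diag_op_comp !diag_op_serre_e_diag (diag_op_serre_h_diag m (shape_serre_e
  s)) (diag_op_serre_h_diag m s).
by rewrite serre_e_idem // serre_e_serre_h.
Qed.

Lemma deq_first p b m : m + b = p ->
  deq (serre_e_diag p.+1 b 0) (Comp (serre_h_diag p b 0 m) (serre_d_diag p b 0)).
Proof.
move=> e; have s := shape_unit p.+1 b 0.
apply: (deq_diag_op (typed_serre_e_diag _ _ _) (typed_Comp (typed_serre_h_diag _ _ _
  _) (typed_serre_d_diag _ _ _)) erefl).
rewrite diag_op_comp diag_op_serre_e_diag (diag_op_serre_d_diag s)
  (diag_op_serre_h_diag m (shape_serre_d s)).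
have [e0 e1 _] := serre_eK s.
(* The homotopy lemmas ask for a vector fixed by the idempotents, so the unit vector is replaced by
   its image under [serre_e], which has the same differential. *)
by rewrite serre_e_serre_d // -(serre_d_serre_e s) (homotopy_first (isT : One != Two)
  (shape_serre_e s)).
Qed.

Lemma deq_last b q m : m + b = q ->
  deq (serre_e_diag 0 b q.+1) (Comp (serre_d_diag 0 b q) (serre_h_diag 0 b q m)).
Proof.
move=> e; have s := shape_unit 0 b q.+1.
apply: (deq_diag_op (typed_serre_e_diag _ _ _) (typed_Comp (typed_serre_d_diag _ _ _)
  (typed_serre_h_diag _ _ _ _)) erefl).
rewrite diag_op_comp diag_op_serre_e_diag (diag_op_serre_h_diag m s)
  (diag_op_serre_d_diag (shape_serre_h m (shape_serre_e s))).
have [e0 e1 e2] := serre_eK s.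
by rewrite (homotopy_last (isT : One != Two) (shape_serre_e s)).
Qed.

Lemma deq_mid p b q m : m + b = (p + q).+1 ->
  deq (serre_e_diag p.+1 b q.+1)
    (Add (Comp (serre_d_diag p.+1 b q) (serre_h_diag p.+1 b q m)) (Comp (serre_h_diag
      p b q.+1 m) (serre_d_diag p b q.+1))).
Proof.
move=> e; have s := shape_unit p.+1 b q.+1.
apply: (deq_diag_op (typed_serre_e_diag _ _ _) _ erefl).
  apply: typed_Add.
    exact: typed_Comp (typed_serre_d_diag _ _ _) (typed_serre_h_diag _ _ _ _).
  exact: typed_Comp (typed_serre_h_diag _ _ _ _) (typed_serre_d_diag _ _ _).
have [e0 e1 e2] := serre_eK s; have s' := shape_serre_e s.
have -> : diag_op (klr_homs (serre_word p.+1 b q.+1)) (Add (Comp (serre_d_diag p.+1 b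
  q) (serre_h_diag p.+1 b q m))
    (Comp (serre_h_diag p b q.+1 m) (serre_d_diag p b q.+1))) 0 (unit_vec p.+1 b q.+1) =
  (diag_op _ (serre_d_diag p.+1 b q) 0 (diag_op _ (serre_h_diag p.+1 b q m) 0
    (unit_vec p.+1 b q.+1)) +
   diag_op _ (serre_h_diag p b q.+1 m) 0 (diag_op _ (serre_d_diag p b q.+1) 0
     (unit_vec p.+1 b q.+1)))%R by [].
rewrite diag_op_serre_e_diag (diag_op_serre_h_diag m s) (diag_op_serre_d_diag
  (shape_serre_h m s')) (diag_op_serre_d_diag s) (diag_op_serre_h_diag m
    (shape_serre_d s)).
by rewrite serre_e_serre_d // -(serre_d_serre_e s) addrC (homotopy_mid (isT : One !=
  Two) s').
Qed.

End DiagFacts.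

(** * The complex in the Karoubi envelope *)

Section SingleSummand.

(** All nonzero objects of the complex have one summand, so a matrix amounts to its entry at (0, 0),
    recorded up to [deq]. *)
Definition single A (s : int) B (t : int) (m : diag) (f : uarr) :=
  [/\ udom f = [:: (A, s)], ucod f = [:: (B, t)] & deq (umx f 0 0) m].

Lemma single_comp A s B t B' t' C u m m' g f :
  single A s B t m f -> single B' t' C u m' g -> typed A C (Comp m' m) ->
  single A s C u (Comp m' m) (ucomp g f).
Proof.
move=> [df cf ef] [dg cg eg] ty; split=> //=.
rewrite cf /= big_ord_recl big_ord0 df cg /= ef eg.
exact: (@deq_addr0 A C).
Qed.

Lemma single_ten A s B t m f A' s' B' t' m' g :
  single A s B t m f -> single A' s' B' t' m' g ->
  single (A ++ A') (s + s')%R (B ++ B') (t + t')%R (Tens m m') (uten f g).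
Proof.
move=> [df cf ef] [dg cg eg]; split=> /=; rewrite ?df ?cf ?dg ?cg //.
by rewrite ef eg.
Qed.

Lemma single_reshift A s B t m f x y : single A s B t m f ->
  single A (s + x)%R B (t + y)%R m (ureshift x y f).
Proof. by move=> [df cf ef]; split=> /=; rewrite ?df ?cf. Qed.

Lemma single_add A s B t m m' f g : single A s B t m f -> single A s B t m' g ->
  single A s B t (Add m m') (uadd f g).
Proof. by move=> [df cf ef] [dg cg eg]; split=> //=; rewrite ef eg. Qed.

Lemma single_ueq A s B t m m' f g : single A s B t m f -> single A s B t m' g ->
  deq m m' -> ueq f g.
Proof.
move=> [df cf ef] [dg cg eg] e; split; rewrite ?df ?cf //.
by case=> [|?] [|?] //= _ _; rewrite ef eg.
Qed.

Lemma single_umor A s B t m f : single A s B t m f -> typed A B m ->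
  hdeg m (s - t)%R -> umor [:: (A, s)] [:: (B, t)] f.
Proof.
move=> [df cf ef] ty h; split=> //; case=> [|?] [|?] //= _ _.
have /typedP[wf df' cf'] := typed_deq (deq_sym ef) ty.
by split=> //; exists m => //; rewrite /udeg /= add0r.
Qed.

Definition serre_degree a b p i : int :=
  ((0 - triangle p + (0 - triangle b)) + (0 - triangle i) + serre_shift a b i)%R.

Lemma single_kid i n : single (nseq n i) (0 - triangle n)%R (nseq n i) (0 - triangle
  n)%R
  (thick_idem i n) (kid (thick i n)).
Proof. by []. Qed.

Lemma kcar_serre a b i :
  kcar (serre_obj a b i) = [:: (serre_word (a - i) b i, serre_degree a b (a - i) i)].
Proof. by []. Qed.

Lemma single_serre_id a b i :
  single (serre_word (a - i) b i) (serre_degree a b (a - i) i) (serre_word (a - i) b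
    i) (serre_degree a b (a - i) i)
    (serre_e_diag (a - i) b i) (kid (serre_obj a b i)).
Proof.
exact: single_reshift (single_ten (single_ten (single_kid _ _) (single_kid _ _))
  (single_kid _ _)).
Qed.

(** Consecutive layers of the differential match only up to associativity of concatenation and p + 1
    = p.+1; this aligns their words and shifts. *)
Lemma single_cast A s B t m f A' s' B' t' : single A s B t m f ->
  A = A' -> s = s' -> B = B' -> t = t' -> single A' s' B' t' m f.
Proof. by move=> h <- <- <- <-. Qed.

Lemma single_splitter i k l :
  single (nseq (k + l) i) (0 - triangle (k + l))%R
    (nseq k i ++ nseq l i) ((0 - triangle k) + (0 - triangle l))%R
    (Comp (Tens (delta i k) (delta i l)) (longest i (k + l))) (splitter i k l).
Proof. by []. Qed.

Lemma single_merger i k l :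
  single (nseq k i ++ nseq l i) ((0 - triangle k) + (0 - triangle l))%R
    (nseq (k + l) i) (0 - triangle (k + l))%R (thick_idem i (k + l)) (merger i k l).
Proof. by []. Qed.

Lemma single_crossing i j k l :
  single (nseq k i ++ nseq l j) ((0 - triangle k) + (0 - triangle l))%R
    (nseq l j ++ nseq k i) ((0 - triangle l) + (0 - triangle k))%R
    (Comp (chi i j k l) (Tens (thick_idem i k) (thick_idem j l))) (crossing i j k l).
Proof. by []. Qed.

Lemma single_serre_diff a b i p : a - i = p.+1 ->
  single (serre_word p.+1 b i) (serre_degree a b p.+1 i) (serre_word p b i.+1)
    (serre_degree a b p i.+1)
    (serre_d_diag p b i) (serre_diff a b i).
Proof.
move=> e; have e1 : a - i - 1 = p by lia.
rewrite /serre_diff e1; apply: single_reshift.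
have s3 := single_ten (single_ten (single_splitter One p 1) (single_kid Two b))
  (single_kid One i).
have s2 := single_ten (single_ten (single_kid One p) (single_crossing One Two 1 b))
  (single_kid One i).
have s1 := single_ten (single_ten (single_kid One p) (single_kid Two b))
  (single_merger One 1 i).
have e2 : (nseq p One ++ (nseq b Two ++ nseq 1 One)) ++ nseq i One = serre_word p b
  i.+1.
  by rewrite /serre_word -!catA.
have e3 : (nseq (p + 1) One ++ nseq b Two) ++ nseq i One = serre_word p.+1 b i by
  rewrite addn1.
have e3' : ((0 - triangle (p + 1)) + (0 - triangle b) + (0 - triangle i) =
            (0 - triangle p.+1) + (0 - triangle b) + (0 - triangle i))%R by rewrite
              addn1.
have s12 := single_comp (single_cast s3 e3 e3' erefl erefl)
  (single_cast s2 erefl erefl e2 erefl) (typed_serre_d_diag_bottom p b i).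
exact: single_comp s12 s1 (typed_serre_d_diag p b i).
Qed.

Lemma umor_serre_diff a b i : i < a ->
  umor (kcar (serre_obj a b i)) (kcar (serre_obj a b i.+1)) (serre_diff a b i).
Proof.
move=> ia; have e : a - i = (a - i.+1).+1 by lia.
rewrite !kcar_serre e; apply: (single_umor (single_serre_diff b e) (typed_serre_d_diag
  _ _ _)).
apply: hdeg_eq (hdeg_serre_d_diag _ _ _) _.
rewrite /serre_degree /serre_shift !triangleS.
have -> : (a%:Z = (a - i.+1)%N%:Z + i%:Z + 1)%R by lia.
rewrite -[Posz i.+1]/(Posz (1 + i)) PoszD; ring.
Qed.

Definition serre_back a b i : uarr :=
  UArr (kcar (serre_obj a b i.+1)) (kcar (serre_obj a b i))
    (fun _ _ => serre_h_diag (a - i.+1) b i (a - b - 1)).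

Lemma single_serre_back a b i p : a - i = p.+1 ->
  single (serre_word p b i.+1) (serre_degree a b p i.+1) (serre_word p.+1 b i)
    (serre_degree a b p.+1 i)
    (serre_h_diag p b i (a - b - 1)) (serre_back a b i).
Proof.
move=> e; have e1 : a - i.+1 = p by lia.
by rewrite /single /serre_back !kcar_serre e e1.
Qed.

Lemma umor_serre_back a b i : b < a -> i < a ->
  umor (kcar (serre_obj a b i.+1)) (kcar (serre_obj a b i)) (serre_back a b i).
Proof.
move=> ba ia; have e : a - i = (a - i.+1).+1 by lia.
rewrite !kcar_serre e; apply: (single_umor (single_serre_back b e) (typed_serre_h_diag
  _ _ _ _)).
apply: hdeg_eq (hdeg_serre_h_diag _ _ _ _) _.
rewrite /serre_degree /serre_shift !triangleS.
(* Here b < a is used: the number of dots is a truncated difference, and its true value is what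
   gives degree 0. *)
have -> : ((a - b - 1)%N%:Z = a%:Z - b%:Z - 1)%R by lia.
have -> : (a%:Z = (a - i.+1)%N%:Z + i%:Z + 1)%R by lia.
rewrite -[Posz i.+1]/(Posz (1 + i)) PoszD; ring.
Qed.

End SingleSummand.

Lemma kwf_serre a b i : kwf (serre_obj a b i).
Proof.
have h := single_serre_id a b i; split.
  apply: (single_umor h (typed_serre_e_diag _ _ _)).
  by apply: hdeg_eq (hdeg_serre_e_diag _ _ _) _; rewrite addrN.
apply: (single_ueq (single_comp h h _) h (deq_serre_e_diag _ _ _)).
by apply: typed_Comp; apply: typed_serre_e_diag.
Qed.

Lemma kmor_serre_diff a b i : i < a ->
  kmor (serre_obj a b i) (serre_obj a b i.+1) (serre_diff a b i).
Proof.
move=> ia; split; first exact: umor_serre_diff.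
have e : a - i = (a - i.+1).+1 by lia.
have h := single_serre_diff b e; have h1 := single_serre_id a b i.
have h2 := single_serre_id a b i.+1; rewrite e in h1.
have ty := typed_Comp (typed_serre_d_diag (a - i.+1) b i) (typed_serre_e_diag _ _ _).
have ty' := typed_Comp (typed_serre_e_diag _ _ _) ty.
exact: single_ueq (single_comp (single_comp h1 h ty) h2 ty') h (deq_serre_d_diag _ _ _).
Qed.

Lemma kmor_serre_back a b i : b < a -> i < a ->
  kmor (serre_obj a b i.+1) (serre_obj a b i) (serre_back a b i).
Proof.
move=> ba ia; split; first exact: umor_serre_back.
have e : a - i = (a - i.+1).+1 by lia.
have h := single_serre_back b e; have h1 := single_serre_id a b i.
have h2 := single_serre_id a b i.+1; rewrite e in h1.
have ty := typed_Comp (typed_serre_h_diag (a - i.+1) b i (a - b - 1))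
  (typed_serre_e_diag _ _ _).
have ty' := typed_Comp (typed_serre_e_diag _ _ _) ty.
exact: single_ueq (single_comp (single_comp h2 h ty) h1 ty') h (deq_serre_h_diag0 _ _
  _ _).
Qed.

Lemma serre_diff2 a b i : i.+1 < a ->
  ueq (ucomp (serre_diff a b i.+1) (serre_diff a b i))
      (uzero (kcar (serre_obj a b i)) (kcar (serre_obj a b i.+2))).
Proof.
move=> ia; have e : a - i = (a - i.+1).+1 by lia.
have e' : a - i.+1 = (a - i.+2).+1 by lia.
have h := single_serre_diff b e; have h' := single_serre_diff b e'.
rewrite e' in h e.
have ty := typed_Comp (typed_serre_d_diag (a - i.+2) b i.+1) (typed_serre_d_diag (a -
  i.+2).+1 b i).
apply: (single_ueq (single_comp h h' ty) _ (deq_serre_d_diag_serre_d_diag _ _ _)).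
by split; rewrite ?kcar_serre ?e.
Qed.

Lemma kwf_kzero : kwf kzero.
Proof. by split; split. Qed.

Lemma umor_empty X Y : X = [::] \/ Y = [::] -> umor X Y (uzero X Y).
Proof. by case=> ->; split. Qed.

Lemma ueq_empty f g : udom f = udom g -> ucod f = ucod g ->
  udom f = [::] \/ ucod f = [::] -> ueq f g.
Proof. by move=> e1 e2 h; split=> // p q; case: h => ->. Qed.

Lemma kmor_empty P Q : kwf P -> kwf Q -> kcar P = [::] \/ kcar Q = [::] ->
  kmor P Q (uzero (kcar P) (kcar Q)).
Proof.
move=> [[dP _ _] _] [[_ cQ _] _] h; split; first exact: umor_empty.
by apply: ueq_empty => //=; rewrite ?dP ?cQ.
Qed.

(** * The complex extended by zero objects *)

Section Complex.
Variables a b : nat.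
Hypothesis b_lt_a : b < a.
Local Notation C := (fin_obj a (serre_obj a b)).
Local Notation d := (fin_diff a (serre_obj a b) (serre_diff a b)).

Lemma kwf_fin n : kwf (C n).
Proof.
case: n => [k|k] /=; last exact: kwf_kzero.
by case: ifP => _; [apply: kwf_serre | apply: kwf_kzero].
Qed.

Lemma posz_succ k : (Posz k + 1)%R = Posz k.+1.
Proof. by rewrite -addn1. Qed.

Lemma fin_objE k : k <= a -> C (Posz k) = serre_obj a b k.
Proof. by move=> /= ->. Qed.

Lemma fin_obj_out k : a < k -> C (Posz k) = kzero.
Proof. by move=> /= h; rewrite leqNgt h. Qed.

Lemma fin_diffE k : k < a -> d (Posz k) = serre_diff a b k.
Proof. by rewrite /fin_diff => ->. Qed.

Lemma fin_diff_out n : ~~ (if n is Posz k then k < a else false) ->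
  d n = uzero (kcar (C n)) (kcar (C (n + 1)%R)).
Proof. by case: n => // k /= /negPf ->. Qed.

Lemma kmor_fin n : kmor (C n) (C (n + 1)%R) (d n).
Proof.
case: n => [k|k]; last first.
  by rewrite fin_diff_out //; apply: kmor_empty; [apply: kwf_fin..|left].
have [ka|ka] := ltnP k a.
  by rewrite posz_succ fin_diffE // !fin_objE ?(ltnW ka) //; apply: kmor_serre_diff.
rewrite fin_diff_out -?leqNgt //; apply: kmor_empty; [apply: kwf_fin..|right].
by rewrite posz_succ fin_obj_out.
Qed.

Lemma fin_diff2 n :
  ueq (ucomp (d (n + 1)%R) (d n)) (uzero (kcar (C n)) (kcar (C (n + 1 + 1)%R))).
Proof.
have [[dn _ _] _] := kmor_fin n; have [[_ cn _] _] := kmor_fin (n + 1)%R.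
case: n dn cn => [k|k] dn cn; last first.
  by apply: ueq_empty; [exact: dn | exact: cn | left; exact: dn].
have [ka|ka] := ltnP k.+1 a; last first.
  apply: ueq_empty; [exact: dn | exact: cn | right].
  by apply: etrans cn _; rewrite posz_succ fin_obj_out //; lia.
rewrite !posz_succ !fin_diffE ?(ltnW ka) // !fin_objE //; try lia.
exact: serre_diff2.
Qed.

Definition fin_back (n : int) : uarr :=
  let zero := uzero (kcar (C n)) (kcar (C (n - 1)%R)) in
  if n is Posz k.+1 then if k < a then serre_back a b k else zero else zero.

Lemma posz_pred k : (Posz k.+1 - 1)%R = Posz k.
Proof. by rewrite -posz_succ addrK. Qed.

Lemma kmor_back n : kmor (C n) (C (n - 1)%R) (fin_back n).
Proof.
have out : kcar (C n) = [::] \/ kcar (C (n - 1)%R) = [::] ->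
    kmor (C n) (C (n - 1)%R) (uzero (kcar (C n)) (kcar (C (n - 1)%R))).
  by apply: kmor_empty; apply: kwf_fin.
case: n out => [[|k]|k] out; [by apply: out; right| |by apply: out; left].
rewrite /fin_back; case: ltnP => ka; last by apply: out; rewrite fin_obj_out //; left.
by rewrite posz_pred !fin_objE ?(ltnW ka) //; apply: kmor_serre_back.
Qed.

Definition htpy_left n := ucomp (d (n - 1)%R) (fin_back n).
Definition htpy_right n := ucomp (fin_back (n + 1)%R) (d n).

Lemma htpy_typed n :
  [/\ udom (htpy_left n) = kcar (C n), ucod (htpy_left n) = kcar (C n),
      udom (htpy_right n) = kcar (C n) & ucod (htpy_right n) = kcar (C n)].
Proof.
have [[dh ch _] _] := kmor_back n; have [[dh' ch' _] _] := kmor_back (n + 1)%R.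
have [[dd cd _] _] := kmor_fin n; have [[dd' cd' _] _] := kmor_fin (n - 1)%R.
by rewrite subrK in cd'; rewrite addrK in ch'; split.
Qed.

Lemma umx_ucomp0 g f : ucod f = [::] ->
  umx (ucomp g f) 0 0 = Zero (uword (udom f) 0) (uword (ucod g) 0).
Proof. by move=> e; rewrite /= e big_ord0. Qed.

(** At position 0 the composite dh passes through a zero object, so its entry is an empty sum. The
    same happens to hd at the other end. *)
Lemma single_left_zero A s : kcar (C 0%R) = [:: (A, s)] ->
  single A s A s (Zero A A) (htpy_left 0%R).
Proof.
move=> e; have [dl cl _ _] := htpy_typed 0%R; have [[_ ch _] _] := kmor_back 0%R.
split; rewrite ?dl ?cl //.
by rewrite umx_ucomp0 ?ch // -/(udom (htpy_left 0%R)) -/(ucod (htpy_left 0%R)) dl cl e.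
Qed.

Lemma single_right_zero k A s : a <= k -> kcar (C (Posz k)) = [:: (A, s)] ->
  single A s A s (Zero A A) (htpy_right (Posz k)).
Proof.
move=> ak e; have [_ _ dr cr] := htpy_typed (Posz k); have [[_ cd _] _]
  := kmor_fin (Posz k).
split; rewrite ?dr ?cr // umx_ucomp0.
  by rewrite -/(udom (htpy_right k)) -/(ucod (htpy_right k)) dr cr e.
by rewrite cd posz_succ fin_obj_out.
Qed.

(** Outside 0, ..., a the objects are empty. At 0 only hd remains, at a only dh, and in between both
    thick strands are present. In each case the condition on the dots is m + b = a - 1. *)
Lemma homotopy_fin n : ueq (kid (C n)) (uadd (htpy_left n) (htpy_right n)).
Proof.
have [[dk ck _] _] := kwf_fin n; have [dl cl dr cr] := htpy_typed n.
have out : kcar (C n) = [::] -> ueq (kid (C n)) (uadd (htpy_left n) (htpy_right n)).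
  by move=> e; apply: ueq_empty; [rewrite [RHS]dl | rewrite [RHS]cl | left; rewrite dk].
case: n dk ck dl cl dr cr out => [k|k] dk ck dl cl dr cr out; last exact: out.
have [ka|ka] := leqP k a; last by apply: out; rewrite fin_obj_out.
have idk := single_serre_id a b k; rewrite -fin_objE // in idk.
have eC : kcar (C (Posz k)) = [:: (serre_word (a - k) b k, serre_degree a b (a - k) k)].
  by rewrite fin_objE // kcar_serre.
case: k ka {dk ck dl cl dr cr out} idk eC => [|k] ka idk eC.
  have e : a - 0 = a.-1.+1 by lia.
  rewrite e in idk eC.
  have hr := single_comp (single_serre_diff b e) (single_serre_back b e)
    (typed_Comp (typed_serre_h_diag _ _ _ _) (typed_serre_d_diag _ _ _)).
  have er : htpy_right 0%R = ucomp (serre_back a b 0) (serre_diff a b 0).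
    have a0 : 0 < a by lia.
    by rewrite /htpy_right (posz_succ 0) /fin_back a0 fin_diffE.
  rewrite -er in hr.
  apply: (single_ueq idk (single_add (single_left_zero eC) hr)).
  rewrite deq_add0r; first by apply: deq_first; lia.
  exact: typed_Comp (typed_serre_h_diag _ _ _ _) (typed_serre_d_diag _ _ _).
have el : htpy_left k.+1 = ucomp (serre_diff a b k) (serre_back a b k).
  by rewrite /htpy_left posz_pred /fin_back ka fin_diffE.
have [eka|ka'] := eqVneq k.+1 a.
  have e : a - k = 1 by lia.
  have hl := single_comp (single_serre_back b e) (single_serre_diff b e)
    (typed_Comp (typed_serre_d_diag _ _ _) (typed_serre_h_diag _ _ _ _)).
  rewrite -el in hl.
  have e0 : a - k.+1 = 0 by lia.
  rewrite e0 in idk eC.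
  apply: (single_ueq idk (single_add hl (single_right_zero _ eC)));
    first by rewrite eka.
  rewrite deq_addr0; first by apply: deq_last; lia.
  exact: typed_Comp (typed_serre_d_diag _ _ _) (typed_serre_h_diag _ _ _ _).
have ka2 : k.+1 < a by lia.
(* With p = a - k - 2 and q = k the object has thicknesses p+1 and q+1, as [deq_mid] requires. *)
have e : a - k.+1 = (a - k.+2).+1 by lia.
have e' : a - k = (a - k.+2).+2 by lia.
have hl := single_comp (single_serre_back b e') (single_serre_diff b e')
  (typed_Comp (typed_serre_d_diag _ _ _) (typed_serre_h_diag _ _ _ _)).
have hr := single_comp (single_serre_diff b e) (single_serre_back b e)
  (typed_Comp (typed_serre_h_diag _ _ _ _) (typed_serre_d_diag _ _ _)).
have er : htpy_right k.+1 = ucomp (serre_back a b k.+1) (serre_diff a b k.+1).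
  by rewrite /htpy_right posz_succ /fin_back ka2 fin_diffE.
rewrite -el in hl; rewrite -er in hr; rewrite e in idk.
apply: (single_ueq idk (single_add hl hr)).
by apply: deq_mid; lia.
Qed.

End Complex.

Theorem theorem6 (a b : nat) (b_gt0 : (0 < b)%N) (b_lt_a : (b < a)%N) :
  is_complex (fin_obj a (serre_obj a b)) (fin_diff a (serre_obj a b) (serre_diff a b))
  /\ null_homotopic (fin_obj a (serre_obj a b))
                    (fin_diff a (serre_obj a b) (serre_diff a b)).
Proof.
split; first by split; [apply: kwf_fin | apply: kmor_fin | apply: fin_diff2].
by exists (fin_back a b); [apply: kmor_back | apply: homotopy_fin].
Qed.
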